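(* For every $\beta>0$ and every $\varepsilon\in]0,\beta[$ there exist sets $\mathcal C,\mathcal C'\subset[0,1]^2$ with $\dim_{\mathcal H}\mathcal C<2$ and $\mathcal H^{h_{2,\beta}}(\mathcal C')>0$, where $h_{2,\beta}(t)=t^2(\log\log(1/t))^\beta$, and a mapping of finite distortion $f\in W^{1,1}([0,1]^2;\mathbb{R}^2)$ such that $$ e^{\frac{K_f}{1+\log K_f}}\in L^{\beta-\varepsilon}_{\mathrm{loc}}(]0,1[^2) $$ and $f(\mathcal C)=\mathcal C'$.
   Context: Mapping of finite distortion (in dimension $2$): a continuous mapping $f$ of class $W^{1,1}_{\mathrm{loc}}$ whose Jacobian determinant $J_f=\det Df$ is locally integrable and for which there exists a measurable function $K$ with values in $[1,\infty[$ such that $|Df(x)|^2\le K(x)J_f(x)$ for almost every $x$ ($|Df(x)|$ is the operator norm). The distortion function $K_f$ is the smallest such function: $K_f(x)=|Df(x)|^2/J_f(x)$ where $J_f(x)>0$ and $K_f(x)=1$ otherwise. For $f$ defined on $[0,1]^2$, continuity is meant on $[0,1]^2$ and the Sobolev and distortion conditions on the interior $]0,1[^2$. Generalized Hausdorff measure: for a dimension gauge $h$ (non-decreasing, $\lim_{t\to0+}h(t)=h(0)=0$) and a set $A\subset\mathbb{R}^2$, $\mathcal H^h(A)=\lim_{\delta\to0}\mathcal H^h_\delta(A)$, where $\mathcal H^h_\delta(A)=\inf\{\sum_{i=1}^\infty h(\operatorname{diam}U_i): A\subset\bigcup_{i=1}^\infty U_i,\ \operatorname{diam}U_i\le\delta\}$.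 The function $h_{2,\beta}$ is used as a gauge for small $t>0$ (where it is defined and non-decreasing), with $h_{2,\beta}(0)=0$; only its values for small $t$ matter. $\dim_{\mathcal H}$ is the usual Hausdorff dimension. *)

(* Defs.v *)
From mathcomp Require Import all_boot all_order all_algebra.
From mathcomp Require Import all_classical all_reals all_analysis.

Set Implicit Arguments.
Unset Strict Implicit.
Unset Printing Implicit Defensive.

Import Order.TTheory GRing.Theory Num.Theory.
Import numFieldNormedType.Exports.

Local Open Scope classical_set_scope.
Local Open Scope ring_scope.

Definition closed_square (R : realType) : set (R * R) :=
  `[0, 1] `*` `[0, 1].

Definition open_square (R : realType) : set (R * R) :=
  `]0, 1[ `*` `]0, 1[.

Arguments closed_square : clear implicits.
Arguments open_square : clear implicits.

Definition coord (R : realType) (i : 'I_2) (x : R * R) : R :=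
  if i == 0 then x.1 else x.2.

Definition basis_vec (R : realType) (j : 'I_2) : R * R :=
  ((j == 0)%:R, (j != 0)%:R).

(* The library norms on [R * R] and on matrices are maximum norms (they induce
   the usual topology), hence an explicit Euclidean norm for diameters and
   operator norms. *)
Definition eucl_norm (R : realType) (v : 'cV[R]_2) : R :=
  Num.sqrt (\sum_i v i 0 ^+ 2).

Definition eucl_dist (R : realType) (x y : R * R) : R :=
  eucl_norm (\col_i coord i (x - y)).

Definition op_norm (R : realType) (A : 'M[R]_2) : R :=
  sup [set eucl_norm (A *m v) | v in [set v | eucl_norm v <= 1]].

(* Adjoining [0] gives the empty set diameter [0] rather than [-oo]. *)
Definition diam (R : realType) (U : set (R * R)) : \bar R :=
  ereal_sup ([set 0%E] `|` [set (eucl_dist x y)%:E | x in U & y in U]).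

Definition hausdorff_delta (R : realType) (h : R -> R) (delta : R)
    (A : set (R * R)) : \bar R :=
  ereal_inf [set (\sum_(0 <= i <oo) (h (fine (diam (U i))))%:E)%E
    | U in [set U : nat -> set (R * R) |
        A `<=` \bigcup_i U i /\ forall i, (diam (U i) <= delta%:E)%E]].

Definition hausdorff_measure (R : realType) (h : R -> R)
    (A : set (R * R)) : \bar R :=
  lim (hausdorff_delta h delta A @[delta --> 0^'+]).

(* The exponent [s = 0] is left out because [t `^ 0 = 1] at [t = 0]; this does
   not change the infimum. *)
Definition hausdorff_dim (R : realType) (A : set (R * R)) : \bar R :=
  ereal_inf [set s%:E | s in
    [set s : R | 0 < s /\ hausdorff_measure (fun t => t `^ s) A = 0%E]].

(* Only small [t] matter: for [t >= expR (- 1)] the iterated logarithm is not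
   positive and the value is conventional. *)
Definition h2 (R : realType) (beta t : R) : R :=
  if t <= 0 then 0 else t ^+ 2 * ln (ln t^-1) `^ beta.

Notation leb2 R :=
  ((@lebesgue_measure R) \x (@lebesgue_measure R))%E (only parsing).

Definition L1_loc (R : realType) (Omega : set (R * R)) (g : R * R -> R) :=
  measurable_fun Omega g /\
  forall K : set (R * R), compact K -> K `<=` Omega ->
    (leb2 R).-integrable K (EFin \o g).

Definition Lp_loc (R : realType) (p : R) (Omega : set (R * R))
    (g : R * R -> R) :=
  measurable_fun Omega g /\ L1_loc Omega (fun x => `|g x| `^ p).

Definition iter_partial (R : realType) (s : seq 'I_2) (phi : R * R -> R) :
    R * R -> R :=
  foldr (fun j (g : R * R -> R) (x : R * R) => 'D_(basis_vec R j) g x) phi s.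

(* C^oo functions with compact support in [Omega]; differentiability of all the
   iterated partial derivatives also gives their continuity. *)
Definition test_function (R : realType) (Omega : set (R * R))
    (phi : R * R -> R) :=
  [/\ forall (s : seq 'I_2) (x : R * R), differentiable (iter_partial s phi) x,
      compact (closure [set x | phi x != 0]) &
      closure [set x | phi x != 0] `<=` Omega].

Definition weak_partial (R : realType) (Omega : set (R * R)) (j : 'I_2)
    (u g : R * R -> R) :=
  forall phi : R * R -> R, test_function Omega phi ->
    \int[leb2 R]_(x in Omega) (u x * 'D_(basis_vec R j) phi x) =
    - \int[leb2 R]_(x in Omega) (g x * phi x).

(* [Df] is a representative of the weak differential, [Df x i j] being the
   [j]-th weak partial derivative of the [i]-th component of [f]. *)
Definition weak_differential (R : realType) (Omega : set (R * R))
    (f : R * R -> R * R) (Df : R * R -> 'M[R]_2) :=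
  forall i j : 'I_2, weak_partial Omega j (coord i \o f) (fun x => Df x i j).

Definition sobolev11_loc (R : realType) (Omega : set (R * R))
    (f : R * R -> R * R) (Df : R * R -> 'M[R]_2) :=
  [/\ forall i : 'I_2, L1_loc Omega (coord i \o f),
      forall i j : 'I_2, L1_loc Omega (fun x => Df x i j) &
      weak_differential Omega f Df].

Definition sobolev11 (R : realType) (Omega : set (R * R))
    (f : R * R -> R * R) (Df : R * R -> 'M[R]_2) :=
  [/\ forall i : 'I_2, (leb2 R).-integrable Omega (EFin \o (coord i \o f)),
      forall i j : 'I_2,
        (leb2 R).-integrable Omega (EFin \o (fun x => Df x i j)) &
      weak_differential Omega f Df].

Definition finite_distortion (R : realType) (S : set (R * R))
    (f : R * R -> R * R) (Df : R * R -> 'M[R]_2) :=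
  [/\ {within S, continuous f},
      sobolev11_loc S° f Df,
      L1_loc S° (fun x => \det (Df x)) &
      exists K : R * R -> R,
        [/\ measurable_fun S° K,
            forall x, S° x -> 1 <= K x &
            {ae leb2 R, forall x, S° x ->
              op_norm (Df x) ^+ 2 <= K x * \det (Df x)}]].

Definition distortion (R : realType) (Df : R * R -> 'M[R]_2) (x : R * R) : R :=
  if 0 < \det (Df x) then op_norm (Df x) ^+ 2 / \det (Df x) else 1.

(* Main.v *)
Require Import Defs.
From mathcomp Require Import all_boot all_order all_algebra.
From mathcomp Require Import all_classical all_reals all_analysis.
From mathcomp Require Import measurable_realfun ring lra.

Set Implicit Arguments.
Unset Strict Implicit.
Unset Printing Implicit Defensive.

Import Order.TTheory GRing.Theory Num.Theory.
Import numFieldNormedType.Exports.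

Local Open Scope classical_set_scope.
Local Open Scope ring_scope.

(* The map is [f (x, y) = (F (x, y), F (y, x))], where [F (x, y)] is
   [x + \sum_j cut_j y * disp_j x]. With all cutoffs equal to 1, [F] would be the
   monotone function of [x] carrying a Cantor set, in which every interval keeps the
   fraction [sg] in each of its [N] children, onto a fatter one that keeps the fraction
   [1 - (1 - sg) * m_j] at generation [j]. The product of the first Cantor set with itself
   has dimension less than 2. The cutoff [cut_j] confines the displacement of generation
   [j] to the neighbourhood of the squares of that generation; since it vanishes
   quadratically at their boundary, the square of the shear it creates is bounded by the
   diagonal entry of [Df], and the distortion is at most [L / m_b] between generations
   [b] and [b + 1], with [L] close to 1 for [sg] close to 1 and [N] large. That region
   has measure at most [sg ^ (2 b)].

   Let [k = b + 1 + j0] and [w = 1 - sg]. For [m_b] close to [beta / (2 * w * k * ln k)]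
   one has [K / (1 + ln K) <= (2 * L * w / beta) * (k + O(1))] in that region, so the
   exponential to the power [p = beta - eps] is integrable as soon as [p * L < beta]. On
   the other hand [\prod_(j < n) (1 - w * m_j)] is of order [(ln n) ^ (- beta / 2)], so
   an image square of generation [n] has side [t] of order [N ^ (- n) * (ln n) ^ (- beta / 2)]
   while it carries the mass [N ^ (- 2 * n)], of order [t ^ 2 * (ln n) ^ beta]; as [n] is of
   order [ln (1 / t)], this is the value of the gauge, and the mass distribution principle
   applies. *)

(** The obstacle is that the plain product of two one-dimensional Cantor maps has unbounded
    distortion: where one coordinate has left the construction early and the other is still being
    refined, the ratio of the two slopes grows without bound. A cutoff in the other variable stops
    the refinement once either coordinate has left: generation [b + 1] is the last active one at
    level [b], and the differential is triangular there. Weak derivatives are computed for the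
    partial sums, which are sums of tensor products of piecewise polynomials, by Fubini and
    one-dimensional integration by parts. The limit is taken by dominated convergence: [slope j]
    lives on a set of measure at most [sg ^ (2 * j)], and [slope j * sg ^ j] is at most 1. For the
    Jacobian, the factor [m_b] makes the sum over the levels telescope. The lower bound for the
    image constructs no measure: base [N] digits parametrize Cantor points by the unit square, so a
    cover of the image becomes a cover of the square by rectangles, where Lebesgue measure is
    available. *)

Section plane_measurability.
Context {R : realType}.

(** The measurable structure of the plane is the product one, so an open set has to be exhibited as
    a countable union of rectangles: the balls of the maximum norm with rational centre and radius
    that it contains. *)
Lemma open_measurable_plane (U : set (R * R)) : open U -> measurable U.
Proof.
move=> oU.
pose box (q : rat * rat * rat) : set (R * R) :=
  ball (ratr q.1.1 : R) (ratr q.2 : R) `*` ball (ratr q.1.2 : R) (ratr q.2 : R).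
have -> : U = \bigcup_(q in [set q | box q `<=` U]) box q.
  apply/seteqP; split => [[x y] Uxy|z [q /= qU]]; last exact: qU.
  have /nbhs_ballP[e /= e0 eU] := open_nbhs_nbhs (conj oU Uxy).
  (* A radius [r < e / 2] and a centre within [r] of the point put the whole box within [2 * r < e]
     of it. *)
  have [r] := @rat_in_itvoo R 0 (e / 2) ltac:(by rewrite divr_gt0).
  rewrite in_itv/= => /andP[r0 re].
  have [a] := @rat_in_itvoo R x (x + ratr r) ltac:(by rewrite ltrDl).
  rewrite in_itv/= => /andP[xa ax].
  have [b] := @rat_in_itvoo R y (y + ratr r) ltac:(by rewrite ltrDl).
  rewrite in_itv/= => /andP[yb by_].
  exists (a, b, r) => /=; last first.
    by split; rewrite /ball/= ltr_norml; apply/andP; split; lra.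
  move=> [u v] [/=]; rewrite /ball/= => ua vb; apply: eU; split => /=;
    rewrite /ball/=; move: ua vb; rewrite !ltr_norml => /andP[? ?] /andP[? ?];
    by apply/andP; split; lra.
rewrite bigcup_mkcond; apply: countable_bigcupT_measurable => // q.
by case: ifP => // _; apply: measurableX; exact: measurable_ball.
Qed.

Lemma closed_measurable_plane (U : set (R * R)) : closed U -> measurable U.
Proof.
by move=> cU; rewrite -[U]setCK; apply: measurableC; apply: open_measurable_plane;
  rewrite openC.
Qed.

Lemma compact_measurable_plane (K : set (R * R)) : compact K -> measurable K.
Proof. move=> cK; apply: closed_measurable_plane; apply: (compact_closed _ cK).
exact: (@norm_hausdorff R (R * R)%type).
Qed.

Lemma continuous_measurable_plane (u : R * R -> R) :
  continuous u -> measurable_fun setT u.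
Proof.
move=> /continuousP cu; apply: (measurability _ (RGenOpens.measurableE R)).
move=> _ [_ [a [b ->] <-]]; rewrite setTI; apply: open_measurable_plane.
exact/cu/interval_open.
Qed.

Lemma interior_closed_square : (closed_square R)° = open_square R.
Proof.
apply/seteqP; split => [[x y]|[x y] [/= xo yo]].
  rewrite /interior /= => -[[A B] /= [nA nB] AB].
  have bx := nbhs_singleton nA; have by_ := nbhs_singleton nB.
  split => /=.
    have : (`[0, 1]%classic : set R)° x.
      by apply: filterS nA => z Az; have [] := AB (z, y) (conj Az by_).
    by rewrite interior_itv.
  have : (`[0, 1]%classic : set R)° y.
    by apply: filterS nB => z Bz; have [] := AB (x, z) (conj bx Bz).
  by rewrite interior_itv.
exists (`[0, 1]%classic, `[0, 1]%classic) => //=; split.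
- have : (`[0, 1]%classic : set R)° x by rewrite interior_itv.
  by [].
- have : (`[0, 1]%classic : set R)° y by rewrite interior_itv.
  by [].
Qed.

Lemma measurable_open_square : measurable (open_square R).
Proof. by apply: measurableX. Qed.

End plane_measurability.

(** * Integration by parts for piecewise polynomials on the unit interval *)

Section piecewise_polynomial.
Context {R : realType}.
Notation mu := (@lebesgue_measure R).

Definition ramp (p x : R) : R := if p <= x then x - p else 0.

(* Pairs of a continuous piecewise polynomial function and its right derivative. *)
Inductive pw_poly : (R -> R) -> (R -> R) -> Prop :=
| pw_cst c : pw_poly (cst c) (cst 0)
| pw_id : pw_poly id (cst 1)
| pw_ramp p : pw_poly (ramp p) (fun x : R => (p <= x)%R%:R)
| pw_ramp2 p : pw_poly (fun x => ramp p x ^+ 2) (fun x => 2 * ramp p x)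
| pw_add u u' v v' : pw_poly u u' -> pw_poly v v' ->
    pw_poly (fun x => u x + v x) (fun x => u' x + v' x)
| pw_scale c u u' : pw_poly u u' -> pw_poly (fun x => c * u x) (fun x => c * u' x).

Lemma pw_eq u u' v v' : u =1 v -> u' =1 v' -> pw_poly u u' -> pw_poly v v'.
Proof. by move=> /funext -> /funext ->. Qed.

Lemma pw_sum (n : nat) (u u' : nat -> R -> R) :
  (forall i, pw_poly (u i) (u' i)) ->
  pw_poly (fun x => \sum_(i < n) u i x) (fun x => \sum_(i < n) u' i x).
Proof.
move=> uu'; elim: n => [|n ih].
  by apply: pw_eq (pw_cst 0) => x; rewrite big_ord0.
by apply: pw_eq (pw_add ih (uu' n)) => x; rewrite big_ord_recr.
Qed.

Lemma ramp_affine a b p x : 0 < a -> ramp p (a * x - b) = a * ramp ((b + p) / a) x.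
Proof.
move=> a0; rewrite /ramp ler_pdivrMr// mulrC lerBrDr addrC.
by case: ifPn => _; [field; rewrite gt_eqF|rewrite mulr0].
Qed.

Lemma pw_comp_affine a b u u' : 0 < a -> pw_poly u u' ->
  pw_poly (fun x => u (a * x - b)) (fun x => a * u' (a * x - b)).
Proof.
move=> a0; elim => {u u'} [c||p|p|u u' v v' _ ihu _ ihv|c u u' _ ihu].
- by apply: pw_eq (pw_cst c) => x /=; rewrite ?mulr0.
- apply: (pw_eq _ _ (pw_add (pw_scale a pw_id) (pw_cst (- b)))) => x //=.
  by rewrite addr0.
- apply: (pw_eq _ _ (pw_scale a (pw_ramp ((b + p) / a)))) => x.
    by rewrite ramp_affine.
  by rewrite ler_pdivrMr// lerBrDr addrC (mulrC x).
- apply: (pw_eq _ _ (pw_scale (a ^+ 2) (pw_ramp2 ((b + p) / a)))) => x.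
    by rewrite ramp_affine// exprMn.
  by rewrite ramp_affine//; ring.
- by apply: pw_eq (pw_add ihu ihv) => x; rewrite // mulrDr.
- by apply: pw_eq (pw_scale c ihu) => x; rewrite // mulrCA.
Qed.

Lemma ramp_maxr p x : ramp p x = Num.max 0 (x - p).
Proof.
rewrite /ramp; case: ifPn; first by move=> ?; rewrite max_r// subr_ge0.
by rewrite -ltNge => ?; rewrite max_l// subr_le0 ltW.
Qed.

Lemma continuous_ramp p : continuous (ramp p).
Proof.
rewrite (_ : ramp p = fun x => Num.max 0 (x - p)); last first.
  by apply/funext => x; rewrite ramp_maxr.
move=> x; apply: (@continuous_max _ _ (fun=> 0) (fun x => x - p)); first exact: cvg_cst.
by apply: cvgB; [exact: cvg_id|exact: cvg_cst].
Qed.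

Lemma pw_continuous u u' : pw_poly u u' -> continuous u.
Proof.
elim => {u u'} [c||p|p|u u' v v' _ ihu _ ihv|c u u' _ ihu] x.
- exact: cvg_cst.
- exact: cvg_id.
- exact: continuous_ramp.
- by rewrite /continuous_at expr2; apply: cvgM; exact: continuous_ramp.
- by apply: cvgD; [exact: ihu|exact: ihv].
- by apply: cvgM; [exact: cvg_cst|exact: ihu].
Qed.

Lemma pw_measurable u u' : pw_poly u u' -> measurable_fun setT u.
Proof. by move=> /pw_continuous/continuous_measurable_fun. Qed.

Lemma pw_measurable_derive u u' : pw_poly u u' -> measurable_fun setT u'.
Proof.
elim => {u u'} [c||p|p|u u' v v' _ ihu _ ihv|c u u' _ ihu].
- exact: measurable_cst.
- exact: measurable_cst.
- rewrite (_ : (fun x => _) = \1_(`[p, +oo[%classic)); last first.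
    by apply/funext => x; rewrite indicE mem_setE in_itv/= andbT.
  exact: measurable_indic.
- apply: measurable_funM => //; apply: continuous_measurable_fun.
  exact: continuous_ramp.
- exact: measurable_funD.
- by apply: measurable_funM.
Qed.

Definition bounded01 (u : R -> R) := exists M, forall x, 0 <= x <= 1 -> `|u x| <= M.

Lemma ramp_bounded01 p : bounded01 (ramp p).
Proof.
exists (1 + `|p|) => x /andP[x0 x1]; rewrite /ramp; case: ifPn => _.
  by rewrite (le_trans (ler_normB _ _))// lerD2r ger0_norm.
by rewrite normr0 addr_ge0.
Qed.

Lemma pw_bounded u u' : pw_poly u u' -> bounded01 u /\ bounded01 u'.
Proof.
elim => {u u'} [c||p|p|u u' v v' _ ihu _ ihv|c u u' _ ihu].
- by split; [exists (`|c|) | exists 0 => *; rewrite normr0].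
- split; first by exists 1 => x /andP[? ?]; rewrite ger0_norm.
  by exists 1 => *; rewrite normr1.
- split; first exact: ramp_bounded01.
  by exists 1 => x _; case: (p <= x); rewrite ?normr1 ?normr0 /=.
- have [M rM] := ramp_bounded01 p; split.
    by exists (M ^+ 2) => x /rM ?; rewrite normrX !expr2 ler_pM.
  by exists (2 * M) => x /rM ?; rewrite normrM ger0_norm// ler_pM2l.
- move: ihu ihv => [[a ha] [a' ha']] [[b hb] [b' hb']].
  split; [exists (a + b)|exists (a' + b')] => x hx; rewrite (le_trans (ler_normD _ _))//;
    by rewrite lerD ?ha ?hb ?ha' ?hb'.
- move: ihu => [[a ha] [a' ha']].
  split; [exists (`|c| * a)|exists (`|c| * a')] => x hx; rewrite normrM;
    by rewrite ler_wpM2l ?ha ?ha'.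
Qed.

Lemma derivable_LR (F : R -> R) a b : (forall x : R, derivable F x 1) ->
  derivable_oo_LRcontinuous F a b.
Proof.
move=> dF; have cF x : {for x, continuous F}.
  by apply: differentiable_continuous; apply/derivable1_diffP.
by split => [x _//||]; [apply: cvg_at_right_filter|apply: cvg_at_left_filter]; exact: cF.
Qed.

Lemma Rintegral_oo_cc (u : R -> R) : measurable_fun setT u ->
  \int[mu]_(x in `]0, 1[) u x = \int[mu]_(x in `[0, 1]) u x.
Proof.
move=> /measurable_EFinP mu_; rewrite /Rintegral; congr fine.
rewrite integral_itv_obnd_cbnd; last exact: measurable_funTS.
by rewrite integral_itv_bndo_bndc//; exact: measurable_funTS.
Qed.

Lemma measurable_cut (p : R) (u : R -> R) : measurable_fun setT u ->
  measurable_fun setT (fun x : R => if p <= x then u x else 0).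
Proof. by move=> mu_; apply: measurable_fun_ifT => //; exact: measurable_fun_ler. Qed.

Lemma Rintegral_cut (u : R -> R) (p : R) : measurable_fun setT u ->
  \int[mu]_(x in `]0, 1[) (if p <= x then u x else 0) =
  \int[mu]_(x in `[Num.max p 0, 1]) u x.
Proof.
move=> mu_; rewrite Rintegral_oo_cc; last exact: measurable_cut.
rewrite Rintegral_mkcond [RHS]Rintegral_mkcond; congr Rintegral.
apply/funext => x; rewrite /patch !mem_setE !in_itv/= ge_max.
by case: (p <= x) => //=; case: ifP.
Qed.

(** On [[max p 0, 1]] the cut function is smooth, so ordinary integration by parts applies. The
    boundary term vanishes at 1 because of [psi]; at [max p 0] it vanishes because of [psi] when
    [p <= 0] and because of [F] otherwise. *)
Lemma ibp_smooth_cut (F f psi psi' : R -> R) (p : R) :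
  (forall x : R, is_derive x (1 : R) F (f x)) -> continuous f ->
  (forall x : R, is_derive x (1 : R) psi (psi' x)) -> continuous psi' ->
  psi 0 = 0 -> psi 1 = 0 -> F p = 0 \/ p <= 0 ->
  \int[mu]_(x in `]0, 1[) ((if p <= x then F x else 0) * psi' x) =
  - \int[mu]_(x in `]0, 1[) ((if p <= x then f x else 0) * psi x).
Proof.
move=> dF cf dpsi cpsi' psi0 psi1 Fp.
have dF1 x : derivable F x 1 by case: (dF x).
have dpsi1 x : derivable psi x 1 by case: (dpsi x).
have cF : continuous F.
  by move=> x; apply: differentiable_continuous; apply/derivable1_diffP.
have cpsi : continuous psi.
  by move=> x; apply: differentiable_continuous; apply/derivable1_diffP.
under eq_Rintegral do rewrite (fun_if ( *%R^~ _)) mul0r.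
under [in RHS]eq_Rintegral do rewrite (fun_if ( *%R^~ _)) mul0r.
rewrite !Rintegral_cut; try by apply: measurable_funM; exact: continuous_measurable_fun.
have [c1|c1] := ltP (Num.max p 0) 1; last first.
  have [{}c1|c1'] := eqVneq (Num.max p 0) 1.
    by rewrite c1 set_itv1 !Rintegral_set1 oppr0.
  by rewrite set_itv_ge ?Rintegral_set0 ?oppr0// bnd_simp -ltNge lt_neqAle eq_sym c1'.
rewrite (@Rintegration_by_parts _ F psi f psi')//.
- rewrite psi1 mulr0; case: (leP p 0) => [_|p0]; first by rewrite psi0 mulr0 subrr sub0r.
  by case: Fp => [->|]; [rewrite mul0r subrr sub0r|rewrite leNgt p0].
- exact: continuous_subspaceT.
- exact: derivable_LR.
- by move=> x _; rewrite derive1E; case: (dF x).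
- exact: continuous_subspaceT.
- exact: derivable_LR.
- by move=> x _; rewrite derive1E; case: (dpsi x).
Qed.

Definition ibp01 (u u' : R -> R) := forall psi psi' : R -> R,
  (forall x : R, is_derive x (1 : R) psi (psi' x)) -> continuous psi' ->
  psi 0 = 0 -> psi 1 = 0 ->
  \int[mu]_(x in `]0, 1[) (u x * psi' x) = - \int[mu]_(x in `]0, 1[) (u' x * psi x).

Lemma bounded01_integrable (u v : R -> R) : measurable_fun setT u -> bounded01 u ->
  continuous v -> mu.-integrable `]0, 1[ (EFin \o (fun x => u x * v x)).
Proof.
move=> mu_ [M uM] cv; apply: measurable_bounded_integrable => //.
- have := @lebesgue_measure_itv R `]0%R, 1%R[.
  by rewrite /= lte_fin ltr01 sube0 => ->; rewrite ltry.
- by apply: measurable_funTS; apply: measurable_funM => //; exact: continuous_measurable_fun.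
- have [||m _ mM] := @EVT_max _ (fun x => `|v x|) 0 1 => //.
    apply: continuous_subspaceT => x; apply: cvg_norm; exact: cv.
  exists (M * `|v m|); split; first exact: num_real.
  move=> y yM x /=; rewrite in_itv/= => /andP[x0 x1].
  rewrite (le_trans _ (ltW yM))// normrM ler_pM// ?uM ?mM//.
    by rewrite !ltW.
  by rewrite in_itv/= !ltW.
Qed.

Lemma pw_ibp u u' : pw_poly u u' -> ibp01 u u'.
Proof.
elim => {u u'} [c||p|p|u u' v v' uu' ihu vv' ihv|c u u' uu' ihu] psi psi' dpsi cpsi' psi0 psi1.
(* The threshold -1 lies to the left of the unit interval, so the cut is invisible there and an
   uncut function is a special case. *)
- have := @ibp_smooth_cut (cst c) (cst 0) psi psi' (-1) _ _ dpsi cpsi' psi0 psi1.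
  have e (w : R -> R) z : (\int[mu]_(x in `]0, 1[) ((if -1 <= x then w x else 0) * z x) =
     \int[mu]_(x in `]0, 1[) (w x * z x)).
    apply: eq_Rintegral => x; rewrite inE/= in_itv/= => /andP[x0 _].
    by rewrite ifT//; lra.
  rewrite !e; apply => //.
  + exact: cst_continuous.
  + by right; lra.
- have := @ibp_smooth_cut id (cst 1) psi psi' (-1) _ _ dpsi cpsi' psi0 psi1.
  have e (w : R -> R) z : (\int[mu]_(x in `]0, 1[) ((if -1 <= x then w x else 0) * z x) =
     \int[mu]_(x in `]0, 1[) (w x * z x)).
    apply: eq_Rintegral => x; rewrite inE/= in_itv/= => /andP[x0 _].
    by rewrite ifT//; lra.
  rewrite !e; apply => //.
  + exact: cst_continuous.
  + by right; lra.
- have dF (x : R) : is_derive x (1 : R) (fun x => x - p) (cst 1 x).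
    by apply: is_derive_eq; rewrite subr0.
  rewrite /ramp (ibp_smooth_cut dF _ dpsi)//.
  + congr (- _); apply: eq_Rintegral => x _; by case: (p <= x).
  + exact: cst_continuous.
  + by left; rewrite subrr.
- have dF (x : R) : is_derive x (1 : R) (fun x => (x - p) ^+ 2) (2 * (x - p)).
    by apply: is_derive_eq; rewrite /= subr0 /GRing.scale/=; ring.
  rewrite (_ : \int[mu]_(x in _) _ =
    \int[mu]_(x in `]0, 1[) ((if p <= x then (x - p) ^+ 2 else 0) * psi' x)); last first.
    by apply: eq_Rintegral => x _; rewrite /ramp; case: (p <= x) => //; rewrite expr0n.
  rewrite (ibp_smooth_cut dF _ dpsi)//.
  + congr (- _); apply: eq_Rintegral => x _; rewrite /ramp; by case: (p <= x) => //; rewrite mulr0.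
  + move=> x; apply: cvgM; first exact: cvg_cst.
    by apply: cvgB; [exact: cvg_id|exact: cvg_cst].
  + by left; rewrite subrr expr0n.
- have [bu bu'] := pw_bounded uu'; have [bv bv'] := pw_bounded vv'.
  have cpsi : continuous psi.
    by move=> x; apply: differentiable_continuous; apply/derivable1_diffP; case: (dpsi x).
  under eq_Rintegral do rewrite mulrDl.
  under [in RHS]eq_Rintegral do rewrite mulrDl.
  rewrite !RintegralD//; try (apply: bounded01_integrable => //);
    try exact: (pw_measurable uu'); try exact: (pw_measurable vv');
    try exact: (pw_measurable_derive uu'); try exact: (pw_measurable_derive vv').
  by rewrite opprD ihu// ihv.
- have [bu bu'] := pw_bounded uu'.
  have cpsi : continuous psi.
    by move=> x; apply: differentiable_continuous; apply/derivable1_diffP; case: (dpsi x).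
  under eq_Rintegral do rewrite -mulrA.
  under [in RHS]eq_Rintegral do rewrite -mulrA.
  rewrite !RintegralZl//; try (apply: bounded01_integrable => //);
    try exact: (pw_measurable uu');
    try exact: (pw_measurable_derive uu').
  by rewrite ihu// mulrN.
Qed.

End piecewise_polynomial.

(** * Operator norm of a matrix of order 2 and measurability of the distortion *)

Section operator_norm.
Context {R : realType}.
Implicit Types (A : 'M[R]_2) (v : 'cV[R]_2).

Definition frob A : R := A 0 0 ^+ 2 + A 0 1 ^+ 2 + A 1 0 ^+ 2 + A 1 1 ^+ 2.

Lemma eucl_normE v : eucl_norm v = Num.sqrt (v 0 0 ^+ 2 + v 1 0 ^+ 2).
Proof. by rewrite /eucl_norm !big_ord_recl big_ord0 addr0; congr (Num.sqrt (_ + v _ _ ^+ _)); apply/val_inj. Qed.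

Lemma eucl_norm_sqr v : eucl_norm v ^+ 2 = v 0 0 ^+ 2 + v 1 0 ^+ 2.
Proof. by rewrite eucl_normE sqr_sqrtr// addr_ge0 ?sqr_ge0. Qed.

Lemma mulmx2E A v i : (A *m v) i 0 = A i 0 * v 0 0 + A i 1 * v 1 0.
Proof.
rewrite mxE !big_ord_recl big_ord0 addr0; congr (_ + A i _ * v _ _); exact/val_inj.
Qed.

Lemma det2E A : \det A = A 0 0 * A 1 1 - A 0 1 * A 1 0.
Proof.
rewrite (expand_det_row _ 0) !big_ord_recl big_ord0 addr0 /cofactor !det_mx11 !mxE/=.
rewrite !expr0 !expr1 mul1r mulN1r mulrN.
by congr (A _ _ * A _ _ - A _ _ * A _ _); apply/val_inj.
Qed.

(* The largest eigenvalue of the Gram matrix, whose characteristic polynomial is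
   [l ^ 2 - frob A * l + (det A) ^ 2]. *)
Lemma op_norm_sqr A :
  op_norm A ^+ 2 = (frob A + Num.sqrt (frob A ^+ 2 - 4 * \det A ^+ 2)) / 2.
Proof.
rewrite det2E /frob; set a := A 0 0; set b := A 0 1; set c := A 1 0; set d := A 1 1.
set T := (a ^+ 2 + _ + _ + _); set D := a * d - b * c.
have disc0 : 0 <= T ^+ 2 - 4 * D ^+ 2.
  have -> : T ^+ 2 - 4 * D ^+ 2 =
    ((a - d) ^+ 2 + (b + c) ^+ 2) * ((a + d) ^+ 2 + (b - c) ^+ 2).
    by rewrite /T /D; ring.
  by rewrite mulr_ge0 ?addr_ge0 ?sqr_ge0.
set s := Num.sqrt _; have s0 : 0 <= s by exact: sqrtr_ge0.
have s2 : s ^+ 2 = T ^+ 2 - 4 * D ^+ 2 by rewrite sqr_sqrtr.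
set l := (T + s) / 2.
pose p := a ^+ 2 + c ^+ 2; pose q := a * b + c * d; pose r := b ^+ 2 + d ^+ 2.
have Tpr : T = p + r by rewrite /T /p /r; ring.
have lpr : (l - p) * (l - r) = q ^+ 2.
  have -> : (l - p) * (l - r) = ((s ^+ 2 - (p - r) ^+ 2)) / 4.
    by rewrite /l Tpr; field.
  by rewrite s2 Tpr /D /p /q /r; field.
have ge_s : `|p - r| <= s.
  rewrite -(ler_pXn2r (n := 2)) ?nnegrE//.
  rewrite real_normK ?num_real// s2 -subr_ge0.
  have -> : T ^+ 2 - 4 * D ^+ 2 - (p - r) ^+ 2 = 4 * q ^+ 2.
    by rewrite Tpr /D /p /q /r; ring.
  by rewrite mulr_ge0 ?sqr_ge0.
move: ge_s; rewrite ler_norml => /andP[ge_s1 ge_s2].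
have lp : 0 <= l - p by rewrite /l Tpr; lra.
have lr : 0 <= l - r by rewrite /l Tpr; lra.
have p0 : 0 <= p by rewrite /p addr_ge0 ?sqr_ge0.
have r0 : 0 <= r by rewrite /r addr_ge0 ?sqr_ge0.
have l0 : 0 <= l by lra.
have normAv v : eucl_norm (A *m v) ^+ 2 =
    p * v 0 0 ^+ 2 + 2 * q * (v 0 0 * v 1 0) + r * v 1 0 ^+ 2.
  by rewrite eucl_norm_sqr !mulmx2E /p /q /r /a /b /c /d; ring.
have ub v : eucl_norm (A *m v) ^+ 2 <= l * eucl_norm v ^+ 2.
  rewrite normAv eucl_norm_sqr; set x := v 0 0; set y := v 1 0.
  rewrite -subr_ge0.
  have -> : l * (x ^+ 2 + y ^+ 2) - (p * x ^+ 2 + 2 * q * (x * y) + r * y ^+ 2) =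
    (l - p) * x ^+ 2 - 2 * q * (x * y) + (l - r) * y ^+ 2 by ring.
  move: lpr lp lr; set P := l - p; set Q := l - r => PQ P0 Q0.
  (* The form to be shown nonnegative has zero discriminant, as [P * Q = q ^ 2]; multiplied by [P]
     it is a perfect square, which leaves [P = 0] apart. *)
  have [P00|Pn0] := eqVneq P 0.
    have q0 : q = 0 by apply/eqP; rewrite -sqrf_eq0 -PQ P00 mul0r.
    by rewrite P00 q0 !(mul0r, mulr0) subr0 add0r mulr_ge0 ?sqr_ge0.
  have Pp : 0 < P by rewrite lt_neqAle eq_sym Pn0.
  rewrite -(pmulr_rge0 _ Pp).
  have -> : P * (P * x ^+ 2 - 2 * q * (x * y) + Q * y ^+ 2) =
    (P * x - q * y) ^+ 2 + (P * Q - q ^+ 2) * y ^+ 2 by ring.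
  by rewrite PQ subrr mul0r addr0 sqr_ge0.
have eucl_ge0 v : 0 <= eucl_norm v by rewrite eucl_normE sqrtr_ge0.
have [v v1 vl] : exists2 v, eucl_norm v ^+ 2 = 1 & eucl_norm (A *m v) ^+ 2 = l.
  have H x y : x ^+ 2 + y ^+ 2 != 0 ->
      p * x ^+ 2 + 2 * q * (x * y) + r * y ^+ 2 = l * (x ^+ 2 + y ^+ 2) ->
      exists2 v, eucl_norm v ^+ 2 = 1 & eucl_norm (A *m v) ^+ 2 = l.
    move=> xy0 xyl; pose n := Num.sqrt (x ^+ 2 + y ^+ 2).
    have n2 : n ^+ 2 = x ^+ 2 + y ^+ 2 by rewrite sqr_sqrtr// addr_ge0 ?sqr_ge0.
    have n0 : n != 0 by rewrite -sqrf_eq0 n2.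
    exists (\col_i (if i == 0 then x / n else y / n)).
      rewrite eucl_norm_sqr !mxE/= !expr_div_n -mulrDl -n2 divff//.
      by rewrite sqrf_eq0.
    rewrite normAv !mxE/=; apply: (@mulfI _ (n ^+ 2)); first by rewrite sqrf_eq0.
    by rewrite [RHS]mulrC n2 -xyl -n2; field.
  (* [(q, l - p)] is an eigenvector of the Gram matrix for [l] unless [l = p]; in that case the
     first basis vector attains the norm. *)
  have [lp0|lp0] := eqVneq (l - p) 0.
    apply: (H 1 0); first by rewrite expr1n expr0n/= addr0 oner_neq0.
    move/eqP: lp0; rewrite subr_eq0 => /eqP ->; ring.
  apply: (H q (l - p)).
    by rewrite paddr_eq0 ?sqr_ge0// !sqrf_eq0 (negbTE lp0) andbF.
  apply/eqP; rewrite -subr_eq0; apply/eqP.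
  transitivity ((l - p) * (q ^+ 2 - (l - p) * (l - r))); first by ring.
  by rewrite lpr subrr mulr0.
have bnd u : eucl_norm u <= 1 -> eucl_norm (A *m u) <= Num.sqrt l.
  move=> u1; rewrite -[leLHS]ger0_norm// -sqrtr_sqr ler_wsqrtr//.
  by apply: (le_trans (ub u)); rewrite ler_piMr// expr_le1.
have v1' : eucl_norm v <= 1 by rewrite -(@expr_le1 _ 2)// v1.
suff -> : op_norm A = Num.sqrt l by rewrite sqr_sqrtr.
rewrite /op_norm; apply/eqP; rewrite eq_le; apply/andP; split.
  apply: ge_sup; first by exists (eucl_norm (A *m v)), v.
  by move=> _ /= [u u1 <-]; exact: bnd.
apply: ub_le_sup; first by exists (Num.sqrt l) => _ /= [u u1 <-]; exact: bnd.
by exists v => //=; rewrite -vl sqrtr_sqr ger0_norm.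
Qed.

Lemma op_norm_sqr_le_frob A : op_norm A ^+ 2 <= frob A.
Proof.
rewrite op_norm_sqr ler_pdivrMr// mulr_natr mulr2n lerD2l.
have f0 : 0 <= frob A by rewrite /frob !addr_ge0 ?sqr_ge0.
rewrite -[leRHS]ger0_norm// -sqrtr_sqr ler_wsqrtr// gerBl.
by rewrite mulr_ge0 ?sqr_ge0.
Qed.

(** With entries [a, b, c, d], the difference [frob A - 2 * \det A] is [(a - d) ^ 2 + (b + c) ^ 2].
    This is what makes the distortion at least 1. *)
Lemma det_le_op_norm_sqr A : \det A <= op_norm A ^+ 2.
Proof.
rewrite op_norm_sqr det2E /frob.
set a := A 0 0; set b := A 0 1; set c := A 1 0; set d := A 1 1.
set s := Num.sqrt _; have s0 : 0 <= s by exact: sqrtr_ge0.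
have := sqr_ge0 (a - d); have := sqr_ge0 (b + c); rewrite !expr2; lra.
Qed.

Lemma le1_distortion (Df : R * R -> 'M[R]_2) z : 1 <= distortion Df z.
Proof.
rewrite /distortion; case: ifPn => // d0.
by rewrite ler_pdivlMr// mul1r det_le_op_norm_sqr.
Qed.

(** The closed formula for the operator norm replaces a supremum over uncountably many vectors.
    Division by the determinant is rewritten as a power with exponent -1, which agrees with it where
    the determinant is positive. *)
Lemma measurable_distortion (Df : R * R -> 'M[R]_2) :
  (forall i j, measurable_fun setT (fun z => Df z i j)) ->
  measurable_fun setT (distortion Df).
Proof.
move=> mDf.
have mdet : measurable_fun setT (fun z => \det (Df z)).
  rewrite (_ : (fun z => _) = fun z =>
      Df z 0 0 * Df z 1 1 - Df z 0 1 * Df z 1 0); last first.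
    by apply/funext => z; rewrite det2E.
  by apply: measurable_funB; apply: measurable_funM.
have mfrob : measurable_fun setT (fun z => frob (Df z)).
  by rewrite /frob; do ! [apply: measurable_funD]; apply: measurable_funX.
rewrite (_ : distortion Df = fun z => if 0 < \det (Df z) then
  (frob (Df z) + Num.sqrt (frob (Df z) ^+ 2 - 4 * \det (Df z) ^+ 2)) / 2 *
    (\det (Df z)) `^ (- 1) else 1); last first.
  apply/funext => z; rewrite /distortion op_norm_sqr.
  by case: ifPn => // d0; rewrite powR_inv1// ltW.
apply: measurable_fun_ifT => //.
  exact: measurable_fun_ltr.
apply: measurable_funM.
  apply: measurable_funM => //; apply: measurable_funD => //.
  apply: measurableT_comp.
    by apply: continuous_measurable_fun; exact: sqrt_continuous.
  apply: measurable_funB; first exact: measurable_funX.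
  by apply: measurable_funM => //; exact: measurable_funX.
exact: (measurableT_comp (f := fun x : R => x `^ (- 1)) (measurable_powR _) mdet).
Qed.

End operator_norm.

(** * Weak partial derivatives of tensor products on the open square *)

Section weak_partial_tensor.
Context {R : realType}.
Notation mu := (@lebesgue_measure R).
Notation sq := (open_square R).

Definition bounded_sq (u : R * R -> R) := exists M, forall z, sq z -> `|u z| <= M.

Lemma lebesgue_open_square : leb2 R sq = 1%:E.
Proof.
rewrite /open_square product_measure1E//.
have := @lebesgue_measure_itv R `]0%R, 1%R[.
by rewrite /= lte_fin ltr01 sube0 => ->; rewrite mule1.
Qed.

Lemma lebesgue_open_square_lty : (leb2 R sq < +oo)%E.
Proof. by rewrite lebesgue_open_square ltry. Qed.

Lemma bounded_sq_integrable (u : R * R -> R) : measurable_fun setT u -> bounded_sq u ->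
  (leb2 R).-integrable sq (EFin \o u).
Proof.
move=> mu_ [M uM]; apply: measurable_bounded_integrable.
- exact: measurable_open_square.
- exact: lebesgue_open_square_lty.
- exact: measurable_funTS.
- exists M; split; first exact: num_real.
  by move=> y My z /uM /le_trans; apply; exact: ltW.
Qed.

Lemma bounded_sqM u v : bounded_sq u -> bounded_sq v -> bounded_sq (fun z => u z * v z).
Proof.
by move=> [M uM] [L vL]; exists (M * L) => z z1; rewrite normrM ler_pM ?uM ?vL.
Qed.

Lemma bounded_sqD u v : bounded_sq u -> bounded_sq v -> bounded_sq (fun z => u z + v z).
Proof.
move=> [M uM] [L vL]; exists (M + L) => z z1.
by rewrite (le_trans (ler_normD _ _))// lerD ?uM ?vL.
Qed.

Lemma continuous_bounded_sq (u : R * R -> R) : continuous u -> bounded_sq u.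
Proof.
move=> cu; have cK : compact (closed_square R).
  by apply: compact_setX; exact: segment_compact.
have : compact (u @` closed_square R).
  by apply: continuous_compact => //; exact: continuous_subspaceT.
move=> /compact_bounded[M [_ uM]]; exists (M + 1) => -[x y] [/= x1 y1].
apply: (uM (M + 1)); first by rewrite ltrDl.
by exists (x, y) => //; split => /=; exact: subset_itv_oo_cc.
Qed.

(** Both orders are recorded because the inner integral has to run along the variable that is
    differentiated. *)
Lemma Rintegral_square (F : R * R -> R) : measurable_fun setT F -> bounded_sq F ->
  \int[leb2 R]_(z in sq) F z =
    \int[mu]_(y in `]0, 1[) \int[mu]_(x in `]0, 1[) F (x, y) /\
  \int[leb2 R]_(z in sq) F z =
    \int[mu]_(x in `]0, 1[) \int[mu]_(y in `]0, 1[) F (x, y).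
Proof.
move=> mF bF; have iF := bounded_sq_integrable mF bF.
have [M FM] := bF.
have I01 : (mu `]0%R, 1%R[ < +oo)%E.
  by have := @lebesgue_measure_itv R `]0%R, 1%R[; rewrite /= lte_fin ltr01 sube0 => ->; rewrite ltry.
have iF' : (leb2 R).-integrable setT ((EFin \o F) \_ sq).
  by move: iF => /integrable_mkcond; apply; exact: measurable_open_square.
have px (x : R) : measurable_fun setT (fun y : R => F (x, y)).
  exact: measurable_fun_pair2.
have py (y : R) : measurable_fun setT (fun x : R => F (x, y)).
  exact: measurable_fun_pair1.
split; rewrite [LHS]/Rintegral integral_mkcond.
- rewrite -(integral21_prod_meas1 iF') [RHS]/Rintegral; congr fine.
  rewrite [RHS]integral_mkcond; apply: eq_integral => y _.
  rewrite /fubini_G /patch mem_setE; case: ifPn => y01; last first.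
    apply: integral0_eq => x _; rewrite ifF//; apply/negbTE/negP.
    by rewrite inE => -[_ /=]; apply/negP.
  rewrite /= /Rintegral fineK; last first.
    apply: integrable_fin_num => //; apply: measurable_bounded_integrable => //.
    + exact: measurable_funTS (py y).
    + exists M; split; first exact: num_real.
      move=> t tM x x01; apply: le_trans (ltW tM); apply: FM; split => //.
  rewrite [RHS]integral_mkcond; apply: eq_integral => x _; rewrite /patch mem_setE /=.
  by have -> : ((x, y) \in sq) = (x \in `]0, 1[) by apply/idP/idP => [/set_mem[]//|?]; apply/mem_set; split.
- rewrite -(integral12_prod_meas1 iF') [RHS]/Rintegral; congr fine.
  rewrite [RHS]integral_mkcond; apply: eq_integral => x _.
  rewrite /fubini_F /patch mem_setE; case: ifPn => y01; last first.
    apply: integral0_eq => y _; rewrite ifF//; apply/negbTE/negP.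
    by rewrite inE => -[/= h _]; move: h; apply/negP.
  rewrite /= /Rintegral fineK; last first.
    apply: integrable_fin_num => //; apply: measurable_bounded_integrable => //.
    + exact: measurable_funTS (px x).
    + exists M; split; first exact: num_real.
      move=> t tM y x01; apply: le_trans (ltW tM); apply: FM; split => //.
  rewrite [RHS]integral_mkcond; apply: eq_integral => y _; rewrite /patch mem_setE /=.
  by have -> : ((x, y) \in sq) = (y \in `]0, 1[) by apply/idP/idP => [/set_mem[]//|?]; apply/mem_set; split.
Qed.

Section test_function.
Variables (phi : R * R -> R) (tphi : test_function sq phi).

Lemma test_continuous : continuous phi.
Proof.
move=> z; have [/(_ [::] z) /= d _ _] := tphi.
exact: differentiable_continuous.
Qed.

Lemma test_continuousD (j : 'I_2) : continuous ('D_(basis_vec R j) phi).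
Proof.
move=> z; have [/(_ [:: j] z) /= d _ _] := tphi.
exact: differentiable_continuous.
Qed.

Lemma test_outside z : ~ sq z -> phi z = 0.
Proof.
move=> nz; apply/eqP/negPn/negP => pz; apply: nz; have [_ _] := tphi; apply.
exact: subset_closure.
Qed.

Lemma test_slice0 (x y : R) :
  is_derive x (1 : R) (fun t : R => phi (t, y)) ('D_(basis_vec R 0) phi (x, y)).
Proof.
have [/(_ [::] (x, y)) /= d _ _] := tphi.
have dv : derivable phi (x, y) (basis_vec R 0) by exact: diff_derivable.
have E : (fun h => h^-1 *: (((fun t : R => phi (t, y)) \o shift x) (h *: (1 : R)) - phi (x, y))) =
    (fun h => h^-1 *: ((phi \o shift (x, y)) (h *: basis_vec R 0) - phi (x, y))).
  apply/funext => h /=; congr (_ *: (phi _ - _)); rewrite /basis_vec/= /shift/=.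
  transitivity (h *: (1 : R) + x, h *: (0 : R) + y) => //.
  by rewrite scaler0 add0r.
by split; [rewrite /derivable E|rewrite /derive E].
Qed.

Lemma test_slice1 (x y : R) :
  is_derive y (1 : R) (fun t : R => phi (x, t)) ('D_(basis_vec R 1) phi (x, y)).
Proof.
have [/(_ [::] (x, y)) /= d _ _] := tphi.
have dv : derivable phi (x, y) (basis_vec R 1) by exact: diff_derivable.
have E : (fun h => h^-1 *: (((fun t : R => phi (x, t)) \o shift y) (h *: (1 : R)) - phi (x, y))) =
    (fun h => h^-1 *: ((phi \o shift (x, y)) (h *: basis_vec R 1) - phi (x, y))).
  apply/funext => h /=; congr (_ *: (phi _ - _)); rewrite /basis_vec/= /shift/=.
  transitivity (h *: (0 : R) + x, h *: (1 : R) + y) => //.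
  by rewrite scaler0 add0r.
by split; [rewrite /derivable E|rewrite /derive E].
Qed.

End test_function.

Definition bounded_weak_partial (j : 'I_2) (u g : R * R -> R) :=
  [/\ measurable_fun setT u, bounded_sq u, measurable_fun setT g, bounded_sq g &
      weak_partial sq j u g].

Lemma bounded_weak_partialD j u g v h : bounded_weak_partial j u g ->
  bounded_weak_partial j v h ->
  bounded_weak_partial j (fun z => u z + v z) (fun z => g z + h z).
Proof.
move=> [mu_ bu mg bg wu] [mv bv mh bh wv]; split.
- exact: measurable_funD.
- exact: bounded_sqD.
- exact: measurable_funD.
- exact: bounded_sqD.
move=> phi tphi.
have cphi := test_continuous tphi; have cD := test_continuousD tphi (j := j).
have mphi := continuous_measurable_plane cphi.
have mD := continuous_measurable_plane cD.
have bphi := continuous_bounded_sq cphi; have bD := continuous_bounded_sq cD.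
under eq_Rintegral do rewrite mulrDl.
under [in RHS]eq_Rintegral do rewrite mulrDl.
rewrite !RintegralD//; try exact: measurable_open_square;
  try (apply: bounded_sq_integrable; [exact: measurable_funM|exact: bounded_sqM]).
by rewrite opprD wu// wv.
Qed.

Lemma bounded_sq_tensor (u v : R -> R) : bounded01 u -> bounded01 v ->
  bounded_sq (fun z => u z.1 * v z.2).
Proof.
move=> [M uM] [L vL]; exists (M * L) => -[x y] [/= /andP[x0 x1] /andP[y0 y1]].
by rewrite normrM ler_pM// ?uM ?vL// !ltW.
Qed.

Lemma measurable_tensor (u v : R -> R) : measurable_fun setT u -> measurable_fun setT v ->
  measurable_fun setT (fun z : R * R => u z.1 * v z.2).
Proof.
move=> mu_ mv; apply: measurable_funM.
  exact: (measurableT_comp mu_ measurable_fst).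
exact: (measurableT_comp mv measurable_snd).
Qed.

(** On each horizontal line the factor [v y] is constant and the slice of the test function vanishes
    at 0 and 1, so Fubini reduces the identity to [pw_ibp]. *)
Lemma bounded_weak_partial_tensor0 u u' v v' : pw_poly u u' -> pw_poly v v' ->
  bounded_weak_partial 0 (fun z => u z.1 * v z.2) (fun z => u' z.1 * v z.2).
Proof.
move=> uu' vv'; have [bu bu'] := pw_bounded uu'; have [bv _] := pw_bounded vv'.
have mu_ := pw_measurable uu'; have mu' := pw_measurable_derive uu'.
have mv := pw_measurable vv'.
have muv := measurable_tensor mu_ mv; have mu'v := measurable_tensor mu' mv.
have buv := bounded_sq_tensor bu bv; have bu'v := bounded_sq_tensor bu' bv.
split => // phi tphi.
have cphi := test_continuous tphi; have cD := test_continuousD tphi (j := 0).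
have mphi := continuous_measurable_plane cphi.
have mD := continuous_measurable_plane cD.
have bphi := continuous_bounded_sq cphi; have bD := continuous_bounded_sq cD.
(* The sign goes inside the integral as a constant factor, so that both sides become iterated
   integrals and can be compared line by line. *)
have -> (a b : R) : (a = - b) = (a = -1 * b) by rewrite mulN1r.
rewrite -RintegralZl; [|exact: measurable_open_square|]; last first.
  exact: (bounded_sq_integrable (measurable_funM mu'v mphi) (bounded_sqM bu'v bphi)).
pose N1 : R * R -> R := cst (-1).
have bN1 : bounded_sq N1 by exists 1 => z _; rewrite normrN1.
have mN1 : measurable_fun setT N1 by exact: measurable_cst.
have [-> _] := Rintegral_square (measurable_funM mN1 (measurable_funM mu'v mphi))
  (bounded_sqM bN1 (bounded_sqM bu'v bphi)).
have [-> _] := Rintegral_square (measurable_funM muv mD) (bounded_sqM buv bD).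
apply: eq_Rintegral => y _ /=.
have cs : continuous (fun x : R => phi (x, y)).
  by move=> x; apply: differentiable_continuous; apply/derivable1_diffP; have [] := test_slice0 tphi x y.
have cDs : continuous (fun x : R => 'D_(basis_vec R 0) phi (x, y)).
  move=> x; apply: (continuous_comp (f := fun x : R => (x, y)) (g := 'D_(basis_vec R 0) phi)); last exact: cD.
  exact: (@cvg_pair _ _ _ _ (nbhs x) (nbhs y) _ _ _ id (cst y) cvg_id (cvg_cst y)).
transitivity (v y * \int[mu]_(x in `]0, 1[) (u x * 'D_(basis_vec R 0) phi (x, y))).
  rewrite -RintegralZl//; last exact: bounded01_integrable.
  by apply: eq_Rintegral => x _; rewrite mulrCA mulrA.
rewrite (pw_ibp uu' (psi := fun x => phi (x, y)) (fun x => test_slice0 tphi x y))//.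
- rewrite mulrN -mulNr -RintegralZl//; last exact: bounded01_integrable.
  by apply: eq_Rintegral => x _; rewrite /N1/= !mulNr mul1r mulrCA mulrA.
- by apply: test_outside => // -[/=]; rewrite in_itv/= ltxx.
- by apply: test_outside => // -[/=]; rewrite in_itv/= ltxx andbF.
Qed.

Lemma bounded_weak_partial_tensor1 u u' v v' : pw_poly u u' -> pw_poly v v' ->
  bounded_weak_partial 1 (fun z => u z.1 * v z.2) (fun z => u z.1 * v' z.2).
Proof.
move=> uu' vv'; have [bu _] := pw_bounded uu'; have [bv bv'] := pw_bounded vv'.
have mu_ := pw_measurable uu'; have mv' := pw_measurable_derive vv'.
have mv := pw_measurable vv'.
have muv := measurable_tensor mu_ mv; have muv' := measurable_tensor mu_ mv'.
have buv := bounded_sq_tensor bu bv; have buv' := bounded_sq_tensor bu bv'.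
split => // phi tphi.
have cphi := test_continuous tphi; have cD := test_continuousD tphi (j := 1).
have mphi := continuous_measurable_plane cphi.
have mD := continuous_measurable_plane cD.
have bphi := continuous_bounded_sq cphi; have bD := continuous_bounded_sq cD.
have -> (a b : R) : (a = - b) = (a = -1 * b) by rewrite mulN1r.
rewrite -RintegralZl; [|exact: measurable_open_square|]; last first.
  exact: (bounded_sq_integrable (measurable_funM muv' mphi) (bounded_sqM buv' bphi)).
pose N1 : R * R -> R := cst (-1).
have bN1 : bounded_sq N1 by exists 1 => z _; rewrite normrN1.
have mN1 : measurable_fun setT N1 by exact: measurable_cst.
have [_ ->] := Rintegral_square (measurable_funM mN1 (measurable_funM muv' mphi))
  (bounded_sqM bN1 (bounded_sqM buv' bphi)).
have [_ ->] := Rintegral_square (measurable_funM muv mD) (bounded_sqM buv bD).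
apply: eq_Rintegral => x _ /=.
have cs : continuous (fun y : R => phi (x, y)).
  by move=> y; apply: differentiable_continuous; apply/derivable1_diffP; have [] := test_slice1 tphi x y.
have cDs : continuous (fun y : R => 'D_(basis_vec R 1) phi (x, y)).
  move=> y; apply: (continuous_comp (f := fun y : R => (x, y)) (g := 'D_(basis_vec R 1) phi)); last exact: cD.
  exact: (@cvg_pair _ _ _ _ (nbhs x) (nbhs y) _ _ _ (cst x) id (cvg_cst x) cvg_id).
transitivity (u x * \int[mu]_(y in `]0, 1[) (v y * 'D_(basis_vec R 1) phi (x, y))).
  rewrite -RintegralZl//; last exact: bounded01_integrable.
  by apply: eq_Rintegral => y _; rewrite mulrA.
rewrite (pw_ibp vv' (psi := fun y => phi (x, y)) (fun y => test_slice1 tphi x y))//.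
- rewrite mulrN -mulNr -RintegralZl//; last exact: bounded01_integrable.
  by apply: eq_Rintegral => y _; rewrite /N1/= !mulNr mul1r mulrA.
- by apply: test_outside => // -[_ /=]; rewrite in_itv/= ltxx.
- by apply: test_outside => // -[_ /=]; rewrite in_itv/= ltxx andbF.
Qed.

End weak_partial_tensor.

(** * Domination by series over the levels and limits of weak derivatives *)

Section limits.
Context {R : realType}.
Notation mu := (@lebesgue_measure R).
Notation sq := (open_square R).

(** By monotone convergence the integral is at most the sum of [c j] times the measure of [B j]. It
    serves for the differential, the Jacobian and the exponential of the distortion, each time with
    [B j] the union of the squares of generation [j]. *)
Lemma indic_series_integrable (B : nat -> set (R * R)) (c b : nat -> R) :
  (forall j, measurable (B j)) -> (forall j, 0 <= c j) ->
  (forall j, ((c j)%:E * leb2 R (B j) <= (b j)%:E)%E) -> cvgn (series b) ->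
  (leb2 R).-integrable sq (fun z => \sum_(0 <= j <oo) (c j * \1_(B j) z)%:E)%E.
Proof.
move=> mB c0 cb cvb.
have mt j : measurable_fun sq (fun z => (c j * \1_(B j) z)%:E).
  by apply/measurable_EFinP; apply: measurable_funM => //; exact: measurable_indic.
have mi j : measurable_fun sq (fun z => (\1_(B j) z : R)%:E).
  by apply/measurable_EFinP; exact: measurable_indic.
have t0 j z : (0 <= (c j * \1_(B j) z)%:E)%E by rewrite lee_fin mulr_ge0.
have b0 j : 0 <= b j.
  by rewrite -lee_fin (le_trans _ (cb j))// mule_ge0// lee_fin.
apply/integrableP; split; first
  by apply: (ge0_emeasurable_sum (P := xpredT) (h := fun j z => (c j * \1_(B j) z)%:E));
    [move=> j z _ _; exact: t0|move=> j _; exact: mt].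
under eq_integral => z _ do rewrite gee0_abs ?nneseries_ge0//.
rewrite integral_nneseries//; last exact: measurable_open_square.
apply: (@le_lt_trans _ _ (\sum_(0 <= j <oo) (b j)%:E)%E).
  apply: lee_nneseries => [j _ _|j _]; first by apply: integral_ge0.
  apply: (le_trans _ (cb j)).
  have -> : (\int[leb2 R]_(z in sq) (c j * \1_(B j) z)%:E =
      (c j)%:E * leb2 R (B j `&` sq))%E.
    rewrite -(integral_indic (leb2 R) measurable_open_square (mB j)).
    apply: (@ge0_integralZl_EFin _ _ _ (leb2 R) sq measurable_open_square
      (fun z => (\1_(B j) z)%:E)) => //.
    exact: mi.
  rewrite lee_wpmul2l ?lee_fin//.
  have mBs : measurable (B j `&` sq).
    by apply: measurableI => //; exact: measurable_open_square.
  by apply: le_measure; rewrite ?inE; [exact: mBs|exact: mB|exact: subIsetl].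
have -> : (\sum_(0 <= j <oo) (b j)%:E)%E = (limn (series b))%:E.
  rewrite -EFin_lim//; congr (limn _).
  by apply/funext => n /=; rewrite -sumEFin.
by rewrite ltry.
Qed.

Lemma dominated_integrable_sq (g : R * R -> R) (G : R * R -> \bar R) :
  measurable_fun setT g -> (leb2 R).-integrable sq G ->
  (forall z, sq z -> (`|g z|%:E <= G z)%E) ->
  (leb2 R).-integrable sq (EFin \o g).
Proof.
move=> mg iG gG; apply: le_integrable iG => //.
- exact: measurable_open_square.
- by apply: measurable_funTS; exact/measurable_EFinP.
- by move=> z /gG /=; move/le_trans; apply; exact: lee_abs.
Qed.

Lemma integrable_L1_loc (g : R * R -> R) : measurable_fun setT g ->
  (leb2 R).-integrable sq (EFin \o g) -> L1_loc sq g.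
Proof.
move=> mg ig; split; first exact: measurable_funTS.
move=> K cK Ksq; apply: integrableS ig => //; first exact: measurable_open_square.
exact: compact_measurable_plane.
Qed.

(** Dominated convergence on both sides of the identity: the functions are uniformly bounded, their
    derivatives stay below [G] and converge almost everywhere, and the test function and its
    derivative are bounded. *)
Lemma weak_partial_lim (j : 'I_2) (u_ g_ : nat -> R * R -> R) (u g : R * R -> R)
    (M : R) (G : R * R -> \bar R) :
  (forall n, bounded_weak_partial j (u_ n) (g_ n)) ->
  measurable_fun setT u -> measurable_fun setT g ->
  (forall z, sq z -> u_ n z @[n --> \oo] --> u z) ->
  (forall n z, sq z -> `|u_ n z| <= M) ->
  {ae leb2 R, forall z, sq z -> g_ n z @[n --> \oo] --> g z} ->
  (leb2 R).-integrable sq G ->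
  (forall n z, sq z -> (`|g_ n z|%:E <= G z)%E) ->
  weak_partial sq j u g.
Proof.
move=> wp mu_ mg uu uM gg iG gG phi tphi.
have cphi := test_continuous tphi; have cD := test_continuousD tphi (j := j).
have mphi := continuous_measurable_plane cphi.
have mD := continuous_measurable_plane cD.
have [L phiL] := continuous_bounded_sq cphi; have [L' DL'] := continuous_bounded_sq cD.
have lim_int (v_ : nat -> R * R -> R) (v w : R * R -> R) (H : R * R -> \bar R) :
    (forall n, measurable_fun setT (v_ n)) -> measurable_fun setT v -> measurable_fun setT w ->
    {ae leb2 R, forall z, sq z -> v_ n z @[n --> \oo] --> v z} ->
    (leb2 R).-integrable sq H ->
    (forall n z, sq z -> (`|v_ n z * w z|%:E <= H z)%E) ->
    (\int[leb2 R]_(z in sq) (v_ n z * w z)) @[n --> \oo] -->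
      \int[leb2 R]_(z in sq) (v z * w z).
  move=> mv_ mv mw vv iH vH.
  have mvw (v' : R * R -> R) : measurable_fun setT v' ->
      measurable_fun sq (fun z => (v' z * w z)%:E).
    by move=> mv'; apply: measurable_funTS; apply/measurable_EFinP; exact: measurable_funM.
  have [|||||i0 _ i1] := @dominated_convergence _ _ _ (leb2 R) sq measurable_open_square
    (fun n z => (v_ n z * w z)%:E) (fun z => (v z * w z)%:E) H.
  - by move=> n; exact: mvw.
  - exact: mvw.
  - case: vv => A [mA A0 Asub]; exists A; split => // z /= nz; apply: Asub => /= vz.
    apply: nz => sz; apply: cvg_EFin; first by near=> n.
    by apply: cvgM; [exact: vz|exact: cvg_cst].
  - exact: iH.
  - exists set0; split; [exact: measurable0|exact: measure0|].
    by move=> z /= nz; apply: nz => n; exact: vH.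
  have fin : (\int[leb2 R]_(z in sq) (v z * w z)%:E)%E \is a fin_num.
    by apply: integrable_fin_num => //; exact: measurable_open_square.
  apply: fine_cvg; rewrite fineK//.
have c1 H := lim_int u_ u ('D_(basis_vec R j) phi) H
  (fun n => let: And5 a _ _ _ _ := wp n in a) mu_ mD.
have c2 := lim_int g_ g phi (fun z => L%:E * G z)%E
  (fun n => let: And5 _ _ a _ _ := wp n in a) mg mphi.
have aeu : {ae leb2 R, forall z, sq z -> u_ n z @[n --> \oo] --> u z}.
  exists set0; split; [exact: measurable0|exact: measure0|].
  by move=> z /= nz; apply: nz; exact: uu.
have {}c1 := c1 _ aeu.
have {}c1 : (\int[leb2 R]_(z in sq) (u_ n z * 'D_(basis_vec R j) phi z)) @[n --> \oo] -->
      \int[leb2 R]_(z in sq) (u z * 'D_(basis_vec R j) phi z).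
  apply: (c1 (fun=> (M * L')%:E)).
    by apply: (bounded_sq_integrable (u := cst (M * L'))) => //; exists `|M * L'|.
  by move=> n z sz; rewrite lee_fin normrM ler_pM ?uM ?DL'.
have {}c2 : (\int[leb2 R]_(z in sq) (g_ n z * phi z)) @[n --> \oo] -->
      \int[leb2 R]_(z in sq) (g z * phi z).
  apply: c2 => //.
    by apply: integrableZl => //; exact: measurable_open_square.
  move=> n z sz; rewrite normrM mulrC EFinM lee_pmul ?lee_fin ?phiL//.
  exact: gG.
have e : (fun n => \int[leb2 R]_(z in sq) (u_ n z * 'D_(basis_vec R j) phi z)) =
         (fun n => - \int[leb2 R]_(z in sq) (g_ n z * phi z)).
  by apply/funext => n; have [_ _ _ _ ->] := wp n.
move: c1; rewrite e => c1.
have c3 : (fun n => - \int[leb2 R]_(z in sq) (g_ n z * phi z)) @ \oo -->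
    - \int[leb2 R]_(z in sq) (g z * phi z) by exact: (cvgN c2).
exact: (cvg_unique (@Rhausdorff R) c1 c3).
Unshelve. all: by end_near. Qed.

End limits.

(** * Series of functions dominated by a geometric series *)

Section uniform_series.
Context {R : realType} {T : topologicalType}.
Variables (u : nat -> T -> R) (rho : R).
Hypotheses (rho0 : 0 <= rho) (rho1 : rho < 1).
Hypotheses (cu : forall j, continuous (u j)) (ubnd : forall j z, `|u j z| <= rho ^+ j).

Lemma geometric_series_cvg z : cvgn (series (u ^~ z)).
Proof.
apply: normed_cvg; apply: (series_le_cvg _ _ _ (is_cvg_geometric_series (a := 1) (z := rho) _)).
- by move=> n /=.
- by move=> n; rewrite /geometric/= mul1r exprn_ge0.
- by move=> n; rewrite /geometric/= mul1r; exact: ubnd.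
- by rewrite ger0_norm.
Qed.

Lemma series_tail_bound n m z : (n <= m)%N ->
  `|series (u ^~ z) m - series (u ^~ z) n| <= rho ^+ n / (1 - rho).
Proof.
move=> nm; rewrite sub_series_geq// (le_trans (ler_norm_sum _ _ _))//.
apply: (le_trans (ler_sum _ (fun j _ => ubnd j z))).
rewrite -{1}(add0n n) big_addn (eq_bigr (fun i => rho ^+ n * rho ^+ i)); last first.
  by move=> i _; rewrite exprD mulrC.
rewrite -mulr_sumr ler_wpM2l ?exprn_ge0//.
have rn1 : rho != 1 by rewrite lt_eqF.
have := congr1 (fun f => f (m - n)%N) (geometric_seriesE 1 rn1).
rewrite /series/= /geometric/=; under eq_bigr do rewrite mul1r.
move=> ->; rewrite mul1r -[leRHS]mul1r ler_pM2r ?invr_gt0 ?subr_gt0// gerBl exprn_ge0//.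
Qed.

Lemma series_lim_tail n z :
  `|limn (series (u ^~ z)) - series (u ^~ z) n| <= rho ^+ n / (1 - rho).
Proof.
have cv := @geometric_series_cvg z.
have : (fun m => `|series (u ^~ z) m - series (u ^~ z) n|) @ \oo -->
    `|limn (series (u ^~ z)) - series (u ^~ z) n|.
  by apply: cvg_norm; apply: cvgB; [exact: cv|exact: cvg_cst].
move=> cvn; rewrite -(cvg_lim (@Rhausdorff R) cvn).
apply: limr_le; first by apply/cvg_ex; eexists; exact: cvn.
by near=> m; apply: series_tail_bound; near: m; exact: nbhs_infty_ge.
Unshelve. all: by end_near. Qed.

Lemma continuous_series n : continuous (fun z => series (u ^~ z) n).
Proof.
elim: n => [|n ih] z.
  rewrite (_ : (fun z => _) = cst 0); first exact: cvg_cst.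
  by apply/funext => y; rewrite /series/= big_geq.
rewrite (_ : (fun z => _) = fun z => series (u ^~ z) n + u n z).
  by apply: cvgD; [exact: ih|exact: cu].
by apply/funext => y; rewrite seriesSr.
Qed.

Lemma continuous_series_lim : continuous (fun z => limn (series (u ^~ z))).
Proof.
move=> z; apply/cvgrPdist_le => e e0.
have r1 : 0 < 1 - rho by rewrite subr_gt0.
have : (fun n => rho ^+ n / (1 - rho)) @ \oo --> 0 / (1 - rho).
  by apply: cvgM; [apply: cvg_expr; rewrite ger0_norm|exact: cvg_cst].
rewrite mul0r => /cvgrPdist_le /(_ (e / 3)) /=.
rewrite divr_gt0// => /(_ isT)[n _ /(_ n (leqnn n))]; rewrite sub0r normrN.
rewrite ger0_norm ?mulr_ge0 ?exprn_ge0 ?invr_ge0 ?(ltW r1)// => ne.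
have cs : {for z, continuous (fun z => series (u ^~ z) n)}.
  exact: continuous_series.
move/cvgrPdist_le : cs => /(_ (e / 3)); rewrite divr_gt0// => /(_ isT).
apply: filterS => y hy.
have h1 := series_lim_tail n z; have h2 := series_lim_tail n y.
have := ler_distD (series (u ^~ z) n) (limn (series (u ^~ z))) (limn (series (u ^~ y))).
have := ler_distD (series (u ^~ y) n) (series (u ^~ z) n) (limn (series (u ^~ y))).
move: h1 h2 hy ne; rewrite (distrC (series (u ^~ y) n) (limn (series (u ^~ y)))) /=; lra.
Qed.

End uniform_series.

(** * Diameters and bounds for Hausdorff measures *)

Section hausdorff_tools.
Context {R : realType}.
Implicit Types (h : R -> R) (A U : set (R * R)) (x y : R * R).

Lemma eucl_distE x y : eucl_dist x y = Num.sqrt ((x.1 - y.1) ^+ 2 + (x.2 - y.2) ^+ 2).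
Proof. by rewrite /eucl_dist eucl_normE !mxE. Qed.

Lemma le_eucl_dist1 x y : `|x.1 - y.1| <= eucl_dist x y.
Proof. by rewrite eucl_distE -sqrtr_sqr ler_wsqrtr// lerDl sqr_ge0. Qed.

Lemma le_eucl_dist2 x y : `|x.2 - y.2| <= eucl_dist x y.
Proof. by rewrite eucl_distE -sqrtr_sqr ler_wsqrtr// lerDr sqr_ge0. Qed.

Lemma eucl_dist_le x y : eucl_dist x y <= `|x.1 - y.1| + `|x.2 - y.2|.
Proof.
rewrite eucl_distE -[leRHS]ger0_norm ?addr_ge0// -sqrtr_sqr ler_wsqrtr//.
rewrite [leRHS]sqrrD !real_normK ?num_real// addrAC lerDl mulrn_wge0//.
Qed.

Lemma diam_ge0 U : (0 <= diam U)%E.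
Proof. by apply: ereal_sup_ubound; left. Qed.

Lemma diam_ge U x y : U x -> U y -> ((eucl_dist x y)%:E <= diam U)%E.
Proof. by move=> Ux Uy; apply: ereal_sup_ubound; right; exists x => //; exists y. Qed.

Lemma diam_le U (r : R) : 0 <= r ->
  (forall x y, U x -> U y -> eucl_dist x y <= r) -> (diam U <= r%:E)%E.
Proof.
move=> r0 Ur; apply: ge_ereal_sup => _ [->|[x Ux [y Uy <-]]]; first by rewrite lee_fin.
by rewrite lee_fin Ur.
Qed.

Lemma diam0 : diam (set0 : set (R * R)) = 0%E.
Proof.
by apply/eqP; rewrite eq_le diam_ge0 andbT; apply: diam_le.
Qed.

Lemma hausdorff_delta_ge0 h delta A : (forall t, 0 <= h t) ->
  (0 <= hausdorff_delta h delta A)%E.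
Proof.
move=> h0; apply: le_ereal_inf_tmp => _ [U _ <-].
by apply: nneseries_ge0 => i _ _; rewrite lee_fin.
Qed.

Lemma hausdorff_delta_nonincreasing h A (d e : R) : d <= e ->
  (hausdorff_delta h e A <= hausdorff_delta h d A)%E.
Proof.
move=> de; apply: le_ereal_inf => _ [U [AU Ud] <-]; exists U => //; split => // i.
by apply: (le_trans (Ud i)); rewrite lee_fin.
Qed.

(** The finite cover is padded with empty sets, which cost nothing since their diameter is 0 and
    [h 0 = 0]. *)
Lemma hausdorff_delta_finite h delta A (s : seq (set (R * R))) (c : R) :
  (forall t, 0 <= h t) -> h 0 = 0 -> 0 <= delta ->
  (forall x, A x -> exists2 U, U \in s & U x) ->
  (forall U, U \in s -> (diam U <= delta%:E)%E /\ h (fine (diam U)) <= c) ->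
  (hausdorff_delta h delta A <= ((size s)%:R * c)%:E)%E.
Proof.
move=> h0 h00 d0 As sc; pose U i := nth set0 s i.
have sum0 i : (size s <= i)%N -> (h (fine (diam (U i))))%:E = 0%E.
  by move=> si; rewrite /U nth_default// diam0 /= h00.
apply: (@le_trans _ _ (\sum_(0 <= i <oo) (h (fine (diam (U i))))%:E)%E).
  apply: ereal_inf_lbound; exists U => //; split.
    move=> x /As[V Vs Vx]; exists (index V s) => //=.
    by rewrite /U nth_index.
  move=> i; have [si|si] := ltnP i (size s).
    by have [] := sc (U i) (mem_nth _ si).
  by rewrite /U nth_default// diam0 lee_fin.
rewrite (@nneseries_split _ _ 0 (size s)); last by move=> i _; rewrite lee_fin.
rewrite eseries0; last by move=> i si _; exact: sum0.
rewrite adde0 sumEFin lee_fin big_mkord.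
rewrite (_ : (size s)%:R * c = \sum_(i < size s) c); last first.
  by rewrite sumr_const card_ord mulr_natl.
by apply: ler_sum => i _; have [] := sc (U i) (mem_nth _ (ltn_ord i)).
Qed.

Lemma hausdorff_measure_eq0 h A :
  (forall delta, 0 < delta -> hausdorff_delta h delta A = 0%E) ->
  hausdorff_measure h A = 0%E.
Proof.
move=> h0; apply/cvg_lim => //; apply: cvg_near_cst.
by near=> d; apply: h0; near: d; exact: nbhs_right_gt.
Unshelve. all: by end_near. Qed.

(** The contents increase as [delta] decreases, so the limit exists and dominates each of them: a
    lower bound at one scale is enough. *)
Lemma hausdorff_measure_ge h A (c : \bar R) (d : R) : 0 < d ->
  (c <= hausdorff_delta h d A)%E -> (c <= hausdorff_measure h A)%E.
Proof.
move=> d0 cd; apply: lime_ge.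
  apply: nonincreasing_at_right_is_cvge; near=> x => a b _ _.
  exact: hausdorff_delta_nonincreasing.
near=> e; apply: (le_trans cd); apply: hausdorff_delta_nonincreasing.
by apply/ltW; near: e; exact: nbhs_right_lt.
Unshelve. all: by end_near. Qed.

End hausdorff_tools.

(** * The Cantor set as the survivors of an expanding interval map *)

Section cantor_dynamics.
Context {R : realType}.
Variables (N : nat) (sg : R).
Hypotheses (N_gt0 : (0 < N)%N) (sg_gt0 : 0 < sg) (sg_lt1 : sg < 1).
Notation mu := (@lebesgue_measure R).

(** Each of the [N] cells, rescaled to the unit interval, keeps a centred interval of length [sg]
    and loses one of length [gap] on either side. *)
Definition gap : R := (1 - sg) / 2.

Let gap_gt0 : 0 < gap. Proof. by rewrite divr_gt0// subr_gt0. Qed.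
Let gap_lt : gap < 1 - gap. Proof. by have := sg_gt0; rewrite /gap; lra. Qed.
Let gap_sg : 1 - gap = gap + sg. Proof. by rewrite /gap; lra. Qed.
Let NR_gt0 : 0 < N%:R :> R. Proof. by rewrite ltr0n. Qed.
Let NR_neq0 : N%:R != 0 :> R. Proof. by rewrite gt_eqF. Qed.
Let sg_neq0 : sg != 0. Proof. by rewrite gt_eqF. Qed.
Let gap_neq0 : gap != 0. Proof. by rewrite gt_eqF. Qed.

Definition step (p x : R) : R := (p <= x)%R%:R.

(* The slope of [tent] is [-1] on both gaps and [sg^-1 - 1] in between; [plateau] is
   [1] between the gaps and falls quadratically to [0] across them. Combinations of
   ramps make both visibly piecewise polynomial. *)
Definition tent (t : R) : R :=
  (-1) * ramp 0 t + sg^-1 * ramp gap t + (- sg^-1) * ramp (1 - gap) t + ramp 1 t.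
Definition dtent (t : R) : R :=
  (-1) * step 0 t + sg^-1 * step gap t + (- sg^-1) * step (1 - gap) t + step 1 t.
Definition plateau (t : R) : R :=
  2 / gap * ramp 0 t + (- (gap ^- 2)) * ramp 0 t ^+ 2 + gap ^- 2 * ramp gap t ^+ 2 +
  (- (gap ^- 2)) * ramp (1 - gap) t ^+ 2 + 2 / gap * ramp 1 t + gap ^- 2 * ramp 1 t ^+ 2.
Definition dplateau (t : R) : R :=
  2 / gap * step 0 t + (- (gap ^- 2)) * (2 * ramp 0 t) + gap ^- 2 * (2 * ramp gap t) +
  (- (gap ^- 2)) * (2 * ramp (1 - gap) t) + 2 / gap * step 1 t + gap ^- 2 * (2 * ramp 1 t).

Lemma pw_tent : pw_poly tent dtent.
Proof.
apply: pw_add; last exact: pw_ramp.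
apply: pw_add; last by apply: pw_scale; exact: pw_ramp.
apply: pw_add; by apply: pw_scale; exact: pw_ramp.
Qed.

Lemma pw_plateau : pw_poly plateau dplateau.
Proof.
apply: pw_add; last by apply: pw_scale; exact: pw_ramp2.
apply: pw_add; last by apply: pw_scale; exact: pw_ramp.
apply: pw_add; last by apply: pw_scale; exact: pw_ramp2.
apply: pw_add; last by apply: pw_scale; exact: pw_ramp2.
apply: pw_add; last by apply: pw_scale; exact: pw_ramp2.
by apply: pw_scale; exact: pw_ramp.
Qed.

(** Half open, so that the [N] cells partition it, in accordance with the right derivatives recorded
    by [pw_poly] at the breakpoints. *)
Definition unit_itv (z : R) : bool := 0 <= z < 1.

Definition supp01 (u : R -> R) := forall z, ~~ unit_itv z -> u z = 0.

Let ramp_ge (p x : R) : p <= x -> ramp p x = x - p. Proof. by rewrite /ramp => ->. Qed.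
Let ramp_lt (p x : R) : x < p -> ramp p x = 0. Proof. by rewrite /ramp ltNge => /negbTE ->. Qed.
Let step_ge (p x : R) : p <= x -> step p x = 1. Proof. by rewrite /step => ->. Qed.
Let step_lt (p x : R) : x < p -> step p x = 0. Proof. by rewrite /step ltNge => /negbTE ->. Qed.

Lemma cell_left (t : R) : 0 <= t < gap ->
  [/\ tent t = - t, dtent t = -1, plateau t = 1 - (1 - t / gap) ^+ 2 &
      dplateau t = 2 / gap * (1 - t / gap)].
Proof.
move=> /andP[t0 tg]; have tg1 : t < 1 - gap by rewrite (lt_trans tg).
have t1 : t < 1 by rewrite (lt_trans tg1)// gtrBl.
rewrite /tent /dtent /plateau /dplateau !(ramp_ge t0, step_ge t0, ramp_lt tg, step_lt tg,
  ramp_lt tg1, step_lt tg1, ramp_lt t1, step_lt t1).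
by split; field.
Qed.

Lemma cell_mid (t : R) : gap <= t < 1 - gap ->
  [/\ tent t = - t + (t - gap) / sg, dtent t = - 1 + sg^-1, plateau t = 1 &
      dplateau t = 0].
Proof.
move=> /andP[tg tg1]; have t0 : 0 <= t by rewrite (le_trans _ tg)// ltW.
have t1 : t < 1 by rewrite (lt_trans tg1)// gtrBl.
rewrite /tent /dtent /plateau /dplateau !(ramp_ge t0, step_ge t0, ramp_ge tg, step_ge tg,
  ramp_lt tg1, step_lt tg1, ramp_lt t1, step_lt t1).
by split; field.
Qed.

Lemma cell_right (t : R) : 1 - gap <= t < 1 ->
  [/\ tent t = 1 - t, dtent t = - 1, plateau t = 1 - (1 - (1 - t) / gap) ^+ 2 &
      dplateau t = - (2 / gap * (1 - (1 - t) / gap))].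
Proof.
move=> /andP[tg1 t1]; have tg : gap <= t by rewrite (le_trans _ tg1)// ltW.
have t0 : 0 <= t by rewrite (le_trans _ tg)// ltW.
rewrite /tent /dtent /plateau /dplateau !(ramp_ge t0, step_ge t0, ramp_ge tg, step_ge tg,
  ramp_ge tg1, step_ge tg1, ramp_lt t1, step_lt t1).
have -> : gap = (1 - sg) / 2 by [].
by split; field; rewrite ?sg_neq0 ?subr_eq0 ?gt_eqF.
Qed.

Lemma cell_out (t : R) : ~~ unit_itv t ->
  [/\ tent t = 0, dtent t = 0, plateau t = 0 & dplateau t = 0].
Proof.
rewrite /unit_itv negb_and -ltNge -leNgt => /orP[t0|t1].
  have tg : t < gap by exact: (lt_trans t0).
  have tg1 : t < 1 - gap by rewrite (lt_trans tg).
  have t1 : t < 1 by rewrite (lt_trans tg1)// gtrBl.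
  rewrite /tent /dtent /plateau /dplateau !(ramp_lt t0, step_lt t0, ramp_lt tg, step_lt tg,
  ramp_lt tg1, step_lt tg1, ramp_lt t1, step_lt t1).
  by split; field.
have tg1 : 1 - gap <= t by rewrite (le_trans _ t1)// gerBl ltW.
have tg : gap <= t by rewrite (le_trans _ tg1)// ltW.
have t0 : 0 <= t by rewrite (le_trans _ tg)// ltW.
rewrite /tent /dtent /plateau /dplateau !(ramp_ge t0, step_ge t0, ramp_ge tg, step_ge tg,
  ramp_ge tg1, step_ge tg1, ramp_ge t1, step_ge t1).
have -> : gap = (1 - sg) / 2 by [].
by split; field; rewrite ?sg_neq0 ?subr_eq0 ?gt_eqF.
Qed.

(** As a sum of affine copies this stays piecewise polynomial; if [u] is supported in the unit
    interval, at most one summand is nonzero, which gives the pointwise value. *)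
Definition cells (u : R -> R) (z : R) : R := \sum_(i < N) u (N%:R * z - i%:R).

Definition digit (z : R) : nat := Num.truncn (N%:R * z).
Definition offset (z : R) : R := N%:R * z - (digit z)%:R.

Lemma digitP z : unit_itv z -> (digit z < N)%N /\ unit_itv (offset z).
Proof.
move=> /andP[z0 z1]; have Nz0 : 0 <= N%:R * z by rewrite mulr_ge0// ltW.
have /andP[d1 d2] := truncn_itv Nz0; split.
  rewrite -(ltr_nat R) (le_lt_trans d1)// -[ltRHS]mulr1 ltr_pM2l//.
by rewrite /unit_itv /offset subr_ge0 d1 /= ltrBlDr -natr1 addrC in d2 *.
Qed.

Lemma cells_in u z : supp01 u -> unit_itv z -> cells u z = u (offset z).
Proof.
move=> su uz; have [dN oz] := digitP uz.
rewrite /cells (bigD1 (Ordinal dN))//= big1 ?addr0// => i /eqP ne.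
apply: su; apply/negP => /andP[i0 i1]; apply: ne; apply/val_inj => /=.
have /andP[z0 _] := uz; have Nz0 : 0 <= N%:R * z by rewrite mulr_ge0// ltW.
apply/esym/truncn_def; move: i0 i1; rewrite subr_ge0 ltrBlDr => -> /=.
by rewrite -natr1 addrC.
Qed.

Lemma cells_out u z : supp01 u -> ~~ unit_itv z -> cells u z = 0.
Proof.
move=> su uz; rewrite /cells big1// => i _; apply: su; apply: contra uz.
move=> /andP[i0 i1]; apply/andP; split.
  rewrite -(pmulr_rge0 _ NR_gt0); apply: le_trans (_ : i%:R <= _) => //.
  by rewrite -subr_ge0.
rewrite -(ltr_pM2l NR_gt0) mulr1; move: i1; rewrite ltrBlDr => /lt_le_trans; apply.
by rewrite addrC natr1 ler_nat.
Qed.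

Lemma pw_cells u u' : pw_poly u u' -> pw_poly (cells u) (fun z => N%:R * cells u' z).
Proof.
move=> uu'; apply: (pw_eq _ _ (pw_sum N (u := fun i z => u (N%:R * z - i%:R))
  (u' := fun i z => N%:R * u' (N%:R * z - i%:R)) _)) => [z//|z|i].
  by rewrite /cells mulr_sumr.
exact: (pw_comp_affine i%:R NR_gt0 uu').
Qed.

(* Points outside the middle parts of the cells are sent to the absorbing value
   [-1], which lies outside the unit interval. *)
Definition shift_map (z : R) : R :=
  if unit_itv z && (gap <= offset z < 1 - gap) then (offset z - gap) / sg else -1.

Lemma unit_itv_affine t : unit_itv ((t - gap) / sg) = (gap <= t < 1 - gap).
Proof.
by rewrite /unit_itv ltr_pdivrMr// mul1r ltrBlDr [sg + gap]addrC -gap_sg pmulr_lge0 ?invr_gt0// subr_ge0.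
Qed.

Lemma unit_itvN1 : ~~ unit_itv (-1 : R).
Proof. by rewrite /unit_itv ltNge; lra. Qed.

Lemma unit_shift_map z : unit_itv (shift_map z) =
  unit_itv z && (gap <= offset z < 1 - gap).
Proof.
rewrite /shift_map; case: ifPn => [/andP[_ h]|_]; last exact/negbTE/unit_itvN1.
by rewrite unit_itv_affine.
Qed.

(** [shift_map] is discontinuous, yet its composition with a function supported in the unit interval
    is a finite sum of affine copies, since the gaps and the value -1 contribute 0. This keeps such
    compositions piecewise polynomial and measurable. *)
Lemma cells_shift_map u z : supp01 u ->
  cells (fun t => u ((t - gap) / sg)) z = u (shift_map z).
Proof.
move=> su.
have su' : supp01 (fun t => u ((t - gap) / sg)).
  move=> t nt; apply: su; rewrite unit_itv_affine; apply: contra nt.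
  move=> /andP[t0 t1]; apply/andP; split; first by rewrite (le_trans _ t0)// ltW.
  by rewrite (lt_trans t1)// gtrBl.
have [uz|nuz] := boolP (unit_itv z); last first.
  by rewrite cells_out// /shift_map (negbTE nuz)/= su// unit_itvN1.
rewrite cells_in// /shift_map uz/=; case: ifPn => // nt.
by rewrite [RHS]su ?unit_itvN1// su// unit_itv_affine.
Qed.

(* [alive j] is the union of the intervals of generation [j] of the Cantor
   construction, each of length [len j]. *)
Definition traj (j : nat) (x : R) : R := iter j shift_map x.
Definition alive (j : nat) : set R := [set x | unit_itv (traj j x)].
Definition len (j : nat) : R := (sg / N%:R) ^+ j.

Lemma trajS j x : traj j.+1 x = shift_map (traj j x). Proof. by []. Qed.

Lemma len_gt0 j : 0 < len j.
Proof. by rewrite exprn_gt0// divr_gt0. Qed.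

(** The induction replaces [u] by [u \o shift_map], which is again piecewise polynomial and
    supported in the unit interval; each replacement multiplies the derivative by [N / sg]. *)
Lemma pw_traj u u' j : supp01 u -> supp01 u' -> pw_poly u u' ->
  pw_poly (u \o traj j) (fun x => (len j)^-1 * u' (traj j x)).
Proof.
move=> su su'; elim: j u u' su su' => [|j ih] u u' su su' uu'.
  by apply: pw_eq uu' => x //=; rewrite /len expr0 invr1 mul1r.
pose v z := u (shift_map z); pose v' z := N%:R / sg * u' (shift_map z).
have vv' : pw_poly v v'.
  have h := pw_cells (pw_comp_affine (gap / sg) (_ : 0 < sg^-1) uu').
  apply: (pw_eq _ _ (h _)) => [z|z|]; last by rewrite invr_gt0.
  - rewrite /v -cells_shift_map//; apply: eq_bigr => i _; congr u; field.
    by rewrite sg_neq0.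
  - rewrite /v' -cells_shift_map// /cells !mulr_sumr; apply: eq_bigr => i _.
    rewrite mulrA; congr (_ * u' _); field.
    by rewrite sg_neq0.
have sv : supp01 v.
  move=> z nz; rewrite /v su// unit_shift_map negb_and nz//.
have sv' : supp01 v'.
  by move=> z nz; rewrite /v' su' ?mulr0// unit_shift_map negb_and nz.
apply: pw_eq (ih _ _ sv sv' vv') => x //=.
rewrite /v' /len exprS; set L := (sg / _) ^+ j.
have L0 : L != 0 by rewrite gt_eqF// exprn_gt0// divr_gt0.
by field; rewrite NR_neq0 L0 sg_neq0.
Qed.

Lemma measurable_traj (u : R -> R) j : supp01 u -> measurable_fun setT u ->
  measurable_fun setT (u \o traj j).
Proof.
elim: j u => [|j ih] u su mu_ //.
rewrite (_ : u \o traj j.+1 = (u \o shift_map) \o traj j); last exact/funext.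
apply: ih.
  by move=> z nz /=; rewrite su// unit_shift_map negb_and nz.
rewrite (_ : u \o shift_map = cells (fun t => u ((t - gap) / sg))); last first.
  by apply/funext => z; rewrite cells_shift_map.
apply: measurable_sum => i; apply: measurableT_comp => //.
apply: measurable_funM => //; apply: measurable_funB => //.
by apply: measurable_funB => //; exact: measurable_funM.
Qed.

Lemma supp01_indic : supp01 (\1_([set z | unit_itv z])).
Proof. by move=> z nz; rewrite indicE memNset//; exact/negP. Qed.

Lemma measurable_alive j : measurable (alive j).
Proof.
apply/(measurable_indicP R).
rewrite (_ : \1_(alive j) = \1_([set z | unit_itv z]) \o traj j); last first.
  by apply/funext => z /=; rewrite !indicE /alive; congr (nat_of_bool _)%:R; apply/idP/idP => /set_mem /= ?; apply/mem_set.
apply: measurable_traj; first exact: supp01_indic.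
apply: measurable_indic.
by rewrite (_ : [set z | _] = `[0, 1[%classic).
Qed.

Fixpoint ends (j : nat) : seq R :=
  if j is j'.+1 then
    [seq c + len j' * ((i%:R + gap) / N%:R) | c <- ends j', i <- iota 0 N]
  else [:: 0].

Lemma size_ends j : size (ends j) = (N ^ j)%N.
Proof. by elim: j => // j ih /=; rewrite size_allpairs size_iota ih expnSr. Qed.

Lemma offsetE z : N%:R * z = (digit z)%:R + offset z.
Proof. by rewrite /offset addrC subrK. Qed.

Lemma shift_mapE z : unit_itv (shift_map z) ->
  N%:R * z = (digit z)%:R + gap + sg * shift_map z.
Proof.
rewrite unit_shift_map => h; rewrite /shift_map h offsetE -addrA; congr (_ + _).
by rewrite mulrC divfK// addrC subrK.
Qed.

Lemma aliveW j x : alive j.+1 x -> alive j x.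
Proof. by rewrite /alive /= unit_shift_map => /andP[]. Qed.

Lemma alive_le i j x : (i <= j)%N -> alive j x -> alive i x.
Proof. by move=> /subnK <-; elim: (j - i)%N => // k ih /aliveW. Qed.

Lemma ends_alive j x : alive j x -> exists2 c, c \in ends j & x = c + len j * traj j x.
Proof.
elim: j => [|j ih] ax; first by exists 0; rewrite ?inE// /len expr0 mul1r add0r.
have [c cE xE] := ih (aliveW ax).
exists (c + len j * (((digit (traj j x))%:R + gap) / N%:R)) => /=.
  apply: allpairs_f => //; rewrite mem_iota/= add0n.
  by have [] := digitP (aliveW ax).
rewrite {1}xE -addrA -/(traj j x); congr (_ + _).
have := shift_mapE ax; rewrite -/(traj j x) -trajS; set d := (digit _)%:R => e.
have -> : traj j x = (d + gap + sg * traj j.+1 x) / N%:R by rewrite -e mulrC mulKf.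
by rewrite /len exprS; field; rewrite NR_neq0.
Qed.

(** The set is covered by [N ^ j] intervals of length [(sg / N) ^ j]. *)
Lemma lebesgue_alive j : (mu (alive j) <= (sg ^+ j)%:E)%E.
Proof.
pose J (k : nat) : set R := `[nth 0 (ends j) k, nth 0 (ends j) k + len j[%classic.
have sub : alive j `<=` \bigcup_(k < size (ends j)) J k.
  move=> x ax; have [c cE xE] := ends_alive ax.
  exists (index c (ends j)); first by rewrite /= index_mem.
  rewrite /J /= nth_index// in_itv/= xE lerDl ltrD2l.
  have /andP[u0 u1] := ax; rewrite mulr_ge0//=; last exact/ltW/len_gt0.
  by rewrite -[ltRHS]mulr1 ltr_pM2l// len_gt0.
apply: (@le_trans _ _ (\sum_(k < size (ends j)) mu (J k))%E).
  rewrite bigcup_mkord in sub.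
  apply: (@content_subadditive _ _ _ mu (alive j) J (size (ends j))) => //.
    by move=> k _; exact: measurable_itv.
  exact: measurable_alive.
rewrite (eq_bigr (fun=> (len j)%:E)); last first.
  move=> k _; rewrite /J lebesgue_measure_itv/= lte_fin ltrDl len_gt0.
  by rewrite -EFinB addrAC subrr add0r.
rewrite sumEFin sumr_const card_ord size_ends lee_fin /len exprMn exprVn.
by rewrite -[leLHS]mulr_natr natrX divfK// expf_neq0.
Qed.

(** * Displacements and cutoffs of the planar map *)

Section planar_map.
Variable m : nat -> R.
Hypotheses (m_gt0 : forall j, 0 < m j) (m_lt1 : forall j, m j < 1).
Hypothesis N_gt1 : (1 < N)%N.

Let w : R := 1 - sg.
Let w_gt0 : 0 < w. Proof. by rewrite /w subr_gt0. Qed.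

(* The image interval of generation [j] has length [lenI j]: each of the [N] children
   loses the fraction [(1 - sg) * m j] of its length, instead of [1 - sg] in the source. *)
Definition shrink (j : nat) : R := 1 - (1 - sg) * m j.
Definition lenI (j : nat) : R := \prod_(i < j) (shrink i / N%:R).
(** Derivative, on the intervals of generation [j], of the one-dimensional map made of the first [j]
    displacements. *)
Definition slope (j : nat) : R := lenI j / len j.

Lemma shrinkP j : sg < shrink j < 1.
Proof.
have := m_gt0 j; have := m_lt1 j; have := sg_lt1; rewrite /shrink => h1 h2 h3.
by apply/andP; split; nra.
Qed.

Lemma shrink_gt0 j : 0 < shrink j.
Proof. by have /andP[h _] := shrinkP j; exact: lt_trans h. Qed.

Lemma lenI_gt0 j : 0 < lenI j.
Proof. by apply: prodr_gt0 => i _; rewrite divr_gt0// shrink_gt0. Qed.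

Lemma lenIS j : lenI j.+1 = lenI j * (shrink j / N%:R).
Proof. by rewrite /lenI big_ord_recr. Qed.

Lemma lenS j : len j.+1 = len j * (sg / N%:R).
Proof. by rewrite /len exprSr. Qed.

Lemma slope0 : slope 0 = 1.
Proof. by rewrite /slope /lenI /len big_ord0 expr0 divr1. Qed.

Lemma slopeS j : slope j.+1 = slope j * (shrink j / sg).
Proof.
rewrite /slope lenIS lenS; field.
by rewrite NR_neq0 sg_neq0 gt_eqF// len_gt0.
Qed.

Lemma slope_gt0 j : 0 < slope j.
Proof. by rewrite divr_gt0 ?lenI_gt0 ?len_gt0. Qed.

Lemma slope_leS j : slope j <= slope j.+1.
Proof.
rewrite slopeS ler_pMr ?slope_gt0// ler_pdivlMr// mul1r ltW//.
by case/andP: (shrinkP j).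
Qed.

Lemma slopeS_le j : slope j.+1 <= slope j / sg.
Proof.
rewrite slopeS mulrA ler_pM2r ?invr_gt0// ler_piMr ?ltW ?slope_gt0//.
by case/andP: (shrinkP j).
Qed.

Lemma lenI_le j : lenI j <= (N%:R^-1) ^+ j.
Proof.
elim: j => [|j ih]; first by rewrite /lenI big_ord0 expr0.
rewrite lenIS exprSr ler_pM ?(ltW (lenI_gt0 _)) ?divr_ge0 ?(ltW (shrink_gt0 j))//.
rewrite -[leRHS]mul1r ler_pM2r ?invr_gt0//.
by apply: ltW; case/andP: (shrinkP j).
Qed.

Definition bump (z : R) : R := cells tent z / N%:R.
Definition dbump (z : R) : R := cells dtent z.
Definition cutoff (z : R) : R := cells plateau z.
Definition dcutoff (z : R) : R := N%:R * cells dplateau z.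

Let supp_tent : supp01 tent. Proof. by move=> z /cell_out[]. Qed.
Let supp_dtent : supp01 dtent. Proof. by move=> z /cell_out[]. Qed.
Let supp_plateau : supp01 plateau. Proof. by move=> z /cell_out[]. Qed.
Let supp_dplateau : supp01 dplateau. Proof. by move=> z /cell_out[]. Qed.

Lemma supp_bump : supp01 bump.
Proof. by move=> z nz; rewrite /bump cells_out// mul0r. Qed.
Lemma supp_dbump : supp01 dbump.
Proof. by move=> z nz; rewrite /dbump cells_out. Qed.
Lemma supp_cutoff : supp01 cutoff.
Proof. by move=> z nz; rewrite /cutoff cells_out. Qed.
Lemma supp_dcutoff : supp01 dcutoff.
Proof. by move=> z nz; rewrite /dcutoff cells_out// mulr0. Qed.

Lemma pw_bump : pw_poly bump dbump.
Proof.
apply: (pw_eq _ _ (pw_scale N%:R^-1 (pw_cells pw_tent))) => z.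
  by rewrite mulrC.
by rewrite mulKf.
Qed.

Lemma pw_cutoff : pw_poly cutoff dcutoff.
Proof. exact: pw_cells pw_plateau. Qed.

(** The factor [1 - m j] is dictated by the slopes: on the gaps, where the bump has slope -1, it
    leaves [slope j * m j]; between them it gives [slope j * (shrink j / sg)], that is
    [slope j.+1]. *)
Definition disp (j : nat) (x : R) : R := lenI j * (1 - m j) * bump (traj j x).
Definition ddisp (j : nat) (x : R) : R := slope j * (1 - m j) * dbump (traj j x).
(** The index is shifted: the cutoff of generation [j.+1] is 1 on [alive j.+1] and falls to 0 across
    the gaps of [alive j]. *)
Definition cut (j : nat) (y : R) : R := if j is j'.+1 then cutoff (traj j' y) else 1.
Definition dcut (j : nat) (y : R) : R :=
  if j is j'.+1 then (len j')^-1 * dcutoff (traj j' y) else 0.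

Lemma pw_disp j : pw_poly (disp j) (ddisp j).
Proof.
apply: (pw_eq _ _ (pw_scale (lenI j * (1 - m j)) (pw_traj j supp_bump supp_dbump pw_bump))) => // x.
by rewrite /ddisp /slope; ring.
Qed.

Lemma pw_cut j : pw_poly (cut j) (dcut j).
Proof.
by case: j => [|j]; [exact: pw_cst|exact: (pw_traj j supp_cutoff supp_dcutoff pw_cutoff)].
Qed.

Lemma disp_dead j x : ~ alive j x -> disp j x = 0 /\ ddisp j x = 0.
Proof.
move=> /negP nx; rewrite /disp /ddisp supp_bump// supp_dbump//.
by rewrite !mulr0.
Qed.

Lemma cut_dead j y : ~ alive j y -> cut j.+1 y = 0 /\ dcut j.+1 y = 0.
Proof.
move=> /negP ny; rewrite /cut /dcut supp_cutoff// supp_dcutoff//.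
by rewrite mulr0.
Qed.

Lemma cut_alive j y : alive j y -> cut j y = 1 /\ dcut j y = 0.
Proof.
case: j => [|j] // ay; rewrite /cut /dcut /cutoff /dcutoff.
have uy := aliveW ay; rewrite !cells_in//.
move: ay; rewrite /alive/= unit_shift_map => /andP[_ /cell_mid[_ _ -> ->]].
by rewrite !mulr0.
Qed.

(* [r] is the distance from [z] to the boundary of its cell, in units of the gap
   width [gap / N]. *)
Lemma gap_cases z : unit_itv z -> ~~ unit_itv (shift_map z) ->
  [/\ dbump z = -1 & exists2 r, 0 <= r <= 1 &
      cutoff z = 1 - (1 - r) ^+ 2 /\ `|dcutoff z| = N%:R * (2 / gap * (1 - r))].
Proof.
move=> uz; rewrite unit_shift_map uz/= => nz.
have [_ /andP[h0 h1]] := digitP uz.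
rewrite /dbump /cutoff /dcutoff !cells_in//.
have [og|og] := ltP (offset z) gap.
  have [| _ -> -> ->] := @cell_left (offset z); first by rewrite h0.
  split => //; exists (offset z / gap).
    by rewrite divr_ge0 ?(ltW gap_gt0)// ler_pdivrMr// mul1r ltW.
  split => //; rewrite normrM ger0_norm//; congr (_ * _); rewrite ger0_norm//.
  apply: mulr_ge0; first by rewrite divr_ge0// ltW.
  by rewrite subr_ge0 ler_pdivrMr// mul1r ltW.
have og1 : 1 - gap <= offset z by move: nz; rewrite og/= -leNgt.
have [| _ -> -> ->] := @cell_right (offset z); first by rewrite og1.
have r1 : (1 - offset z) / gap <= 1 by rewrite ler_pdivrMr// mul1r; lra.
split => //; exists ((1 - offset z) / gap).
  by rewrite r1 andbT divr_ge0 ?(ltW gap_gt0)// subr_ge0 ltW.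
split => //; rewrite normrM ger0_norm// normrN; congr (_ * _); rewrite ger0_norm//.
by apply: mulr_ge0; [rewrite divr_ge0// ltW|rewrite subr_ge0].
Qed.

Lemma dbump_mid z : unit_itv (shift_map z) -> dbump z = -1 + sg^-1.
Proof.
rewrite unit_shift_map => /andP[uz oz]; rewrite /dbump cells_in//.
by have [_ ->] := cell_mid oz.
Qed.

Lemma norm_tent t : `|tent t| <= gap.
Proof.
have [u|/cell_out[-> _ _ _]] := boolP (unit_itv t); last by rewrite normr0 ltW.
have /andP[t0 t1] := u.
have [tg|tg] := ltP t gap.
  have [| -> _ _ _] := @cell_left t; first by rewrite t0.
  by rewrite normrN ger0_norm// ltW.
have [tg1|tg1] := ltP t (1 - gap).
  have [| -> _ _ _] := @cell_mid t; first by rewrite tg.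
  rewrite (_ : _ + _ = ((1 - sg) * t - gap) / sg); last by field.
  rewrite normrM [X in _ * X]ger0_norm; last by rewrite invr_ge0 ltW.
  rewrite ler_pdivrMr//.
  by rewrite ler_norml; move: tg tg1; rewrite /gap; have := sg_gt0; have := sg_lt1; nra.
have [| -> _ _ _] := @cell_right t; first by rewrite tg1.
by rewrite ger0_norm ?subr_ge0; [lra|exact: ltW].
Qed.

Lemma norm_bump z : `|bump z| <= gap / N%:R.
Proof.
have [uz|nuz] := boolP (unit_itv z); last first.
  by rewrite supp_bump// normr0 divr_ge0// ltW.
by rewrite /bump cells_in// normrM [X in _ * X]ger0_norm ?invr_ge0// ler_pM2r ?invr_gt0// norm_tent.
Qed.

Lemma cutoff01 z : 0 <= cutoff z <= 1.
Proof.
have [uz|nuz] := boolP (unit_itv z); last by rewrite supp_cutoff// lexx ler01.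
have [uT|nuT] := boolP (unit_itv (shift_map z)).
  have [h _] := @cut_alive 1 z uT.
  by rewrite (h : cutoff z = 1) ler01 lexx.
have [_ [r /andP[r0 r1] [-> _]]] := gap_cases uz nuT.
by apply/andP; split; nra.
Qed.

Lemma cut01 j y : 0 <= cut j y <= 1.
Proof. by case: j => [|j]; [rewrite /cut ler01 lexx|exact: cutoff01]. Qed.

Lemma norm_term j x y : `|cut j y * disp j x| <= (N%:R^-1) ^+ j.
Proof.
rewrite normrM -[leRHS]mul1r ler_pM//.
  by have /andP[? ?] := cut01 j y; rewrite ger0_norm.
rewrite /disp normrM -[leRHS]mulr1 ler_pM//.
  rewrite normrM (ger0_norm (ltW (lenI_gt0 j))) -[leRHS]mulr1 ler_pM ?(ltW (lenI_gt0 j)) ?lenI_le//.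
  by rewrite ger0_norm ?subr_ge0; [rewrite gerBl ltW|exact: ltW].
apply: (le_trans (norm_bump _)); rewrite ler_pdivrMr// mul1r (@le_trans _ _ 1)//.
  by have := gap_lt; lra.
by rewrite ler1n.
Qed.

Lemma slope_ddisp j x : alive j x -> 1 + \sum_(i < j) ddisp i x = slope j.
Proof.
elim: j => [|j ih] ax; first by rewrite big_ord0 addr0 slope0.
rewrite big_ord_recr/= addrA ih; last exact: aliveW.
rewrite /ddisp dbump_mid; last exact: ax.
by rewrite slopeS /shrink; field.
Qed.

(** At level [b] one diagonal entry can be [slope b * m b] while the other is as small as
    [slope b.+1 * m b.+1]; this bounds the first by 4 times the second. *)
Hypothesis m_slow : forall j, m j <= 4 * m j.+1.

(** * Partial sums, their weak derivatives and their values level by level *)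

Definition both (j : nat) : set (R * R) := alive j `*` alive j.

Definition coord_map (n : nat) (z : R * R) : R :=
  z.1 + \sum_(j < n) cut j z.2 * disp j z.1.
Definition diag_entry (n : nat) (z : R * R) : R :=
  1 + \sum_(j < n) cut j z.2 * ddisp j z.1.
Definition offdiag_entry (n : nat) (z : R * R) : R :=
  \sum_(j < n) dcut j z.2 * disp j z.1.
Definition swap (z : R * R) : R * R := (z.2, z.1).

Lemma bounded_weak_partial_eq k (u u' g g' : R * R -> R) :
  u =1 u' -> g =1 g' -> bounded_weak_partial k u g -> bounded_weak_partial k u' g'.
Proof. by move=> /funext -> /funext ->. Qed.

Lemma weak_coord_map0 n : bounded_weak_partial 0 (coord_map n) (diag_entry n).
Proof.
elim: n => [|n ih].
  apply: bounded_weak_partial_eq (bounded_weak_partial_tensor0 pw_id (pw_cst 1)) => z;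
    by rewrite /coord_map /diag_entry big_ord0 /= addr0 mulr1.
apply: bounded_weak_partial_eq (bounded_weak_partialD ih
  (bounded_weak_partial_tensor0 (pw_disp n) (pw_cut n))) => z;
  by rewrite /coord_map /diag_entry big_ord_recr /= addrA [cut n _ * _]mulrC.
Qed.

Lemma weak_coord_map1 n : bounded_weak_partial 1 (coord_map n) (offdiag_entry n).
Proof.
elim: n => [|n ih].
  apply: bounded_weak_partial_eq (bounded_weak_partial_tensor1 pw_id (pw_cst 1)) => z;
    by rewrite /coord_map /offdiag_entry big_ord0 /= ?addr0 ?mulr1 ?mulr0.
apply: bounded_weak_partial_eq (bounded_weak_partialD ih
  (bounded_weak_partial_tensor1 (pw_disp n) (pw_cut n))) => z;
  by rewrite /coord_map /offdiag_entry big_ord_recr /= ?addrA ![_ * disp n _]mulrC.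
Qed.

(** The second component is treated by exchanging the tensor factors, which avoids a change of
    variables in the integrals. *)
Lemma weak_coord_map_swap1 n :
  bounded_weak_partial 1 (coord_map n \o swap) (diag_entry n \o swap).
Proof.
elim: n => [|n ih].
  apply: bounded_weak_partial_eq (bounded_weak_partial_tensor1 (pw_cst 1) pw_id) => z;
    by rewrite /coord_map /diag_entry /= big_ord0 /= addr0 mul1r.
apply: bounded_weak_partial_eq (bounded_weak_partialD ih
  (bounded_weak_partial_tensor1 (pw_cut n) (pw_disp n))) => z;
  by rewrite /coord_map /diag_entry /= big_ord_recr /= addrA.
Qed.

Lemma weak_coord_map_swap0 n :
  bounded_weak_partial 0 (coord_map n \o swap) (offdiag_entry n \o swap).
Proof.
elim: n => [|n ih].
  apply: bounded_weak_partial_eq (bounded_weak_partial_tensor0 (pw_cst 1) pw_id) => z;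
    by rewrite /coord_map /offdiag_entry /= big_ord0 /= ?addr0 ?mul1r ?mul0r.
apply: bounded_weak_partial_eq (bounded_weak_partialD ih
  (bounded_weak_partial_tensor0 (pw_cut n) (pw_disp n))) => z;
  by rewrite /coord_map /offdiag_entry /= big_ord_recr /= ?addrA.
Qed.

Lemma both_swap j z : both j (swap z) = both j z.
Proof. by apply/propext; split => -[]. Qed.

Lemma both_le i j z : (i <= j)%N -> both j z -> both i z.
Proof. by move=> ij [a1 a2]; split; exact: (alive_le ij). Qed.

(** Value of [diag_entry] on [both b] minus [both b.+1]: the generations below [b] have cutoff 1 and
    add up to [slope b], generation [b] is still uncut, and only generation [b.+1] carries a genuine
    cutoff. *)
Definition level_diag (b : nat) (z : R * R) : R :=
  slope b + ddisp b z.1 + cut b.+1 z.2 * ddisp b.+1 z.1.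
Definition level_offdiag (b : nat) (z : R * R) : R := dcut b.+1 z.2 * disp b.+1 z.1.

(** A nonzero term of generation [j] needs [z.1] alive at [j] and [z.2] alive at [j - 1], hence both
    alive at [b.+1]. *)
Lemma terms_vanish b j z : ~ both b.+1 z -> (b.+1 < j)%N ->
  cut j z.2 * ddisp j z.1 = 0 /\ dcut j z.2 * disp j z.1 = 0.
Proof.
case: j => // j nb; rewrite ltnS => bj.
have [a1|/disp_dead[-> ->]] := pselect (alive j.+1 z.1); last by rewrite !mulr0.
have [a2|/cut_dead[-> ->]] := pselect (alive j z.2); last by rewrite !mul0r.
by case: nb; split; [exact: (alive_le (leqW bj) a1)|exact: (alive_le bj a2)].
Qed.

Lemma diag_both n z : both n z -> diag_entry n z = slope n.
Proof.
move=> [a1 a2]; rewrite -(slope_ddisp a1) /diag_entry; congr (1 + _).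
apply: eq_bigr => i _; have [-> _] := cut_alive (alive_le (ltnW (ltn_ord i)) a2).
by rewrite mul1r.
Qed.

Lemma offdiag_both n z : alive n z.2 -> offdiag_entry n.+1 z = 0.
Proof.
move=> a2; rewrite /offdiag_entry big1// => i _.
have ile : (i <= n)%N by rewrite -ltnS.
by have [_ ->] := cut_alive (alive_le ile a2); rewrite mul0r.
Qed.

Lemma level_entries b n z : both b z -> ~ both b.+1 z -> (b.+1 < n)%N ->
  diag_entry n z = level_diag b z /\ offdiag_entry n z = level_offdiag b z.
Proof.
move=> bz nbz bn; have [_ a2] := bz; have [c1 d1] := cut_alive a2.
rewrite -(subnKC bn); elim: (n - b.+2)%N => [|k [ihA ihB]].
  rewrite addn0; split.
    rewrite /diag_entry !big_ord_recr/= !addrA (_ : 1 + _ = diag_entry b z)//.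
    by rewrite diag_both// c1 mul1r.
  by rewrite /offdiag_entry big_ord_recr/= -/(offdiag_entry b.+1 z) offdiag_both// add0r.
have bk : (b.+1 < b.+2 + k)%N by rewrite leq_addr.
have [t1 t2] := terms_vanish nbz bk.
rewrite addnS; split.
  by rewrite /diag_entry big_ord_recr/= addrA -/(diag_entry _ z) ihA t1 addr0.
by rewrite /offdiag_entry big_ord_recr/= -/(offdiag_entry _ z) ihB t2 addr0.
Qed.

Lemma exists_level n z : both 0 z ->
  both n z \/ exists2 b, (b < n)%N & both b z /\ ~ both b.+1 z.
Proof.
move=> b0; elim: n => [|n [bn|[b bn h]]]; first by left.
- have [bS|nbS] := pselect (both n.+1 z); first by left.
  by right; exists n.
- by right; exists b => //; exact: ltnW.
Qed.

Lemma norm_dbump z : `|dbump z| <= sg^-1.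
Proof.
have sg1 : 1 <= sg^-1 by rewrite invf_ge1// ltW.
have [uz|/supp_dbump ->] := boolP (unit_itv z); last by rewrite normr0 (le_trans _ sg1).
have [uT|nuT] := boolP (unit_itv (shift_map z)).
  by rewrite dbump_mid// ger0_norm; lra.
by have [-> _] := gap_cases uz nuT; rewrite normrN1.
Qed.

Lemma norm_ddisp j x : `|ddisp j x| <= slope j / sg.
Proof.
have s0 := slope_gt0 j; have := m_gt0 j; have := m_lt1 j => m1 m0.
rewrite /ddisp normrM ler_pM// ?norm_dbump//.
rewrite normrM (ger0_norm (ltW s0)) ger0_norm; last by rewrite subr_ge0 ltW.
by rewrite ler_piMr// ?ltW//; lra.
Qed.

Lemma norm_dcutoff z : `|dcutoff z| <= N%:R * (2 / gap).
Proof.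
have c0 : 0 <= 2 / gap by rewrite divr_ge0// ltW.
have c1 : 0 <= N%:R * (2 / gap) by rewrite mulr_ge0.
have [uz|/supp_dcutoff ->] := boolP (unit_itv z); last by rewrite normr0.
have [uT|nuT] := boolP (unit_itv (shift_map z)).
  have [_ h] := @cut_alive 1 z uT.
  have : dcutoff z = 0 by move: h; rewrite /dcut /len expr0 invr1 mul1r.
  by move=> ->; rewrite normr0.
have [_ [r /andP[r0 r1] [_ ->]]] := gap_cases uz nuT.
by rewrite ler_wpM2l// ler_piMr//; lra.
Qed.

Lemma norm_disp j x : `|disp j x| <= lenI j * (1 - m j) * (gap / N%:R).
Proof.
have l0 := lenI_gt0 j; have := m_lt1 j => m1.
rewrite /disp normrM ler_pM// ?norm_bump//.
by rewrite ger0_norm// mulr_ge0 ?subr_ge0 ?ltW.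
Qed.

Lemma norm_level_offdiag b z : `|level_offdiag b z| <= 2 * slope b.+1 * (sg / N%:R) * (1 - m b.+1).
Proof.
rewrite /level_offdiag normrM; apply: (@le_trans _ _ ((len b)^-1 * (N%:R * (2 / gap)) *
  (lenI b.+1 * (1 - m b.+1) * (gap / N%:R)))).
  rewrite ler_pM ?norm_disp// normrM ler_pM ?norm_dcutoff// ger0_norm//.
  by rewrite invr_ge0 ltW// len_gt0.
rewrite /slope lenS le_eqVlt; apply/orP; left; apply/eqP; field.
by rewrite NR_neq0 sg_neq0 gap_neq0 gt_eqF// len_gt0.
Qed.

Lemma level_diag_case b z : both b z ->
  (~ alive b.+1 z.1 /\ level_diag b z = slope b * m b) \/
  (alive b.+1 z.1 /\
   level_diag b z = slope b.+1 * (1 + cut b.+1 z.2 * ((1 - m b.+1) * dbump (traj b.+1 z.1)))).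
Proof.
move=> [a1 a2]; have [a1'|na1'] := pselect (alive b.+1 z.1); [right|left]; split => //.
  have e := slope_ddisp a1'; rewrite big_ord_recr/= addrA slope_ddisp// in e.
  by rewrite /level_diag e /ddisp; ring.
have [_ e] := disp_dead na1'; rewrite /level_diag e mulr0 addr0 /ddisp.
have [-> _] := gap_cases a1 (introN idP na1').
by ring.
Qed.

(** The constant collects [slope b], [slope b / sg] and [slope b / sg ^ 2] from the summands of
    [level_diag]. The level may depend on [n], as the sum can stop before the point leaves the
    construction; this is harmless because [dominator] sums over all levels. *)
Lemma entries_bound n z : both 0 z -> exists2 b, both b z &
  `|diag_entry n z| <= 3 / sg ^+ 2 * slope b /\ `|offdiag_entry n z| <= 3 / sg ^+ 2 * slope b.
Proof.
move=> b0.
have sg1 : 1 <= sg^-1 by rewrite invf_ge1// ltW.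
have sg2 : sg^-1 <= sg^-1 ^+ 2 by rewrite expr2 ler_peMl// (le_trans _ sg1).
have c0 : 0 <= 3 / sg ^+ 2 by rewrite divr_ge0// exprn_ge0// ltW.
have c1 : 1 <= 3 / sg ^+ 2 by rewrite -exprVn; lra.
have [bn|[b bn [bz nbz]]] := exists_level n b0.
  exists n => //; rewrite diag_both// (ger0_norm (ltW (slope_gt0 n))).
  split; first by rewrite ler_peMl// ltW// slope_gt0.
  have -> : offdiag_entry n z = 0.
    case: n bn => [|n] bn; first by rewrite /offdiag_entry big_ord0.
    by apply: offdiag_both; apply: aliveW; case: bn.
  by rewrite normr0 mulr_ge0// ltW// slope_gt0.
exists b => //.
have s0 := slope_gt0 b; have s1 := slopeS_le b.
have d1 : `|slope b + ddisp b z.1| <= slope b + slope b / sg.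
  rewrite (le_trans (ler_normD _ _))// lerD ?norm_ddisp//.
  by rewrite ger0_norm// ltW.
move: bn; rewrite leq_eqVlt => /orP[/eqP <-|bn].
  split.
    have -> : diag_entry b.+1 z = slope b + ddisp b z.1.
      rewrite -(diag_both bz) /diag_entry big_ord_recr/= addrA; congr (_ + _).
      by have [-> _] := cut_alive (proj2 bz); rewrite mul1r.
    by apply: (le_trans d1); rewrite -exprVn; nra.
  by rewrite (offdiag_both (proj2 bz)) normr0 mulr_ge0// ltW.
have [-> ->] := level_entries bz nbz bn; split.
  rewrite /level_diag (le_trans (ler_normD _ _))//.
  have : `|cut b.+1 z.2 * ddisp b.+1 z.1| <= slope b / sg ^+ 2.
    have /andP[k0 k1] := cut01 b.+1 z.2.
    rewrite normrM (ger0_norm k0).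
    have := norm_ddisp b.+1 z.1; have n0 := normr_ge0 (ddisp b.+1 z.1) => h.
    apply: (@le_trans _ _ (`|ddisp b.+1 z.1|)); first by rewrite ler_piMl.
    apply: (le_trans h); rewrite -exprVn expr2 mulrA ler_pM2r ?invr_gt0//.
  rewrite -exprVn; nra.
apply: (le_trans (norm_level_offdiag _ _)).
have m0 := m_gt0 b.+1; have m1 := m_lt1 b.+1.
have s1' := slope_gt0 b.+1.
have sN : 0 < sg / N%:R <= 1.
  by rewrite divr_gt0//= ler_pdivrMr// mul1r (le_trans (ltW sg_lt1))// ler1n.
have /andP[k0 k1] := sN.
apply: (@le_trans _ _ (2 * slope b.+1)).
  have s2 : 0 <= 2 * slope b.+1 by apply: mulr_ge0 => //; exact: ltW.
  by rewrite -mulrA ler_piMr// mulr_ile1 ?(ltW k0)//; lra.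
rewrite -exprVn; nra.
Qed.

Lemma level_offdiag_dead b z : ~ alive b.+1 z.1 -> level_offdiag b z = 0.
Proof. by move=> na; rewrite /level_offdiag; have [-> _] := disp_dead na; rewrite mulr0. Qed.

Lemma level_diag_dead b z : both b z -> ~ alive b.+1 z.1 -> level_diag b z = slope b * m b.
Proof. by move=> bz na; have [[_ ->]|[/na]] := level_diag_case bz. Qed.

(* The shear [level_offdiag] is controlled by the square root of the diagonal
   entry because the cutoff is quadratic near the edge of its plateau. *)
Lemma level_alive b z : both b z -> alive b.+1 z.1 -> ~ alive b.+1 z.2 ->
  exists a, [/\ level_diag b z = slope b.+1 * a, m b.+1 <= a <= sg^-1 &
    level_offdiag b z ^+ 2 <= slope b.+1 ^+ 2 * (4 / N%:R ^+ 2) * a].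
Proof.
move=> bz a1 na2; have [[/(_ a1)//]|[_ e]] := level_diag_case bz.
have m0 := m_gt0 b.+1; have m1 := m_lt1 b.+1.
have sg1 : 1 <= sg^-1 by rewrite invf_ge1// ltW.
exists (1 + cut b.+1 z.2 * ((1 - m b.+1) * dbump (traj b.+1 z.1))).
have [_ [r /andP[r0 r1] [cE dE]]] := gap_cases (proj2 bz) (introN idP na2).
have cE' : cut b.+1 z.2 = 1 - (1 - r) ^+ 2 by [].
set a := 1 + _.
(* The bump has slope at least -1; with the quadratic cutoff this leaves the term in [(1 - r) ^ 2],
   which pays for the shear. *)
have am : m b.+1 + (1 - m b.+1) * (1 - r) ^+ 2 <= a.
  have : -1 <= dbump (traj b.+1 z.1).
    by have := norm_dbump (traj b.+1 z.1);
    have [u|u] := boolP (unit_itv (shift_map (traj b.+1 z.1)));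
    [rewrite dbump_mid//; lra|have [-> _] := gap_cases a1 u].
  rewrite /a cE'; set t := dbump _ => t1.
  have c0 : 0 <= 1 - (1 - r) ^+ 2 by nra.
  have : (1 - (1 - r) ^+ 2) * (1 - m b.+1) * (-1) <= (1 - (1 - r) ^+ 2) * (1 - m b.+1) * t.
    by rewrite ler_wpM2l// mulr_ge0// subr_ge0 ltW.
  by rewrite -mulrA; lra.
have a_sg : a <= sg^-1.
  have h : dbump (traj b.+1 z.1) <= sg^-1 - 1.
    have [u|u] := boolP (unit_itv (shift_map (traj b.+1 z.1))).
      by rewrite dbump_mid//; lra.
    by have [-> _] := gap_cases a1 u; lra.
  rewrite /a; have /andP[k0 k1] := cut01 b.+1 z.2.
  have : (cut b.+1 z.2 * (1 - m b.+1)) * dbump (traj b.+1 z.1) <= sg^-1 - 1.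
    apply: (@le_trans _ _ ((cut b.+1 z.2 * (1 - m b.+1)) * (sg^-1 - 1))).
      by rewrite ler_wpM2l// mulr_ge0// subr_ge0 ltW.
    rewrite ler_piMl ?subr_ge0//; apply: mulr_ile1 => //; lra.
  by rewrite -mulrA; lra.
split => //.
  by rewrite a_sg andbT (le_trans _ am)// lerDl mulr_ge0 ?sqr_ge0// subr_ge0 ltW.
(* The derivative of the cutoff is linear in [1 - r]. The gap widths of cutoff and bump cancel, and
   the factor [1 / N] comes from [len b.+1 / len b = sg / N]. *)
have h : `|level_offdiag b z| <= slope b.+1 * (2 / N%:R) * ((1 - m b.+1) * (1 - r)).
  rewrite /level_offdiag normrM.
  apply: (@le_trans _ _ ((len b)^-1 * (N%:R * (2 / gap * (1 - r))) *
    (lenI b.+1 * (1 - m b.+1) * (gap / N%:R)))).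
    rewrite ler_pM ?norm_disp// normrM dE ger0_norm//.
    by rewrite invr_ge0 ltW// len_gt0.
  apply: (@le_trans _ _ (sg * (slope b.+1 * (2 / N%:R) * ((1 - m b.+1) * (1 - r))))).
    rewrite /slope lenS le_eqVlt; apply/orP; left; apply/eqP; field.
    by rewrite NR_neq0 sg_neq0 gap_neq0 gt_eqF// len_gt0.
  have nn : 0 <= slope b.+1 * (2 / N%:R) * ((1 - m b.+1) * (1 - r)).
    apply: mulr_ge0; apply: mulr_ge0; rewrite ?subr_ge0 ?(ltW m1)//.
    exact/ltW/slope_gt0.
  by rewrite ler_piMl// ltW.
have h0 := normr_ge0 (level_offdiag b z).
rewrite -(@real_normK _ (level_offdiag b z)) ?num_real//.
apply: (@le_trans _ _ ((slope b.+1 * (2 / N%:R) * ((1 - m b.+1) * (1 - r))) ^+ 2)).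
  by rewrite !expr2 ler_pM.
rewrite (_ : _ ^+ 2 = (slope b.+1 ^+ 2 * (4 / N%:R ^+ 2)) * ((1 - m b.+1) ^+ 2 * (1 - r) ^+ 2)); last first.
  by field.
apply: ler_wpM2l.
  by apply: mulr_ge0; [exact: sqr_ge0|rewrite divr_ge0// sqr_ge0].
apply: (le_trans _ am); rewrite -[leLHS]add0r lerD ?(ltW m0)//.
by rewrite ler_wpM2r ?sqr_ge0// expr2 ler_piMr ?subr_ge0 ?(ltW m1)//; lra.
Qed.

(** The three summands, divided by [m b], bound the squares of the alive diagonal entry, of the
    shear and of the other diagonal entry, relative to the determinant. *)
Definition distortion_bound (b : nat) : R :=
  (sg ^- 2 + 4 / (N%:R ^+ 2 * sg) + 4 * m b) / m b.

(** At least one coordinate is dead at generation [b.+1]; its row has diagonal entry [slope b * m b]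
    and no shear, so the matrix is triangular. The two cases with one dead coordinate are symmetric
    and go through [core]; with two, the matrix is a multiple of the identity. *)
Lemma level_matrix b z : both b z -> ~ both b.+1 z ->
  let a := level_diag b z in let o := level_offdiag b z in
  let o' := level_offdiag b (swap z) in let a' := level_diag b (swap z) in
  [/\ 0 < a * a' - o * o',
      a ^+ 2 + o ^+ 2 + o' ^+ 2 + a' ^+ 2 <= distortion_bound b * (a * a' - o * o') &
      a * a' - o * o' <= m b * slope b ^+ 2 / sg ^+ 2].
Proof.
move=> bz nbz a o o' a'.
have bz' : both b (swap z) by rewrite both_swap.
have m0 := m_gt0 b; have m1 := m_lt1 b; have s0 := slope_gt0 b.
have sg1 : 1 <= sg^-1 by rewrite invf_ge1// ltW.
have sg2 : 1 <= sg ^- 2 by rewrite -exprVn exprn_ege1.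
have c2 : 0 <= 4 / (N%:R ^+ 2 * sg) :> R.
  by rewrite divr_ge0// mulr_ge0 ?exprn_ge0// ltW.
suff core (A B D : R) (a1 : R) : A = slope b.+1 * a1 -> m b.+1 <= a1 <= sg^-1 ->
    B ^+ 2 <= slope b.+1 ^+ 2 * (4 / N%:R ^+ 2) * a1 -> D = slope b * m b ->
    [/\ 0 < A * D, A ^+ 2 + B ^+ 2 + D ^+ 2 <= distortion_bound b * (A * D) &
        A * D <= m b * slope b ^+ 2 / sg ^+ 2].
  have [a1|na1] := pselect (alive b.+1 z.1).
    have na2 : ~ alive b.+1 z.2 by move=> a2; apply: nbz.
    have [a_ [aE ab oE]] := level_alive bz a1 na2.
    have o'0 : o' = 0 by apply: level_offdiag_dead.
    have a'E : a' = slope b * m b by apply: level_diag_dead.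
    have [h1 h2 h3] := core _ _ _ _ aE ab oE a'E.
    by rewrite /a /o o'0 mulr0 subr0 expr0n/= addr0.
  have o0 : o = 0 by apply: level_offdiag_dead.
  have aE : a = slope b * m b by apply: level_diag_dead.
  have [a2|na2] := pselect (alive b.+1 z.2).
    have [a_ [a'E ab oE]] := level_alive bz' a2 na1.
    have [h1 h2 h3] := core _ _ _ _ a'E ab oE aE.
    rewrite o0 mul0r subr0 expr0n/= addr0 [a * a']mulrC; split => //.
    by apply: le_trans h2; rewrite -/o' -/a'; lra.
  have o'0 : o' = 0 by apply: level_offdiag_dead.
  have a'E : a' = slope b * m b by apply: level_diag_dead.
  rewrite o0 o'0 aE a'E mulr0 subr0 expr0n/= !addr0.
  have D0 : 0 < slope b * m b by rewrite mulr_gt0.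
  split; first by rewrite mulr_gt0.
    rewrite (_ : _ + _ = 2 * (slope b * m b * (slope b * m b))); last by ring.
    apply: ler_wpM2r; first exact/ltW/mulr_gt0.
    by rewrite /distortion_bound ler_pdivlMr//; lra.
  rewrite (_ : _ * _ = m b * slope b ^+ 2 * m b); last by ring.
  apply: ler_wpM2l; last exact/ltW/(lt_le_trans m1).
  by apply: mulr_ge0; [exact: ltW|exact: sqr_ge0].
move=> AE /andP[ma asg] BE DE.
have s1 := slope_gt0 b.+1; have m0' := m_gt0 b.+1; have msl := m_slow b.
have sS := slope_leS b; have sS' := slopeS_le b.
have a10 : 0 < a1 by rewrite (lt_le_trans m0').
have A0 : 0 < A by rewrite AE mulr_gt0.
have D0 : 0 < D by rewrite DE mulr_gt0.
have sA : A <= slope b / sg ^+ 2.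
  rewrite AE expr2 invfM mulrA ler_pM// ltW//.
split; first by rewrite mulr_gt0.
  have t1 : A ^+ 2 * m b <= sg ^- 2 * (A * D).
    rewrite (_ : A ^+ 2 * m b = A * m b * A); last by ring.
    rewrite (_ : sg ^- 2 * (A * D) = A * m b * (slope b / sg ^+ 2)); last first.
      by rewrite DE; field.
    by apply: ler_wpM2l => //; apply: mulr_ge0; exact: ltW.
  have t2 : B ^+ 2 * m b <= 4 / (N%:R ^+ 2 * sg) * (A * D).
    apply: (@le_trans _ _ (slope b.+1 ^+ 2 * (4 / N%:R ^+ 2) * a1 * m b)).
      by apply: ler_wpM2r => //; exact: ltW.
    rewrite (_ : slope b.+1 ^+ 2 * (4 / N%:R ^+ 2) * a1 * m b =
      (4 / N%:R ^+ 2 * A * m b) * slope b.+1); last by rewrite AE; ring.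
    rewrite (_ : _ * (A * D) = (4 / N%:R ^+ 2 * A * m b) * (slope b / sg)); last first.
      by rewrite DE; field; rewrite sg_neq0 NR_neq0.
    apply: ler_wpM2l => //; apply: mulr_ge0; last exact: ltW.
    by apply: mulr_ge0; [rewrite divr_ge0// sqr_ge0|exact: ltW].
  (* Here [m_slow] enters, as [D = slope b * m b <= 4 * A]. *)
  have t3 : D ^+ 2 * m b <= 4 * m b * (A * D).
    rewrite (_ : D ^+ 2 * m b = (D * m b) * (slope b * m b)); last by rewrite -DE; ring.
    rewrite (_ : 4 * m b * (A * D) = (D * m b) * (4 * A)); last by ring.
    apply: ler_wpM2l; first by apply: mulr_ge0; exact: ltW.
    rewrite AE; apply: (@le_trans _ _ (slope b * (4 * a1))).
      by apply: ler_wpM2l; [exact: ltW|lra].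
    by rewrite mulrCA; apply: ler_wpM2l => //; apply: ler_wpM2r => //; exact: ltW.
  by rewrite /distortion_bound mulrAC ler_pdivlMr// !mulrDl; lra.
rewrite DE (_ : _ * _ = m b * slope b * A); last by ring.
rewrite (_ : m b * _ / _ = m b * slope b * (slope b / sg ^+ 2)); last by field.
by apply: ler_wpM2l => //; apply: mulr_ge0; exact: ltW.
Qed.

(** * The limit map and its Sobolev regularity *)

Notation sq := (open_square R).

Definition limit_map (z : R * R) : R :=
  z.1 + limn (series (fun j => cut j z.2 * disp j z.1)).
Definition planar_map (z : R * R) : R * R := (limit_map z, limit_map (swap z)).

Let rho0 : 0 <= (N%:R^-1 : R). Proof. by rewrite invr_ge0. Qed.
Let rho1 : (N%:R^-1 : R) < 1. Proof. by rewrite invf_lt1// ltr1n. Qed.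

Let continuous_term j : continuous (fun z : R * R => cut j z.2 * disp j z.1).
Proof.
move=> z; apply: cvgM.
  by apply: (continuous_comp (f := snd) (g := cut j)); [exact: cvg_snd|exact: (pw_continuous (pw_cut j))].
by apply: (continuous_comp (f := fst) (g := disp j)); [exact: cvg_fst|exact: (pw_continuous (pw_disp j))].
Qed.

Let term_bound j (z : R * R) : `|cut j z.2 * disp j z.1| <= (N%:R^-1) ^+ j.
Proof. exact: norm_term. Qed.

Lemma coord_mapE n z :
  coord_map n z = z.1 + series (fun j => cut j z.2 * disp j z.1) n.
Proof. by rewrite /coord_map /series/= big_mkord. Qed.

Lemma continuous_swap : continuous swap.
Proof.
move=> z; apply: (@cvg_pair _ _ _ _ (nbhs z.2) (nbhs z.1)); [exact: cvg_snd|exact: cvg_fst].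
Qed.

Lemma continuous_limit_map : continuous limit_map.
Proof.
move=> z; apply: cvgD; first exact: cvg_fst.
exact: (continuous_series_lim rho0 rho1 continuous_term term_bound).
Qed.

Lemma continuous_planar_map : continuous planar_map.
Proof.
move=> z; apply: (@cvg_pair _ _ _ _ (nbhs (limit_map z)) (nbhs (limit_map (swap z)))).
  exact: continuous_limit_map.
apply: (continuous_comp (f := swap) (g := limit_map)); first exact: continuous_swap.
exact: continuous_limit_map.
Qed.

Lemma coord_map_cvg z : coord_map n z @[n --> \oo] --> limit_map z.
Proof.
rewrite (_ : (fun n => _) = (fun n => z.1 + series (fun j => cut j z.2 * disp j z.1) n)); last first.
  by apply/funext => n; exact: coord_mapE.
apply: cvgD; first exact: cvg_cst.
exact: (@geometric_series_cvg _ _ (fun j z => cut j z.2 * disp j z.1) _ rho0 rho1 term_bound z).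
Qed.

Lemma coord_map_bound n z : sq z -> `|coord_map n z| <= 1 + (1 - N%:R^-1)^-1.
Proof.
move=> [/=]; rewrite in_itv/= => /andP[z0 z1] _.
rewrite coord_mapE (le_trans (ler_normD _ _))// lerD//.
  by rewrite ger0_norm ltW.
have := series_tail_bound rho0 rho1 term_bound z (leq0n n).
by rewrite {2}/series/= big_geq// subr0 expr0 mul1r.
Qed.

Lemma measurable_both j : measurable (both j).
Proof. by apply: measurableX; exact: measurable_alive. Qed.

Lemma lebesgue_both j : (leb2 R (both j) <= ((sg ^+ j) ^+ 2)%:E)%E.
Proof.
have -> : leb2 R (both j) = (mu (alive j) * mu (alive j))%E.
  by apply: product_measure1E; exact: measurable_alive.
by rewrite expr2 EFinM lee_pmul// lebesgue_alive.
Qed.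

Definition surviving : set R := [set x | forall j, alive j x].

Lemma negligible_surviving : (leb2 R).-negligible (surviving `*` surviving).
Proof.
exists (\bigcap_j both j); split.
- by apply: bigcapT_measurable => j; exact: measurable_both.
- apply/eqP; rewrite eq_le measure_ge0 andbT.
  have sub j : (leb2 R (\bigcap_j both j) <= ((sg ^+ 2) ^+ j)%:E)%E.
    rewrite -exprM mulnC exprM; apply: le_trans (lebesgue_both j).
    apply: le_measure; rewrite ?inE.
    + by apply: bigcapT_measurable => i; exact: measurable_both.
    + exact: measurable_both.
    + by move=> z; exact.
  have cv : (((sg ^+ 2) ^+ j)%:E @[j --> \oo] --> (0 : R)%:E)%E.
    apply: cvg_EFin; first by near=> n.
    by apply: cvg_expr; rewrite ger0_norm ?exprn_ge0 ?ltW// expr_lt1// ltW.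
  rewrite -[leRHS](cvg_lim (@ereal_hausdorff R) cv).
  apply: lime_ge; first by apply/cvg_ex; eexists; exact: cv.
  by near=> n; exact: sub.
- by move=> [x y] [sx sy] j _; split; [exact: sx|exact: sy].
Unshelve. all: by end_near. Qed.

Lemma both_level z : both 0 z -> ~ (surviving `*` surviving) z ->
  exists2 b, both b z & ~ both b.+1 z.
Proof.
move=> b0 ns; apply: contrapT => h; apply: ns.
have bj j : both j z.
  by elim: j => // j bj; apply: contrapT => nbj; apply: h; exists j.
by split => j /=; case: (bj j).
Qed.

Lemma sq_both0 z : sq z -> both 0 z.
Proof.
by move=> [/=]; rewrite !in_itv/= => /andP[x0 x1] /andP[y0 y1]; split;
  rewrite /alive/= /unit_itv ltW.
Qed.

(* The partial sums are stationary off the surviving set; they are replaced by [0]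
   as long as the level of the point is not reached, so as to converge everywhere. *)
Definition resolved (u : nat -> R * R -> R) (n : nat) (z : R * R) : R :=
  u n z * (\1_(both 0) z * (1 - \1_(both n) z)).
Definition limit_entry (u : nat -> R * R -> R) (z : R * R) : R :=
  limn (resolved u ^~ z).

Lemma resolved_near (u : nat -> R * R -> R) (v : nat -> R * R -> R) b z :
  both b z -> ~ both b.+1 z ->
  (forall n, (b.+1 < n)%N -> u n z = v b z) ->
  \forall n \near \oo, resolved u n z = v b z.
Proof.
move=> bz nbz uv; near=> n.
have bn : (b.+1 < n)%N by near: n; exact: nbhs_infty_gt.
rewrite /resolved uv// !indicE mem_set; last exact: both_le bz.
rewrite memNset ?subr0 ?mulr1// => /both_le h; apply: nbz; apply: h.
exact: ltnW.
Unshelve. all: by end_near. Qed.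

Lemma resolved_cst (u : nat -> R * R -> R) z : (forall n, resolved u n z = 0) ->
  resolved u n z @[n --> \oo] --> (0 : R).
Proof. by move=> h; under eq_fun do rewrite h; exact: cvg_cst. Qed.

Section entry.
Variables (u v : nat -> R * R -> R).
Hypothesis uv : forall b z n, both b z -> ~ both b.+1 z -> (b.+1 < n)%N -> u n z = v b z.

Lemma limit_entryE b z : both b z -> ~ both b.+1 z -> limit_entry u z = v b z.
Proof.
move=> bz nbz; apply/cvg_lim => //.
apply: cvg_near_cst; apply: resolved_near => // n; exact: uv.
Qed.

Lemma resolved_cvg z : resolved u n z @[n --> \oo] --> limit_entry u z.
Proof.
suff : cvgn (resolved u ^~ z) by [].
have [b0|nb0] := pselect (both 0 z); last first.
  apply/cvg_ex; exists 0; apply: resolved_cst => n.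
  by rewrite /resolved indicE memNset// mul0r mulr0.
have [s|ns] := pselect ((surviving `*` surviving) z).
  apply/cvg_ex; exists 0; apply: resolved_cst => n.
  rewrite /resolved [X in 1 - X]indicE mem_set ?subrr ?mulr0//.
  by split; [exact: (proj1 s)|exact: (proj2 s)].
have [b bz nbz] := both_level b0 ns.
apply/cvg_ex; exists (v b z).
by apply: cvg_near_cst; apply: resolved_near => // n; exact: uv.
Qed.

Lemma entry_ae : {ae leb2 R, forall z, sq z -> u n z @[n --> \oo] --> limit_entry u z}.
Proof.
have [A [mA A0 sA]] := negligible_surviving; exists A; split => // z nz; apply: sA.
apply: contrapT => ns; apply: nz => sz.
have [b bz nbz] := both_level (sq_both0 sz) ns.
rewrite (limit_entryE bz nbz); apply: cvg_near_cst.
by near=> n; apply: uv => //; near: n; exact: nbhs_infty_gt.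
Unshelve. all: by end_near. Qed.

Lemma measurable_limit_entry : (forall n, measurable_fun setT (u n)) ->
  measurable_fun setT (limit_entry u).
Proof.
move=> mu_; apply: (@measurable_fun_cvg _ _ _ setT (resolved u)).
  move=> n; apply: measurable_funM => //; apply: measurable_funM.
    by apply: measurable_indic; exact: measurable_both.
  by apply: measurable_funB => //; apply: measurable_indic; exact: measurable_both.
by move=> z _; exact: resolved_cvg.
Qed.

Lemma limit_entry_surviving z : (surviving `*` surviving) z -> limit_entry u z = 0.
Proof.
move=> s; apply/cvg_lim => //; apply: resolved_cst => n.
rewrite /resolved [X in 1 - X]indicE mem_set ?subrr ?mulr0//.
by split; [exact: (proj1 s)|exact: (proj2 s)].
Qed.

End entry.

(** Total length [N ^ j * lenI j] of the image intervals of generation [j]. *)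
Definition mass (j : nat) : R := \prod_(i < j) shrink i.

Lemma massS j : mass j.+1 = mass j * shrink j.
Proof. by rewrite /mass big_ord_recr. Qed.

Lemma mass_gt0 j : 0 < mass j.
Proof. by apply: prodr_gt0 => i _; exact: shrink_gt0. Qed.

Lemma mass_le1 j : mass j <= 1.
Proof.
elim: j => [|j ih]; first by rewrite /mass big_ord0.
rewrite massS (le_trans _ ih)// ler_piMr ?(ltW (mass_gt0 j))//.
by apply: ltW; case/andP: (shrinkP j).
Qed.

Lemma slope_mass j : slope j * sg ^+ j = mass j.
Proof.
elim: j => [|j ih]; first by rewrite slope0 expr0 mulr1 /mass big_ord0.
by rewrite slopeS massS -ih exprS; field.
Qed.

Lemma nneseries_ge_term (u : nat -> R) b : (forall j, 0 <= u j) ->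
  ((u b)%:E <= \sum_(0 <= j <oo) (u j)%:E)%E.
Proof.
move=> u0; apply: (@le_trans _ _ (\sum_(0 <= j < b.+1) (u j)%:E)%E).
  by rewrite big_nat_recr//= leeDr// sume_ge0// => j _; rewrite lee_fin.
by apply: nneseries_lim_ge => j _ _; rewrite lee_fin.
Qed.

Let c3 : R := 3 / sg ^+ 2.
Let c3_ge0 : 0 <= c3. Proof. by rewrite divr_ge0// exprn_ge0// ltW. Qed.

(** Integrable because [slope j] times the measure of [both j] is at most
    [slope j * sg ^ (2 * j) = mass j * sg ^ j], the term of a convergent geometric series up to
    [mass j <= 1]. *)
Definition dominator (z : R * R) : \bar R :=
  (\sum_(0 <= j <oo) (3 / sg ^+ 2 * slope j * \1_(both j) z)%:E)%E.

Lemma integrable_dominator : (leb2 R).-integrable sq dominator.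
Proof.
apply: (@indic_series_integrable _ _ _ (geometric c3 sg)).
- exact: measurable_both.
- by move=> j; apply: mulr_ge0 => //; exact/ltW/slope_gt0.
- move=> j; rewrite -/c3.
  apply: (@le_trans _ _ ((c3 * slope j)%:E * ((sg ^+ j) ^+ 2)%:E)%E).
    apply: lee_wpmul2l; last exact: lebesgue_both.
    by rewrite lee_fin; apply: mulr_ge0 => //; exact/ltW/slope_gt0.
  rewrite -EFinM lee_fin /geometric/=.
  have -> : c3 * slope j * sg ^+ j ^+ 2 = c3 * mass j * sg ^+ j.
    by rewrite -(slope_mass j) expr2 !mulrA.
  by rewrite ler_wpM2r ?exprn_ge0 ?(ltW sg_gt0)// ler_piMr// mass_le1.
- by apply: is_cvg_geometric_series; rewrite ger0_norm// ltW.
Qed.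

Lemma dominator_ge b z x : both b z -> x <= c3 * slope b -> (x%:E <= dominator z)%E.
Proof.
move=> bz xb; apply: (@le_trans _ _ (c3 * slope b * \1_(both b) z)%:E).
  by rewrite lee_fin indicE mem_set// mulr1.
apply: (nneseries_ge_term (u := fun j => c3 * slope j * \1_(both j) z)) => j.
by apply: mulr_ge0 => //; apply: mulr_ge0 => //; exact/ltW/slope_gt0.
Qed.

Lemma diag_dominated n z : sq z -> (`|diag_entry n z|%:E <= dominator z)%E.
Proof.
by move=> /sq_both0/(entries_bound n)[b bz [h _]]; exact: dominator_ge bz h.
Qed.

Lemma offdiag_dominated n z : sq z -> (`|offdiag_entry n z|%:E <= dominator z)%E.
Proof.
by move=> /sq_both0/(entries_bound n)[b bz [_ h]]; exact: dominator_ge bz h.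
Qed.

Lemma sq_swap z : sq z -> sq (swap z).
Proof. by move=> [a1 a2]; split. Qed.

Lemma diag_swap_dominated n z : sq z -> (`|(diag_entry n \o swap) z|%:E <= dominator z)%E.
Proof.
move=> /sq_swap/sq_both0/(entries_bound n)[b]; rewrite both_swap => bz [h _].
exact: dominator_ge bz h.
Qed.

Lemma offdiag_swap_dominated n z : sq z -> (`|(offdiag_entry n \o swap) z|%:E <= dominator z)%E.
Proof.
move=> /sq_swap/sq_both0/(entries_bound n)[b]; rewrite both_swap => bz [_ h].
exact: dominator_ge bz h.
Qed.

Let diag_level b z n : both b z -> ~ both b.+1 z -> (b.+1 < n)%N ->
  diag_entry n z = level_diag b z.
Proof. by move=> bz nbz bn; have [] := level_entries bz nbz bn. Qed.

Let offdiag_level b z n : both b z -> ~ both b.+1 z -> (b.+1 < n)%N ->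
  offdiag_entry n z = level_offdiag b z.
Proof. by move=> bz nbz bn; have [] := level_entries bz nbz bn. Qed.

Let diag_swap_level b z n : both b z -> ~ both b.+1 z -> (b.+1 < n)%N ->
  (diag_entry n \o swap) z = (level_diag b \o swap) z.
Proof. by rewrite -(both_swap b) -(both_swap b.+1); exact: diag_level. Qed.

Let offdiag_swap_level b z n : both b z -> ~ both b.+1 z -> (b.+1 < n)%N ->
  (offdiag_entry n \o swap) z = (level_offdiag b \o swap) z.
Proof. by rewrite -(both_swap b) -(both_swap b.+1); exact: offdiag_level. Qed.

Lemma limit_entry_dominated (u v : nat -> R * R -> R) :
  (forall b z n, both b z -> ~ both b.+1 z -> (b.+1 < n)%N -> u n z = v b z) ->
  (forall n z, sq z -> (`|u n z|%:E <= dominator z)%E) ->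
  forall z, sq z -> (`|limit_entry u z|%:E <= dominator z)%E.
Proof.
move=> uv ud z sz; have [s|ns] := pselect ((surviving `*` surviving) z).
  rewrite limit_entry_surviving// normr0; apply: (dominator_ge (sq_both0 sz)).
  by apply: mulr_ge0 => //; exact/ltW/slope_gt0.
have [b bz nbz] := both_level (sq_both0 sz) ns.
rewrite (limit_entryE uv bz nbz); have <- := uv b z b.+2 bz nbz (ltnSn _).
exact: ud.
Qed.

Lemma weak_limit_entry k (c u v : nat -> R * R -> R) (cl : R * R -> R) (M : R) :
  (forall n, bounded_weak_partial k (c n) (u n)) ->
  (forall z, c n z @[n --> \oo] --> cl z) -> continuous cl ->
  (forall n z, sq z -> `|c n z| <= M) ->
  (forall b z n, both b z -> ~ both b.+1 z -> (b.+1 < n)%N -> u n z = v b z) ->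
  (forall n z, sq z -> (`|u n z|%:E <= dominator z)%E) ->
  [/\ measurable_fun setT (limit_entry u),
      (leb2 R).-integrable sq (EFin \o limit_entry u) &
      weak_partial sq k cl (limit_entry u)].
Proof.
move=> wp cc ccl cM uv ud.
have mu_ n : measurable_fun setT (u n) by case: (wp n).
have ml := measurable_limit_entry uv mu_.
split => //.
  apply: (dominated_integrable_sq ml integrable_dominator).
  exact: (limit_entry_dominated uv ud).
apply: (weak_partial_lim wp (M := M) (G := dominator)) => //.
- exact: continuous_measurable_plane.
- exact: entry_ae uv.
- exact: integrable_dominator.
Qed.

Definition Dmap (z : R * R) : 'M[R]_2 := \matrix_(i, j)
  if i == 0 then (if j == 0 then limit_entry diag_entry z else limit_entry offdiag_entry z)
  else (if j == 0 then limit_entry (fun n => offdiag_entry n \o swap) z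
        else limit_entry (fun n => diag_entry n \o swap) z).

Lemma ord2 (i : 'I_2) : i = 0 \/ i = 1.
Proof. by case: i => -[|[|]]// h; [left|right]; exact/val_inj. Qed.

Lemma Dmap_entries (i j : 'I_2) :
  [/\ measurable_fun setT (fun z => Dmap z i j),
      (leb2 R).-integrable sq (EFin \o (fun z => Dmap z i j)) &
      weak_partial sq j (Defs.coord i \o planar_map) (fun z => Dmap z i j)].
Proof.
have cs : continuous (limit_map \o swap).
  move=> z; apply: (continuous_comp (f := swap) (g := limit_map)); first exact: continuous_swap.
  exact: continuous_limit_map.
have [->|->] := ord2 i; have [->|->] := ord2 j.
- rewrite (_ : (fun z => Dmap z 0 0) = limit_entry diag_entry); last first.
    by apply/funext => z; rewrite mxE.
  rewrite (_ : Defs.coord 0 \o planar_map = limit_map)//.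
  exact: (weak_limit_entry weak_coord_map0 coord_map_cvg continuous_limit_map
    coord_map_bound diag_level diag_dominated).
- rewrite (_ : (fun z => Dmap z 0 1) = limit_entry offdiag_entry); last first.
    by apply/funext => z; rewrite mxE.
  rewrite (_ : Defs.coord 0 \o planar_map = limit_map)//.
  exact: (weak_limit_entry weak_coord_map1 coord_map_cvg continuous_limit_map
    coord_map_bound offdiag_level offdiag_dominated).
- rewrite (_ : (fun z => Dmap z 1 0) = limit_entry (fun n => offdiag_entry n \o swap)); last first.
    by apply/funext => z; rewrite mxE.
  rewrite (_ : Defs.coord 1 \o planar_map = limit_map \o swap)//.
  apply: (weak_limit_entry weak_coord_map_swap0 (fun z => @coord_map_cvg (swap z)) cs
    (fun n z sz => coord_map_bound n (sq_swap sz)) offdiag_swap_level offdiag_swap_dominated).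
- rewrite (_ : (fun z => Dmap z 1 1) = limit_entry (fun n => diag_entry n \o swap)); last first.
    by apply/funext => z; rewrite mxE.
  rewrite (_ : Defs.coord 1 \o planar_map = limit_map \o swap)//.
  apply: (weak_limit_entry weak_coord_map_swap1 (fun z => @coord_map_cvg (swap z)) cs
    (fun n z sz => coord_map_bound n (sq_swap sz)) diag_swap_level diag_swap_dominated).
Qed.

Lemma continuous_coord (i : 'I_2) : continuous (Defs.coord i \o planar_map).
Proof.
have [->|->] := ord2 i => z.
  exact: continuous_limit_map.
apply: (continuous_comp (f := swap) (g := limit_map)); first exact: continuous_swap.
exact: continuous_limit_map.
Qed.

Lemma sobolev11_planar_map : sobolev11 sq planar_map Dmap.
Proof.
split => [i|i j|i j]; last 2 first.
- by have [] := Dmap_entries i j.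
- by have [] := Dmap_entries i j.
apply: bounded_sq_integrable.
  by apply: continuous_measurable_plane; exact: continuous_coord.
by apply: continuous_bounded_sq; exact: continuous_coord.
Qed.

Lemma sobolev11_loc_planar_map : sobolev11_loc sq planar_map Dmap.
Proof.
have [h1 h2 h3] := sobolev11_planar_map; split => [i|i j|//].
  apply: integrable_L1_loc => //.
  by apply: continuous_measurable_plane; exact: continuous_coord.
by apply: integrable_L1_loc => //; have [] := Dmap_entries i j.
Qed.

(** * Integrability of the Jacobian and of the exponential of the distortion *)

Lemma Dmap_level b z : both b z -> ~ both b.+1 z ->
  [/\ 0 < \det (Dmap z), op_norm (Dmap z) ^+ 2 <= distortion_bound b * \det (Dmap z) &
      \det (Dmap z) <= m b * slope b ^+ 2 / sg ^+ 2].
Proof.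
move=> bz nbz; have [h1 h2 h3] := level_matrix bz nbz.
have e00 : Dmap z 0 0 = level_diag b z by rewrite mxE /= (limit_entryE diag_level bz).
have e01 : Dmap z 0 1 = level_offdiag b z by rewrite mxE /= (limit_entryE offdiag_level bz).
have e10 : Dmap z 1 0 = level_offdiag b (swap z).
  by rewrite mxE /= (limit_entryE offdiag_swap_level bz).
have e11 : Dmap z 1 1 = level_diag b (swap z).
  by rewrite mxE /= (limit_entryE diag_swap_level bz).
have dE : \det (Dmap z) = level_diag b z * level_diag b (swap z) -
    level_offdiag b z * level_offdiag b (swap z) by rewrite det2E e00 e01 e10 e11.
rewrite dE; split => //; apply: (le_trans (op_norm_sqr_le_frob _)).
by rewrite /frob e00 e01 e10 e11.
Qed.

Lemma Dmap_surviving z : (surviving `*` surviving) z -> \det (Dmap z) = 0.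
Proof.
by move=> s; rewrite det2E !mxE/= !limit_entry_surviving// mulr0 subrr.
Qed.

Lemma measurable_det : measurable_fun setT (fun z => \det (Dmap z)).
Proof.
have mD i j : measurable_fun setT (fun z => Dmap z i j) by have [] := Dmap_entries i j.
under eq_fun do rewrite det2E.
by apply: measurable_funB; apply: measurable_funM.
Qed.

Lemma measurable_distortion_Dmap : measurable_fun setT (distortion Dmap).
Proof. by apply: measurable_distortion => i j; have [] := Dmap_entries i j. Qed.

(** The series telescopes: [w * m j * mass j] is [mass j - mass j.+1]. *)
Lemma cvg_mass_series : cvgn (series (fun j => m j * mass j / sg ^+ 2)).
Proof.
have tel n : series (fun j => m j * mass j / sg ^+ 2) n = (1 - mass n) / (w * sg ^+ 2).
  elim: n => [|n ih]; first by rewrite /series/= big_geq// /mass big_ord0 subrr mul0r.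
  rewrite seriesSr ih massS /shrink -/w; field.
  by rewrite sg_neq0 /w subr_eq0 gt_eqF.
apply: nondecreasing_is_cvgn.
  apply/nondecreasing_seqP => n; rewrite seriesSr lerDl divr_ge0 ?exprn_ge0 ?(ltW sg_gt0)//.
  by apply: mulr_ge0; [exact: ltW|exact/ltW/mass_gt0].
exists (1 / (w * sg ^+ 2)) => _ [n _ <-]; rewrite tel ler_pM2r; last first.
  by rewrite invr_gt0 mulr_gt0// exprn_gt0.
by rewrite gerBl ltW// mass_gt0.
Qed.

Lemma integrable_det : (leb2 R).-integrable sq (EFin \o (fun z => \det (Dmap z))).
Proof.
(* Weighted by the measure of [both j], these bounds become [m j * mass j ^ 2 / sg ^ 2]; one factor
   [mass j] is discarded to reach the telescoping series. *)
pose c j := m j * slope j ^+ 2 / sg ^+ 2.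
have c0 j : 0 <= c j.
  apply: divr_ge0; last by rewrite exprn_ge0// ltW.
  by apply: mulr_ge0; [exact: ltW|exact: sqr_ge0].
have ib := @indic_series_integrable _ both c _ measurable_both c0 _ cvg_mass_series.
apply: (dominated_integrable_sq measurable_det (ib _)) => [j|z sz].
  apply: (@le_trans _ _ ((c j)%:E * ((sg ^+ j) ^+ 2)%:E)%E).
    by apply: lee_wpmul2l; [rewrite lee_fin|exact: lebesgue_both].
  rewrite -EFinM lee_fin /c.
  have -> : m j * slope j ^+ 2 / sg ^+ 2 * sg ^+ j ^+ 2 = m j * mass j ^+ 2 / sg ^+ 2.
    by rewrite -(slope_mass j); move: (sg ^+ j) (slope j) => t s; field.
  apply: ler_wpM2r; first by rewrite invr_ge0 exprn_ge0// ltW.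
  apply: ler_wpM2l; first exact: ltW.
  by rewrite expr2 ler_piMr ?mass_le1//; exact/ltW/mass_gt0.
have [s|ns] := pselect ((surviving `*` surviving) z).
  rewrite Dmap_surviving// normr0; apply: nneseries_ge0 => j _ _.
  by rewrite lee_fin mulr_ge0.
have [b bz nbz] := both_level (sq_both0 sz) ns.
have [d0 _ dc] := Dmap_level bz nbz; rewrite gtr0_norm//.
apply: (@le_trans _ _ (c b * \1_(both b) z)%:E).
  by rewrite lee_fin indicE mem_set// mulr1.
by apply: (nneseries_ge_term (u := fun j => c j * \1_(both j) z)) => j; exact: mulr_ge0.
Qed.

Lemma finite_distortion_planar_map : finite_distortion (closed_square R) planar_map Dmap.
Proof.
rewrite /finite_distortion interior_closed_square; split.
- by apply: continuous_subspaceT; exact: continuous_planar_map.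
- exact: sobolev11_loc_planar_map.
- exact: integrable_L1_loc measurable_det integrable_det.
- exists (distortion Dmap); split.
  + exact: measurable_funTS measurable_distortion_Dmap.
  + by move=> z _; exact: le1_distortion.
  + have [A [mA A0 sA]] := negligible_surviving; exists A; split => // z nz; apply: sA.
    apply: contrapT => ns; apply: nz => sz.
    have [b bz nbz] := both_level (sq_both0 sz) ns.
    have [d0 _ _] := Dmap_level bz nbz.
    by rewrite /distortion d0 divfK// gt_eqF.
Qed.

Lemma distortion_le z : sq z -> exists2 b, both b z & distortion Dmap z <= distortion_bound b.
Proof.
move=> sz; have [s|ns] := pselect ((surviving `*` surviving) z).
  (* The determinant vanishes on the surviving set, so the distortion is 1 by convention and level 0
     will do. *)
  exists 0%N; first exact: sq_both0.
  rewrite /distortion Dmap_surviving// ltxx /distortion_bound ler_pdivlMr// mul1r.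
  have : 1 <= sg ^- 2 by rewrite -exprVn exprn_ege1// invf_ge1// ltW.
  have : 0 <= 4 / (N%:R ^+ 2 * sg) by rewrite divr_ge0// mulr_ge0 ?exprn_ge0// ltW.
  by have := m_gt0 0; lra.
have [b bz nbz] := both_level (sq_both0 sz) ns; exists b => //.
have [d0 h _] := Dmap_level bz nbz.
by rewrite /distortion d0 ler_pdivrMr.
Qed.

(** Concavity of the logarithm gives [ln y <= ln x + y / x - 1]. The monotonicity allows the
    distortion to be replaced by its bound in the exponent. *)
Lemma ratio_ln_le (x y : R) : 1 <= x -> x <= y -> x / (1 + ln x) <= y / (1 + ln y).
Proof.
move=> x1 xy; have x0 : 0 < x by rewrite (lt_le_trans ltr01).
have y0 : 0 < y by exact: lt_le_trans xy.
have lx : 0 <= ln x by exact: ln_ge0.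
have ly : 0 <= ln y by rewrite ln_ge0// (le_trans x1).
rewrite ler_pdivrMr; last lra.
rewrite mulrAC ler_pdivlMr; last lra.
have : ln y <= ln x + (y / x - 1).
  have yx : 0 < y / x by rewrite divr_gt0.
  have -> : ln y = ln x + ln (1 + (y / x - 1)).
    rewrite -lnM ?posrE//; last by rewrite addrC subrK.
    by congr ln; field; rewrite gt_eqF.
  by rewrite lerD2l le_ln1Dx// ltrBrDr; lra.
move=> h; have : x * ln y <= x * (ln x + (y / x - 1)) by rewrite ler_pM2l.
have -> : x * (ln x + (y / x - 1)) = x * ln x + y - x by field; rewrite gt_eqF.
nra.
Qed.

Lemma measurable_exp_ratio (K : R * R -> R) : measurable_fun setT K ->
  (forall z, 1 <= K z) -> measurable_fun setT (fun z => expR (K z / (1 + ln (K z)))).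
Proof.
move=> mK K1; rewrite (_ : (fun z => _) =
  fun z => expR (K z * (1 + ln (K z)) `^ (-1))); last first.
  apply/funext => z; rewrite powR_inv1// addr_ge0// ln_ge0//.
apply: measurableT_comp => //; apply: measurable_funM => //.
have ml : measurable_fun setT (fun z => 1 + ln (K z)).
  by apply: measurable_funD => //; apply: measurableT_comp => //; exact: measurable_ln.
exact: (measurableT_comp (f := fun x : R => x `^ (- 1)) (measurable_powR _) ml).
Qed.

Lemma Lp_loc_distortion (p : R) : 0 <= p ->
  cvgn (series (fun b => expR (p * (distortion_bound b / (1 + ln (distortion_bound b)))) *
    (sg ^+ b) ^+ 2)) ->
  Lp_loc p sq (fun z => expR (distortion Dmap z / (1 + ln (distortion Dmap z)))).
Proof.
move=> p0 cv; pose E b := expR (p * (distortion_bound b / (1 + ln (distortion_bound b)))).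
have mg := measurable_exp_ratio measurable_distortion_Dmap (@le1_distortion _ Dmap).
split; first exact: measurable_funTS.
have mgp : measurable_fun setT (fun z =>
    `|expR (distortion Dmap z / (1 + ln (distortion Dmap z)))| `^ p).
  apply: (measurableT_comp (f := fun x : R => x `^ p) (measurable_powR _)).
  exact: measurableT_comp.
apply: integrable_L1_loc => //.
have E0 b : 0 <= E b by exact: expR_ge0.
have ib := @indic_series_integrable _ both E _ measurable_both E0 _ cv.
apply: (dominated_integrable_sq mgp (ib _)) => [j|z sz].
  rewrite EFinM; apply: lee_wpmul2l; last exact: lebesgue_both.
  by rewrite lee_fin.
rewrite ger0_norm ?powR_ge0// ger0_norm ?expR_ge0//.
have [b bz Kb] := distortion_le sz.
apply: (@le_trans _ _ (E b * \1_(both b) z)%:E); last first.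
  by apply: (nneseries_ge_term (u := fun j => E j * \1_(both j) z)) => j; exact: mulr_ge0.
rewrite lee_fin indicE mem_set// mulr1 /powR gt_eqF ?expR_gt0// expRK ler_expR.
apply: ler_wpM2l => //; apply: ratio_ln_le => //.
exact: le1_distortion.
Qed.

(** * Dimension of the source set *)

Lemma ends_square j z : both j z -> exists2 U, U \in [seq
    (`[cc.1, cc.1 + len j]%classic `*` `[cc.2, cc.2 + len j]%classic : set (R * R))
    | cc <- [seq (c, c') | c <- ends j, c' <- ends j]] & U z.
Proof.
move=> [/= a1 a2]; have [c cE xE] := ends_alive a1; have [c' cE' yE] := ends_alive a2.
exists (`[c, c + len j]%classic `*` `[c', c' + len j]%classic).
  by apply/mapP; exists (c, c') => //; exact: allpairs_f.
have l0 := len_gt0 j.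
have itv x d : unit_itv x -> d <= d + len j * x <= d + len j.
  move=> /andP[x0 x1]; rewrite lerDl mulr_ge0 ?(ltW l0)//= lerD2l ler_piMr ?(ltW l0)//.
  exact: ltW.
by split => /=; rewrite in_itv/=; [have := itv _ c a1; rewrite -xE|have := itv _ c' a2; rewrite -yE].
Qed.

Lemma hausdorff_dim_surviving : (hausdorff_dim (surviving `*` surviving) < 2%:E)%E.
Proof.
have NR1 : 1 < N%:R :> R by rewrite ltr1n.
have lN : 0 < ln N%:R :> R by rewrite ln_gt0.
have ls : ln sg < 0 by rewrite ln_lt0// sg_gt0.
(* Chosen so that [(sg / N) ^ s = sg / N ^ 2] for [s = 2 - kap]: the [N ^ (2 * j)] covering squares
   then contribute [sg ^ j] up to a constant. This [s] is halfway between 2 and the similarity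
   dimension [2 - 2 * kap]. *)
pose kap := - ln sg / (ln N%:R - ln sg).
have dk : 0 < ln N%:R - ln sg :> R by lra.
have k0 : 0 < kap by rewrite divr_gt0// oppr_gt0.
have k1 : kap < 1 by rewrite ltr_pdivrMr//; lra.
pose s := 2 - kap.
have s0 : 0 < s by rewrite /s; lra.
apply: (@le_lt_trans _ _ s%:E); last by rewrite lte_fin /s; lra.
apply: ereal_inf_lbound; exists s => //; split => //.
apply: hausdorff_measure_eq0 => d d0.
have h0 (t : R) : 0 <= t `^ s by exact: powR_ge0.
apply/eqP; rewrite eq_le hausdorff_delta_ge0// andbT.
have lenE j : (2 * len j) `^ s = 2 `^ s * (sg / N%:R ^+ 2) ^+ j.
  have l0 := len_gt0 j.
  rewrite powRM ?(ltW l0)//; congr (_ * _).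
  have -> : len j `^ s = ((sg / N%:R) `^ s) ^+ j.
    by rewrite /len -!powR_mulrn ?powR_ge0 ?divr_ge0 ?(ltW sg_gt0)// -!powRrM (mulrC s).
  congr (_ ^+ j).
  rewrite /powR gt_eqF ?divr_gt0// lnM ?posrE ?invr_gt0// lnV ?posrE//.
  have -> : s * (ln sg - ln N%:R) = ln sg - ln (N%:R ^+ 2).
    by rewrite lnXn// /s /kap mulr2n; field; rewrite gt_eqF.
  by rewrite expRD expRN !lnK ?posrE// exprn_gt0.
have bound j : 2 * len j <= d ->
    (hausdorff_delta (fun t : R => (t `^ s)%R) d (surviving `*` surviving) <= (2 `^ s * sg ^+ j)%:E)%E.
  move=> jd; have l0 := len_gt0 j.
  pose S := [seq (`[cc.1, cc.1 + len j]%classic `*` `[cc.2, cc.2 + len j]%classic : set (R * R))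
    | cc <- [seq (c, c') | c <- ends j, c' <- ends j]].
  have cS z : (surviving `*` surviving) z -> exists2 U, U \in S & U z.
    by move=> hz; apply: (@ends_square j); split; [exact: (proj1 hz)|exact: (proj2 hz)].
  have sE : size S = (N ^ j * N ^ j)%N by rewrite size_map size_allpairs size_ends.
  apply: (le_trans (@hausdorff_delta_finite _ (fun t : R => (t `^ s)%R) d _ S
    ((2 * len j) `^ s) h0 _ (ltW d0) cS _)).
  - by rewrite powR0// gt_eqF.
  - move=> U /mapP[[c c'] _ ->] /=.
    set V := _ `*` _.
    have dU : (diam V <= (2 * len j)%:E)%E.
      apply: diam_le => [|[x y] [u v] [/= + +] [/= + +]]; first by rewrite mulr_ge0// ltW.
      rewrite !in_itv/= => /andP[x0 x1] /andP[y0 y1] /andP[u0 u1] /andP[v0 v1].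
      apply: (le_trans (eucl_dist_le _ _)) => /=; rewrite mulr_natl mulr2n.
      by apply: lerD; rewrite ler_norml; lra.
    split; first by rewrite (le_trans dU)// lee_fin.
    have fd : diam V \is a fin_num.
      by rewrite ge0_fin_numE ?diam_ge0// (le_lt_trans dU)// ltry.
    apply: ge0_ler_powR; rewrite ?nnegrE ?mulr_ge0 ?(ltW s0) ?(ltW l0)//.
      by rewrite fine_ge0// diam_ge0.
    by rewrite -lee_fin fineK.
  rewrite lee_fin sE lenE natrM natrX.
  rewrite (_ : _ * _ = 2 `^ s * (N%:R ^+ j ^+ 2 * (sg / N%:R ^+ 2) ^+ j)); last by rewrite expr2; ring.
  apply: ler_wpM2l => //; rewrite expr_div_n -!exprM mulnC mulrCA divff ?mulr1//.
  by rewrite expf_neq0.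
have cv : ((2 `^ s * sg ^+ j)%:E @[j --> \oo] --> (2 `^ s * 0 : R)%:E)%E.
  apply: cvg_EFin; first by near=> n.
  apply: cvgM; first exact: cvg_cst.
  by apply: cvg_expr; rewrite ger0_norm// ltW.
rewrite mulr0 in cv; rewrite -[leRHS](cvg_lim (@ereal_hausdorff R) cv).
apply: lime_ge; first by apply/cvg_ex; eexists; exact: cv.
have cl : (2 * len j) @[j --> \oo] --> (2 * 0 : R).
  apply: cvgM; first exact: cvg_cst.
  apply: cvg_expr; rewrite ger0_norm ?divr_ge0 ?(ltW sg_gt0)//.
  by rewrite ltr_pdivrMr// mul1r (lt_trans sg_lt1).
rewrite mulr0 in cl; move/cvgrPdist_le : cl => /(_ d d0) cl.
near=> j; apply: bound; have : `|0 - 2 * len j| <= d by near: j.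
by rewrite sub0r normrN; apply: le_trans; exact: ler_norm.
Unshelve. all: by end_near. Qed.

(** * The image set and the mass distribution argument *)

Definition left_end (n : nat) (x : R) : R :=
  \sum_(j < n) lenI j * (((digit (traj j x))%:R + gap * m j) / N%:R).

Lemma left_endS n x : left_end n.+1 x =
  left_end n x + lenI n * (((digit (traj n x))%:R + gap * m n) / N%:R).
Proof. by rewrite /left_end big_ord_recr. Qed.

Lemma digit_le z : unit_itv z -> (digit z)%:R + 1 <= N%:R :> R.
Proof. by move=> /digitP[dN _]; rewrite natr1 ler_nat. Qed.

Lemma left_end_nested n k x : (n <= k)%N -> alive k x ->
  left_end n x <= left_end k x /\ left_end k x + lenI k <= left_end n x + lenI n.
Proof.
move=> /subnKC <-; elim: (k - n)%N => [|i ih] ax; first by rewrite addn0.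
rewrite addnS in ax *; have [ih1 ih2] := ih (aliveW ax).
set j := (n + i)%N in ax ih1 ih2 *.
have l0 := lenI_gt0 j; have m0 := m_gt0 j.
have dj := digit_le (aliveW ax : unit_itv (traj j x)).
rewrite left_endS; set d := (digit _)%:R in dj *.
have d0 : 0 <= d by exact: ler0n.
split.
  apply: (le_trans ih1); rewrite lerDl; apply: mulr_ge0; first exact: ltW.
  by rewrite divr_ge0// addr_ge0// mulr_ge0// ltW.
apply: le_trans ih2; rewrite lenIS -addrA lerD2l -mulrDr ler_piMr ?(ltW l0)//.
rewrite -mulrDl ler_pdivrMr// mul1r /shrink.
have -> : (1 - sg) * m j = 2 * (gap * m j) by rewrite /gap; field.
have : 0 <= gap * m j by rewrite mulr_ge0// ltW.
by lra.
Qed.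

(** Inside a cell, source and image positions differ by [1 - m n] times the tent, so the displaced
    point is affine on each interval of generation [n] and fills the image interval that starts at
    [left_end n x]. *)
Lemma image_partial n x : alive n x ->
  x + \sum_(j < n) disp j x = left_end n x + lenI n * traj n x.
Proof.
elim: n => [|n ih] ax; first by rewrite /left_end /lenI !big_ord0 addr0 add0r mul1r.
rewrite big_ord_recr/= addrA ih; last exact: aliveW.
rewrite left_endS lenIS -!addrA; congr (_ + _).
have uz : unit_itv (traj n x) by exact: (aliveW ax).
have e := shift_mapE ax.
have zE : traj n x = ((digit (traj n x))%:R + gap + sg * shift_map (traj n x)) / N%:R.
  by rewrite -e mulrC mulKf.
have bE : bump (traj n x) = ((1 - sg) * shift_map (traj n x) - gap) / N%:R.
  rewrite /bump cells_in//; congr (_ / _).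
  have := ax; rewrite /alive/= unit_shift_map => /andP[_ oz].
  have [-> _ _ _] := cell_mid oz.
  have -> : offset (traj n x) = gap + sg * shift_map (traj n x).
    by apply: (@addrI _ (digit (traj n x))%:R); rewrite -offsetE e addrA.
  by field.
rewrite /disp bE {1}zE /shrink; have -> : sg = 1 - 2 * gap by rewrite /gap; field.
by field.
Qed.

(** Since [y] survives, every cutoff equals 1: the two variables decouple, and the nested image
    intervals of [x] contain the limit. *)
Lemma limit_map_itv n x y : surviving x -> surviving y ->
  left_end n x <= limit_map (x, y) <= left_end n x + lenI n.
Proof.
move=> sx sy.
have cv := @coord_map_cvg (x, y).
have e k : coord_map k (x, y) = left_end k x + lenI k * traj k x.
  rewrite -(image_partial (sx k)) /coord_map/=; congr (_ + _).
  by apply: eq_bigr => j _; have [-> _] := cut_alive (sy j); rewrite mul1r.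
have bnd k : (n <= k)%N -> left_end n x <= coord_map k (x, y) <= left_end n x + lenI n.
  move=> nk; rewrite e; have [h1 h2] := left_end_nested nk (sx k).
  have /andP[t0 t1] : unit_itv (traj k x) := sx k.
  have l0 := lenI_gt0 k.
  apply/andP; split; first by rewrite (le_trans h1)// lerDl mulr_ge0// ltW.
  by apply: le_trans h2; rewrite lerD2l ler_piMr// ltW.
rewrite -(cvg_lim (@Rhausdorff R) cv); apply/andP; split.
  apply: limr_ge; first by apply/cvg_ex; eexists; exact: cv.
  near=> k; have nk : (n <= k)%N by near: k; exact: nbhs_infty_ge.
  by have /andP[] := bnd k nk.
apply: limr_le; first by apply/cvg_ex; eexists; exact: cv.
near=> k; have nk : (n <= k)%N by near: k; exact: nbhs_infty_ge.
  by have /andP[] := bnd k nk.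
Unshelve. all: by end_near. Qed.

Lemma image_closed_square :
  planar_map @` (surviving `*` surviving) `<=` closed_square R.
Proof.
have h x y : surviving x -> surviving y -> 0 <= limit_map (x, y) <= 1.
  move=> sx sy; have := limit_map_itv 0 sx sy.
  by rewrite /left_end /lenI !big_ord0 add0r.
by move=> _ [[x y] [sx sy] <-]; split => /=; rewrite in_itv/= h.
Qed.

Lemma surviving_closed_square : surviving `*` surviving `<=` closed_square R.
Proof.
by move=> [x y] [/= /(_ 0%N) /andP[x0 x1] /(_ 0%N) /andP[y0 y1]]; split => /=;
  rewrite in_itv/= ?x0 ?y0/= ltW.
Qed.

(* [cantor_pt y] has the base [N] digits of [y] as its Cantor digits. *)
Definition cantor_term (k : nat) (y : R) : R :=
  (sg / N%:R) ^+ k * (((digit (iter k offset y))%:R + gap) / N%:R).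
Definition cantor_pt (y : R) : R := limn (series (cantor_term ^~ y)).

Lemma unit_iter_offset k y : unit_itv y -> unit_itv (iter k offset y).
Proof. by move=> uy; elim: k => //= k /digitP[]. Qed.

Let ratio : R := sg / N%:R.
Let ratio_ge0 : 0 <= ratio. Proof. by rewrite divr_ge0// ltW. Qed.
Let ratio_lt1 : ratio < 1.
Proof. by rewrite /ratio ltr_pdivrMr// mul1r (lt_trans sg_lt1)// ltr1n. Qed.

Lemma cantor_term_bound k y : unit_itv y -> `|cantor_term k y| <= ratio ^+ k.
Proof.
move=> /(unit_iter_offset k)/digit_le dk; rewrite /cantor_term.
rewrite ger0_norm; last first.
  by rewrite mulr_ge0 ?exprn_ge0// divr_ge0// addr_ge0// ltW.
rewrite ler_piMr ?exprn_ge0// ler_pdivrMr// mul1r.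
by have := gap_lt; lra.
Qed.

Lemma cantor_series_cvg y : unit_itv y -> cvgn (series (cantor_term ^~ y)).
Proof.
move=> uy; apply: (@geometric_series_cvg _ _ (fun k _ => cantor_term k y) ratio
  ratio_ge0 ratio_lt1 (fun k _ => cantor_term_bound k uy) y).
Qed.

Lemma cantor_seriesS n y : series (cantor_term ^~ y) n.+1 =
  ((digit y)%:R + gap) / N%:R + ratio * series (cantor_term ^~ (offset y)) n.
Proof.
rewrite /series/= big_nat_recl// {1}/cantor_term expr0 mul1r/=; congr (_ + _).
rewrite mulr_sumr; apply: eq_bigr => i _.
by rewrite /cantor_term exprS -mulrA iterSr.
Qed.

(** The last child ends at distance [gap / N] from the right end. This margin survives in the limit
    and keeps [cantor_pt] strictly below 1, as the half-open [unit_itv] demands. *)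
Lemma cantor_series_le n y : unit_itv y ->
  series (cantor_term ^~ y) n <= 1 - gap / N%:R.
Proof.
have g1 : gap / N%:R <= 1.
  by rewrite ler_pdivrMr// mul1r (@le_trans _ _ 1) ?ler1n//; have := gap_lt; lra.
elim: n y => [|n ih] y uy; first by rewrite /series/= big_geq// subr_ge0.
have [_ uo] := digitP uy; have dy := digit_le uy; have := ih _ uo => ihy.
rewrite cantor_seriesS.
have : ratio * series (cantor_term ^~ (offset y)) n <= ratio * 1.
  apply: ler_wpM2l => //; apply: (le_trans ihy).
  by rewrite gerBl divr_ge0// ltW.
have : ((digit y)%:R + gap) / N%:R <= (N%:R - 1 + gap) / N%:R.
  by rewrite ler_pM2r ?invr_gt0//; lra.
have -> : (N%:R - 1 + gap) / N%:R = 1 - gap / N%:R - ratio :> R.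
  have -> : ratio = (1 - 2 * gap) / N%:R by rewrite /ratio /gap; field.
  by field.
by lra.
Qed.

Lemma cantor_ptE y : unit_itv y ->
  N%:R * cantor_pt y = (digit y)%:R + gap + sg * cantor_pt (offset y).
Proof.
move=> uy; have [_ uo] := digitP uy.
have cv := cantor_series_cvg uy; have cvo := cantor_series_cvg uo.
have cv1 : (fun n => series (cantor_term ^~ y) n.+1) @ \oo --> cantor_pt y.
  by rewrite (cvg_shiftS (series (cantor_term ^~ y))); exact: cv.
have cv2 : (fun n => series (cantor_term ^~ y) n.+1) @ \oo -->
    ((digit y)%:R + gap) / N%:R + ratio * cantor_pt (offset y).
  under eq_fun do rewrite cantor_seriesS.
  by apply: cvgD; [exact: cvg_cst|apply: cvgM; [exact: cvg_cst|exact: cvo]].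
rewrite (cvg_unique (@Rhausdorff R) cv1 cv2) /ratio; field.
exact: NR_neq0.
Qed.

Lemma unit_cantor_pt y : unit_itv y -> unit_itv (cantor_pt y).
Proof.
move=> uy; have cv := cantor_series_cvg uy.
have t0 k : 0 <= cantor_term k y.
  by rewrite mulr_ge0 ?exprn_ge0// divr_ge0// addr_ge0// ltW.
apply/andP; split.
  apply: limr_ge; first exact: cv.
  by near=> n; apply: sumr_ge0.
apply: (@le_lt_trans _ _ (1 - gap / N%:R)).
  apply: limr_le; first exact: cv.
  by near=> n; exact: cantor_series_le.
by rewrite gtrBl divr_gt0.
Unshelve. all: by end_near. Qed.

(** [cantor_pt] conjugates the base [N] shift with [shift_map]; hence its values survive forever and
    have prescribed digits. *)
Lemma cantor_pt_dynamics y : unit_itv y ->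
  digit (cantor_pt y) = digit y /\ shift_map (cantor_pt y) = cantor_pt (offset y).
Proof.
move=> uy; have [_ uo] := digitP uy; have e := cantor_ptE uy.
have /andP[c0 c1] := unit_cantor_pt uo.
have sc0 : 0 <= sg * cantor_pt (offset y) by rewrite mulr_ge0// ltW.
have sc1 : sg * cantor_pt (offset y) < sg by rewrite gtr_pMr.
have dE : digit (cantor_pt y) = digit y.
  apply: truncn_def; rewrite e -natr1; apply/andP; split.
    by rewrite -addrA lerDl addr_ge0// ltW.
  by have := gap_sg; have := gap_gt0; lra.
split => //; have oE : offset (cantor_pt y) = gap + sg * cantor_pt (offset y).
  by rewrite /offset dE e; ring.
rewrite /shift_map oE unit_cantor_pt//=.
have -> : (gap <= gap + sg * cantor_pt (offset y) < 1 - gap) = true.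
  by apply/andP; split; [rewrite lerDl|rewrite gap_sg ltrD2l].
by rewrite addrAC subrr add0r mulrC mulKf.
Qed.

Lemma traj_cantor_pt k y : unit_itv y -> traj k (cantor_pt y) = cantor_pt (iter k offset y).
Proof.
move=> uy; elim: k => // k ih; rewrite trajS ih.
by have [_ ->] := cantor_pt_dynamics (unit_iter_offset k uy).
Qed.

Lemma surviving_cantor_pt y : unit_itv y -> surviving (cantor_pt y).
Proof.
move=> uy k; rewrite /alive/= traj_cantor_pt//.
exact/unit_cantor_pt/unit_iter_offset.
Qed.

Fixpoint prefix (n : nat) (y : R) : nat :=
  if n is n'.+1 then (N * prefix n' y + digit (iter n' offset y))%N else 0.

Lemma prefixE n y : N%:R ^+ n * y = (prefix n y)%:R + iter n offset y.
Proof.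
elim: n => [|n ih]; first by rewrite expr0 mul1r add0r.
by rewrite exprS -mulrA ih mulrDr (offsetE (iter n offset y))/= natrD natrM addrA.
Qed.

Lemma prefix_le n y y' : unit_itv y -> unit_itv y' -> y <= y' ->
  (prefix n y <= prefix n y')%N.
Proof.
move=> uy uy' yy'; rewrite leqNgt; apply/negP => lt.
have /andP[f0 f1] := unit_iter_offset n uy; have /andP[f0' f1'] := unit_iter_offset n uy'.
have : N%:R ^+ n * y <= N%:R ^+ n * y' by rewrite ler_wpM2l// exprn_ge0.
rewrite !prefixE; move: lt; rewrite -(ler_nat R) -natr1; lra.
Qed.

(** The gap corrections of the two points cancel, and [lenI n.+1 <= lenI n / N], so reading one more
    digit cannot spoil the inequality. *)
Lemma prefix_left_end n y y' : unit_itv y -> unit_itv y' -> y <= y' ->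
  lenI n * ((prefix n y')%:R - (prefix n y)%:R) <=
  left_end n (cantor_pt y') - left_end n (cantor_pt y).
Proof.
move=> uy uy' yy'; elim: n => [|n ih].
  by rewrite /left_end /lenI !big_ord0 /=; lra.
have p0 : 0 <= (prefix n.+1 y')%:R - (prefix n.+1 y)%:R :> R.
  by rewrite subr_ge0 ler_nat prefix_le.
have dE z : unit_itv z -> digit (traj n (cantor_pt z)) = digit (iter n offset z).
  by move=> uz; rewrite traj_cantor_pt//; have [-> _] := cantor_pt_dynamics (unit_iter_offset n uz).
rewrite !left_endS !dE// lenIS.
apply: (@le_trans _ _ (lenI n / N%:R * ((prefix n.+1 y')%:R - (prefix n.+1 y)%:R))).
  apply: ler_wpM2r => //; apply: ler_wpM2l; first exact/ltW/lenI_gt0.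
  rewrite -[leRHS]mul1r ler_pM2r ?invr_gt0//.
  by apply: ltW; case/andP: (shrinkP n).
rewrite /= !natrD !natrM; set d := (digit (iter n offset y))%:R.
set d' := (digit (iter n offset y'))%:R.
set P := (prefix n y)%:R in ih *; set P' := (prefix n y')%:R in ih *.
rewrite (_ : _ / _ * _ = lenI n * (P' - P) + lenI n * ((d' - d) / N%:R)); last first.
  by rewrite /P /P' /d /d'; field.
lra.
Qed.

(** An inverse modulus of continuity. Dividing by [N ^ n] turns [lenI n] into [mass n]; one error
    [N ^- n] accounts for the digits after the first [n], the other for the position inside the
    image interval. *)
Lemma modulus_limit_map n y y' t t' : unit_itv y -> unit_itv y' -> surviving t -> surviving t' ->
  `|y - y'| <= `|limit_map (cantor_pt y, t) - limit_map (cantor_pt y', t')| / mass n +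
    2 * (N%:R^-1) ^+ n.
Proof.
wlog yy' : y y' t t' / y <= y' => [hw|].
  have [yy'|y'y] := leP y y'; first exact: hw.
  move=> uy uy' st st'; rewrite distrC [X in _ <= X / _ + _]distrC.
  by apply: hw => //; exact: ltW.
move=> uy uy' st st'.
have pl := prefix_left_end n uy uy' yy'.
have /andP[a1 a2] := limit_map_itv n (surviving_cantor_pt uy) st.
have /andP[b1 b2] := limit_map_itv n (surviving_cantor_pt uy') st'.
have /andP[f0 f1] := unit_iter_offset n uy; have /andP[f0' f1'] := unit_iter_offset n uy'.
have Nn : 0 < N%:R ^+ n :> R by rewrite exprn_gt0.
have l0 := lenI_gt0 n.
have massE : mass n = N%:R ^+ n * lenI n.
  elim: (n) => [|k ih]; first by rewrite /mass /lenI !big_ord0 mulr1.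
  by rewrite massS lenIS ih exprS; field.
have dist : left_end n (cantor_pt y') - left_end n (cantor_pt y) <=
    `|limit_map (cantor_pt y, t) - limit_map (cantor_pt y', t')| + lenI n.
  by have := ler_norm (limit_map (cantor_pt y', t') - limit_map (cantor_pt y, t)); rewrite distrC; lra.
rewrite distrC ger0_norm ?subr_ge0//.
set D := `|_ - _| in dist *.
have h : N%:R ^+ n * (y' - y) <= D / lenI n + 2.
  have : (prefix n y')%:R - (prefix n y)%:R <= (D + lenI n) / lenI n.
    by rewrite ler_pdivlMr// mulrC; lra.
  rewrite mulrDl divff ?gt_eqF// mulrBr !prefixE; lra.
rewrite -(ler_pM2l Nn); apply: (le_trans h); rewrite mulrDr massE exprVn.
rewrite le_eqVlt; apply/orP; left; apply/eqP; field.
by rewrite !gt_eqF.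
Qed.

(** The sets [U i] are arbitrary and are not measured themselves: by the hypothesis on [h],
    parameters of points of [U i] differ by at most [phi i] in each coordinate. Squares of side
    [2 * phi i] then cover the unit square, and [(2 * phi i) ^ 2 = 4 * c * h (D i)]. *)
Lemma hausdorff_measure_image (h : R -> R) (c d0 : R) : (forall t, 0 <= h t) ->
  0 < c -> 0 < d0 ->
  (forall y D : R, 0 <= y <= 1 -> 0 <= D <= d0 ->
    (forall n, y <= D / mass n + 2 * (N%:R^-1) ^+ n) -> y ^+ 2 <= c * h D) ->
  (0 < hausdorff_measure h (planar_map @` (surviving `*` surviving)))%E.
Proof.
move=> h0 c0 d0_gt0 hc; set C' := _ @` _.
apply: (@lt_le_trans _ _ ((4 * c)^-1)%:E).
  by rewrite lte_fin invr_gt0 mulr_gt0.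
apply: (hausdorff_measure_ge d0_gt0); apply: le_ereal_inf_tmp => _ [U [CU Ud] <-].
pose cpt (y : R * R) := (cantor_pt y.1, cantor_pt y.2).
pose D i := fine (diam (U i)).
have dfin i : diam (U i) \is a fin_num.
  by rewrite ge0_fin_numE ?diam_ge0// (le_lt_trans (Ud i))// ltry.
have D0 i : 0 <= D i <= d0.
  by rewrite fine_ge0 ?diam_ge0//= -lee_fin fineK.
pose phi i := Num.sqrt (c * h (D i)).
have phi2 i : phi i ^+ 2 = c * h (D i) by rewrite sqr_sqrtr// mulr_ge0// ltW.
have phi0 i : 0 <= phi i by exact: sqrtr_ge0.
have close i (y z : R * R) : sq y -> sq z -> U i (planar_map (cpt y)) ->
    U i (planar_map (cpt z)) -> `|y.1 - z.1| <= phi i /\ `|y.2 - z.2| <= phi i.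
  move=> [/= + +] [/= + +]; rewrite !in_itv/= => /andP[y0 y1] /andP[y0' y1'].
  move=> /andP[z0 z1] /andP[z0' z1'] Uy Uz.
  have uu (t : R) : 0 < t -> t < 1 -> unit_itv t by move=> t0 t1; rewrite /unit_itv ltW.
  have dD := diam_ge Uy Uz; rewrite -(fineK (dfin i)) lee_fin in dD.
  have key (a b s t : R) : 0 < a -> a < 1 -> 0 < b -> b < 1 -> surviving s -> surviving t ->
      `|limit_map (cantor_pt a, s) - limit_map (cantor_pt b, t)| <= D i -> `|a - b| <= phi i.
    move=> a0 a1 b0 b1 ss st ab.
    rewrite -[leLHS]ger0_norm// -sqrtr_sqr ler_wsqrtr//; apply: hc => //.
      by rewrite normr_ge0/= ler_norml; lra.
    move=> n; apply: (le_trans (modulus_limit_map n (uu _ a0 a1) (uu _ b0 b1) ss st)).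
    by rewrite lerD2r ler_pM2r// invr_gt0 mass_gt0.
  have e1 : `|limit_map (cpt y) - limit_map (cpt z)| <= D i.
    exact: le_trans (le_eucl_dist1 (planar_map (cpt y)) (planar_map (cpt z))) dD.
  have e2 : `|limit_map (swap (cpt y)) - limit_map (swap (cpt z))| <= D i.
    exact: le_trans (le_eucl_dist2 (planar_map (cpt y)) (planar_map (cpt z))) dD.
  split.
    apply: (key y.1 z.1 (cantor_pt y.2) (cantor_pt z.2)) => //;
      by apply: surviving_cantor_pt; exact: uu.
  apply: (key y.2 z.2 (cantor_pt y.1) (cantor_pt z.1)) => //;
    by apply: surviving_cantor_pt; exact: uu.
pose V i := [set y | sq y /\ U i (planar_map (cpt y))].
(* The square is centred at an arbitrary point of [V i], hence the half side [phi i]; an empty [V i]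
   leaves nothing to cover. *)
pose Q i : set (R * R) := if pselect (V i !=set0) is left ne then
  `[(projT1 (cid ne)).1 - phi i, (projT1 (cid ne)).1 + phi i]%classic `*`
  `[(projT1 (cid ne)).2 - phi i, (projT1 (cid ne)).2 + phi i]%classic else set0.
have mQ i : measurable (Q i).
  by rewrite /Q; case: pselect => // ne; apply: measurableX.
have lQ i : (leb2 R (Q i) <= (4 * c * h (D i))%:E)%E.
  have itvE (a : R) : lebesgue_measure (`[a - phi i, a + phi i]%classic : set R) = (2 * phi i)%:E.
    rewrite lebesgue_measure_itv/= lte_fin.
    case: ifPn => [_|]; first by rewrite -EFinB; congr (_%:E); ring.
    by rewrite -leNgt => h1; congr (_%:E); have := phi0 i; lra.
  rewrite /Q; case: pselect => [ne|_]; last first.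
    rewrite measure0 lee_fin; apply: mulr_ge0 => //; apply: mulr_ge0 => //; exact: ltW.
  rewrite [X in (X <= _)%E](_ : _ = ((2 * phi i)%:E * (2 * phi i)%:E)%E).
    by rewrite -EFinM lee_fin -mulrA -phi2; lra.
  set I1 := [set` _]; set I2 := [set` _].
  rewrite -[X in (X * _)%E](itvE (projT1 (cid ne)).1) -(itvE (projT1 (cid ne)).2).
  by apply: product_measure1E; exact: measurable_itv.
have cover : sq `<=` \bigcup_i Q i.
  move=> y sy; have Cy : C' (planar_map (cpt y)).
    exists (cpt y) => //; have [/= + +] := sy.
    rewrite !in_itv/= => /andP[y0 y1] /andP[y0' y1'].
    by split; apply: surviving_cantor_pt; rewrite /unit_itv ltW.
  have [i _ Uy] := CU _ Cy; exists i => //.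
  have Vy : V i y by [].
  rewrite /Q; case: pselect => [ne|]; last by case; exists y.
  have [sz Uz] := projT2 (cid ne).
  have [h1 h2] := close i _ _ sz sy Uz Uy.
  move: h1 h2; rewrite !ler_norml => /andP[? ?] /andP[? ?].
  by split => /=; rewrite in_itv/=; apply/andP; split; lra.
have : (leb2 R sq <= \sum_(0 <= i <oo) leb2 R (Q i))%E.
  apply: measure_sigma_subadditive => //.
  exact: measurable_open_square.
rewrite (lebesgue_open_square : leb2 R sq = 1%:E) => le1.
rewrite -(@lee_pmul2l _ (4 * c)%:E)//; last by rewrite lte_fin mulr_gt0.
rewrite -EFinM divff; last by rewrite gt_eqF// mulr_gt0.
apply: (le_trans le1); rewrite -nneseriesZl; last by move=> i _; rewrite lee_fin.
apply: lee_nneseries => [i _ _|i _]; first exact: measure_ge0.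
by apply: (le_trans (lQ i)); rewrite EFinM.
Qed.

End planar_map.

End cantor_dynamics.

(** * Choice of the compression factors and the two asymptotic estimates *)

Section parameters.
Context {R : realType}.
Variables (gam w : R) (j0 : nat).
Hypotheses (gam_gt0 : 0 < gam) (w_gt0 : 0 < w) (w_lt1 : w < 1).
Hypothesis ln_j0 : 1 <= ln (j0%:R : R).

Definition shifted (b : nat) : R := (b + j0)%:R.
Definition xlnx (b : nat) : R := shifted b.+1 * ln (shifted b.+1).
(** The summand [gam] in the denominator makes [shrink] equal to [(1 + gam / xlnx b)^-1] exactly, to
    which [1 + t <= exp t] applies. *)
Definition compression (b : nat) : R := gam / (w * (xlnx b + gam)).

Lemma shifted_ge0 b : j0%:R <= shifted b.
Proof. by rewrite ler_nat leq_addl. Qed.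

Lemma j0_ge2 : 2 <= j0%:R :> R.
Proof.
rewrite ler_nat ltnNge; apply/negP => j1; move: ln_j0; rewrite leNgt => /negP; apply.
apply: (@le_lt_trans _ _ 0) => //; apply: ln_le0.
by case: (j0) j1 => [|[|]].
Qed.

Lemma shifted_ge2 b : 2 <= shifted b.
Proof. exact: le_trans j0_ge2 (shifted_ge0 b). Qed.

Lemma shiftedS b : shifted b.+1 = shifted b + 1.
Proof. by rewrite /shifted addSn -natr1. Qed.

Lemma ln_shifted_ge1 b : 1 <= ln (shifted b).
Proof.
apply: (le_trans ln_j0); rewrite ler_ln ?posrE ?shifted_ge0//.
  by have := j0_ge2; lra.
by have := shifted_ge2 b; lra.
Qed.

Lemma xlnx_ge b : shifted b.+1 <= xlnx b.
Proof.
by rewrite ler_peMr ?ln_shifted_ge1//; have := shifted_ge2 b.+1; lra.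
Qed.

Lemma xlnx_gt0 b : 0 < xlnx b.
Proof. by have := xlnx_ge b; have := shifted_ge2 b.+1; lra. Qed.

Lemma compression_gt0 b : 0 < compression b.
Proof. by rewrite divr_gt0// mulr_gt0// addr_gt0// xlnx_gt0. Qed.

Lemma compression_le b : compression b <= gam / (w * j0%:R).
Proof.
have j2 := j0_ge2; have xb := xlnx_ge b; have sb := shifted_ge0 b.+1.
have g0 := gam_gt0; have j00 : 0 < j0%:R :> R by lra.
have xg : 0 < xlnx b + gam by lra.
rewrite ler_pM2l// lef_pV2 ?posrE; [|exact: mulr_gt0|exact: mulr_gt0].
by rewrite ler_pM2l//; lra.
Qed.

Lemma ln_succ_le (x : R) : 2 <= x -> ln (x + 1) <= 2 * ln x.
Proof.
move=> x2; rewrite mulr_natl -lnXn ?ler_ln ?posrE ?exprn_gt0//; last 3 first.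
- by lra.
- by lra.
- by lra.
by rewrite expr2; nra.
Qed.

(** Each of the two factors of [xlnx] at most doubles from one index to the next. *)
Lemma compression_slow b : compression b <= 4 * compression b.+1.
Proof.
have x0 := xlnx_gt0 b; have x1 := xlnx_gt0 b.+1.
have h : xlnx b.+1 <= 4 * xlnx b.
  have s2 := shifted_ge2 b.+1; have l1 := ln_shifted_ge1 b.+1.
  have := ln_succ_le s2; rewrite -shiftedS => l2.
  have l3 := ln_shifted_ge1 b.+2.
  have sS := shiftedS b.+1.
  rewrite /xlnx.
  apply: (@le_trans _ _ ((2 * shifted b.+1) * (2 * ln (shifted b.+1)))); last by lra.
  by apply: ler_pM; lra.
rewrite /compression mulrA ler_pdivrMr ?mulr_gt0 ?addr_gt0//.
rewrite mulrAC ler_pdivlMr ?mulr_gt0 ?addr_gt0//.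
have := mulr_gt0 gam_gt0 w_gt0 => gw.
rewrite (_ : gam * (w * (xlnx b.+1 + gam)) = gam * w * (xlnx b.+1 + gam)); last by ring.
rewrite (_ : 4 * gam * (w * (xlnx b + gam)) = gam * w * (4 * (xlnx b + gam))); last by ring.
by have := gam_gt0; rewrite ler_pM2l//; lra.
Qed.

(* [1 / (x * ln x)] is the derivative of [ln (ln x)]. *)
Lemma lnln_increment b :
  (xlnx b)^-1 <= ln (ln (shifted b.+1)) - ln (ln (shifted b)).
Proof.
have s2 := shifted_ge2 b; have s2' := shifted_ge2 b.+1.
have l0 := ln_shifted_ge1 b; have l1 := ln_shifted_ge1 b.+1.
(* Used twice: for the outer logarithm, at the values of the inner one, and for the inner
   logarithm. *)
have key (x y : R) : 0 < x -> 0 < y -> 1 - x / y <= ln y - ln x.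
  move=> x0 y0; have : ln (1 + (x / y - 1)) <= x / y - 1.
    by apply: le_ln1Dx; have := divr_gt0 x0 y0; lra.
  rewrite [1 + _]addrC subrK lnM ?posrE ?invr_gt0// lnV ?posrE//.
  by lra.
have l0' : 0 < ln (shifted b) by lra.
have l1' : 0 < ln (shifted b.+1) by lra.
have s0' : 0 < shifted b by lra.
have s1' : 0 < shifted b.+1 by lra.
apply: (le_trans _ (key _ _ l0' l1')).
have k2 := key _ _ s0' s1'.
rewrite -[X in X - _](divff (lt0r_neq0 l1')) -mulrBl.
rewrite /xlnx invfM ler_pM2r ?invr_gt0//; apply: le_trans k2.
rewrite -[X in X - _](divff (lt0r_neq0 s1')) -mulrBl shiftedS.
by rewrite (addrC (shifted b)) addrK mul1r.
Qed.

(** Each factor is at least [exp (- gam / xlnx j)], and [1 / xlnx j] is at most an increment of the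
    iterated logarithm, so the exponents telescope; the nonnegative starting value is dropped. *)
Lemma mass_ge n : expR (- (gam * ln (ln (shifted n)))) <= mass (1 - w) compression n.
Proof.
have h0 : 0 <= ln (ln (shifted 0)) by apply: ln_ge0; exact: ln_shifted_ge1.
suff : expR (gam * (ln (ln (shifted 0)) - ln (ln (shifted n)))) <= mass (1 - w) compression n.
  apply: le_trans; rewrite ler_expR -mulrN ler_pM2l//; lra.
elim: n => [|n ih]; first by rewrite subrr mulr0 expR0 /mass big_ord0.
rewrite massS.
have -> : gam * (ln (ln (shifted 0)) - ln (ln (shifted n.+1))) =
    gam * (ln (ln (shifted 0)) - ln (ln (shifted n))) +
    - (gam * (ln (ln (shifted n.+1)) - ln (ln (shifted n)))) by ring.
rewrite expRD ler_pM ?expR_ge0//.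
have x0 := xlnx_gt0 n; have xg : 0 < xlnx n + gam by rewrite addr_gt0.
have -> : shrink (1 - w) compression n = (1 + gam / xlnx n)^-1.
  rewrite /shrink /compression; field.
  by rewrite !gt_eqF//.
rewrite expRN lef_pV2 ?posrE ?expR_gt0 ?addr_gt0 ?divr_gt0//.
apply: (le_trans (expR_ge1Dx _)); rewrite ler_expR ler_pM2l//.
exact: lnln_increment.
Qed.

(** With [k = shifted b.+1], the distortion is at most [Kb = c0 * (k * ln k + gam)] and
    [ln Kb >= ln k], so the ratio in the exponent is at most [c0 * (k + gam)]. This is linear in
    [b], and the series compares with a geometric one. *)
Lemma series_parameters (L0 p : R) (N : nat) :
  0 < p -> 1 <= L0 -> p * L0 < 2 * gam ->
  (forall b, (1 - w) ^- 2 + 4 / (N%:R ^+ 2 * (1 - w)) + 4 * compression b <= L0) ->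
  (forall b, 1 <= distortion_bound N (1 - w) compression b) ->
  expR (gam / (L0 * w)) <= j0%:R ->
  cvgn (series (fun b => expR (p * (distortion_bound N (1 - w) compression b /
    (1 + ln (distortion_bound N (1 - w) compression b)))) * ((1 - w) ^+ b) ^+ 2)).
Proof.
move=> p0 L1 pL Lb d1 j0L; pose c0 := L0 * w / gam.
have L00 : 0 < L0 by lra.
have c00 : 0 < c0 by rewrite divr_gt0// mulr_gt0.
have ratio_le b : distortion_bound N (1 - w) compression b /
    (1 + ln (distortion_bound N (1 - w) compression b)) <= c0 * (shifted b.+1 + gam).
  have x0 := xlnx_gt0 b; have s2 := shifted_ge2 b.+1; have l1 := ln_shifted_ge1 b.+1.
  pose Kb := c0 * (xlnx b + gam).
  have dK : distortion_bound N (1 - w) compression b <= Kb.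
    have -> : Kb = L0 / compression b.
      rewrite /Kb /c0 /compression; field.
      by rewrite !gt_eqF// addr_gt0.
    by rewrite /distortion_bound ler_pM2r ?invr_gt0 ?compression_gt0.
  apply: (le_trans (ratio_ln_le (d1 b) dK)).
  (* The lower bound on [j0] gives [c0 * ln k >= 1] for [k = shifted b.+1], hence
     [Kb >= c0 * k * ln k >= k]. *)
  have Kl : ln (shifted b.+1) <= ln Kb.
    rewrite ler_ln ?posrE; [|lra|by rewrite mulr_gt0// addr_gt0].
    have lj : gam / (L0 * w) <= ln (shifted b.+1).
      rewrite -[leLHS]expRK ler_ln ?posrE ?expR_gt0//.
      exact: le_trans (shifted_ge0 _).
    have : 1 <= c0 * ln (shifted b.+1).
      apply: (@le_trans _ _ (c0 * (gam / (L0 * w)))); last by rewrite ler_pM2l.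
      rewrite le_eqVlt; apply/orP; left; apply/eqP; rewrite /c0; field.
      by rewrite !gt_eqF.
    move=> cl; apply: (@le_trans _ _ (c0 * xlnx b)); last by rewrite ler_pM2l// lerDl ltW.
    by rewrite /xlnx mulrCA ler_peMr//; lra.
  have Kl0 : 0 < 1 + ln Kb by lra.
  rewrite ler_pdivrMr// {1}/Kb -[leRHS]mulrA ler_pM2l// /xlnx.
  apply: (@le_trans _ _ ((shifted b.+1 + gam) * (1 + ln (shifted b.+1)))).
    by have := gam_gt0; nra.
  by rewrite ler_pM2l; [lra|have := gam_gt0; lra].
pose r := expR (p * c0) * (1 - w) ^+ 2.
have r0 : 0 <= r by rewrite mulr_ge0 ?expR_ge0// sqr_ge0.
(* From [1 - w <= exp (- w)] one gets [r <= exp (p * c0 - 2 * w)], and [p * c0 < 2 * w] is the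
   hypothesis [p * L0 < 2 * gam]. *)
have r1 : r < 1.
  have h : (1 - w) ^+ 2 <= expR (- (2 * w)).
    have -> : - (2 * w) = - w + - w by ring.
    by rewrite expRD expr2 ler_pM ?subr_ge0 ?(ltW w_lt1)// expR_ge1Dx.
  apply: (@le_lt_trans _ _ (expR (p * c0) * expR (- (2 * w)))).
    by rewrite ler_wpM2l// expR_ge0.
  rewrite -expRD -[ltRHS]expR0 ltr_expR subr_lt0.
  by rewrite /c0 mulrA ltr_pdivrMr// mulrA [ltRHS]mulrAC ltr_pM2r.
pose a := expR (p * (c0 * (1 + j0%:R + gam))).
apply: (series_le_cvg (v_ := geometric a r)).
- by move=> n; rewrite mulr_ge0 ?expR_ge0// sqr_ge0.
- by move=> n; rewrite /geometric/= mulr_ge0 ?expR_ge0// exprn_ge0.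
- move=> n; rewrite /geometric/= /r exprMn [leRHS]mulrA -exprM mulnC exprM.
  rewrite ler_wpM2r ?exprn_ge0 ?subr_ge0 ?(ltW w_lt1)//.
  rewrite /a -expRM_natl -expRD ler_expR.
  apply: (@le_trans _ _ (p * (c0 * (shifted n.+1 + gam)))); first by rewrite ler_pM2l.
  by rewrite /shifted addSn -natr1 natrD; lra.
- by apply: is_cvg_geometric_series; rewrite ger0_norm.
Qed.

(** The depth [n] is matched to [y]. Either [N ^- n <= D ^ 2], and [y ^ 2] is bounded by a multiple
    of [D ^ 2], or [n <= ln (1 / D)], and [mass_ge] turns [mass n ^- 2] into a power
    [beta = 2 * gam] of the iterated logarithm. *)
Lemma gauge_parameters (beta : R) (N : nat) : gam = beta / 2 -> 0 < beta ->
  expR 2 <= N%:R :> R ->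
  exists c d0 : R, [/\ 0 < c, 0 < d0 & forall y D : R, 0 <= y <= 1 -> 0 <= D <= d0 ->
    (forall n, y <= D / mass (1 - w) compression n + 2 * (N%:R^-1) ^+ n) ->
    y ^+ 2 <= c * h2 beta D].
Proof.
move=> gE beta0 N2.
have N1 : 1 < N%:R :> R by apply: lt_le_trans N2; rewrite -expR0 ltr_expR.
have N0 : 0 < N%:R :> R by lra.
pose M := 1 + ln (1 + j0%:R : R).
have M1 : 1 <= M by rewrite lerDl ln_ge0// lerDl.
have Mb : 0 <= M `^ beta by exact: powR_ge0.
(* One summand for each of the two cases. The bound on [D] gives [ln (1 / D) >= e], so the iterated
   logarithm [T] is at least 1. *)
exists (16 * N%:R ^+ 2 + 4 * M `^ beta), (expR (- expR 1)); split.
- by rewrite ltr_pwDl ?mulr_gt0 ?exprn_gt0// mulr_ge0.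
- exact: expR_gt0.
move=> y D /andP[y0 y1] /andP[D0 Dd] hy.
have c0 : 0 <= 16 * N%:R ^+ 2 + 4 * M `^ beta.
  by rewrite addr_ge0// mulr_ge0// sqr_ge0.
have hD0 : 0 <= h2 beta D.
  by rewrite /h2; case: ifP => // _; rewrite mulr_ge0 ?sqr_ge0// powR_ge0.
have [->|yn0] := eqVneq y 0; first by rewrite expr0n mulr_ge0.
have yp : 0 < y by rewrite lt_neqAle eq_sym yn0.
have r1 : `|N%:R^-1 : R| < 1 by rewrite ger0_norm ?invr_ge0 ?(ltW N0)// invf_lt1.
have ex : exists n, (N%:R^-1 : R) ^+ n <= y / 4.
  have := cvg_expr r1 => /cvgrPdist_le /(_ (y / 4)); rewrite divr_gt0// => /(_ isT)[n _ hn].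
  exists n; have := hn n (leqnn n); rewrite /= sub0r normrN; apply: le_trans.
  exact: ler_norm.
(* For this [n] the error [2 * N ^- n] is absorbed in [y / 2], while minimality gives
   [y <= 4 * N * N ^- n]. *)
pose n := ex_minn ex; have [nle nmin] : (N%:R^-1 : R) ^+ n <= y / 4 /\
    forall k, (N%:R^-1 : R) ^+ k <= y / 4 -> (n <= k)%N by rewrite /n; case: ex_minnP.
have n0 : (0 < n)%N.
  by rewrite lt0n; apply/eqP => e; move: nle; rewrite e expr0; lra.
have yN : y <= 4 * N%:R * (N%:R^-1) ^+ n.
  have nlt : y / 4 < (N%:R^-1) ^+ n.-1.
    by rewrite ltNge; apply/negP => /nmin; rewrite -ltnS prednK// ltnn.
  by rewrite -(prednK n0) exprS -mulrA mulVKf ?gt_eqF//; lra.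
set rn := (N%:R^-1 : R) ^+ n in nle yN.
have rn0 : 0 < rn by rewrite exprn_gt0// invr_gt0.
have rn1 : rn <= 1 by lra.
have lmass := mass_ge n.
set mm := mass _ _ n in lmass.
have mm0 : 0 < mm by apply: lt_le_trans lmass; exact: expR_gt0.
have y2 : y / 2 <= D / mm by have := hy n; rewrite -/rn -/mm; lra.
have Dp : 0 < D.
  rewrite lt_neqAle D0 andbT; apply/eqP => e.
  by move: y2; rewrite -e mul0r; lra.
have lD : expR 1 <= ln D^-1.
  by rewrite lnV ?posrE// lerNr -[leRHS]expRK ler_ln ?posrE ?expR_gt0.
have lD0 : 0 < ln D^-1 by apply: lt_le_trans lD; exact: expR_gt0.
set T := ln (ln D^-1).
have T1 : 1 <= T by rewrite /T -[leLHS]expRK ler_ln ?posrE ?expR_gt0.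
have TbE : h2 beta D = D ^+ 2 * T `^ beta by rewrite /h2 leNgt Dp.
have Tb1 : 1 <= T `^ beta.
  have <- : 1 `^ beta = 1 :> R by rewrite powR1.
  by apply: ge0_ler_powR; rewrite ?nnegrE ?(ltW beta0)//; lra.
rewrite TbE; have [Dr|Dr] := leP rn (D ^+ 2).
  apply: (@le_trans _ _ (16 * N%:R ^+ 2 * (D ^+ 2 * T `^ beta))); last first.
    rewrite ler_wpM2r ?mulr_ge0 ?sqr_ge0 ?powR_ge0// lerDl mulr_ge0//.
  apply: (@le_trans _ _ ((4 * N%:R * rn) ^+ 2)).
    by rewrite !expr2 ler_pM// ltW.
  rewrite (_ : _ ^+ 2 = 16 * N%:R ^+ 2 * rn ^+ 2); last by ring.
  rewrite ler_wpM2l ?mulr_ge0 ?sqr_ge0//.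
  apply: (@le_trans _ _ (D ^+ 2)); last by rewrite ler_peMr// sqr_ge0.
  by apply: le_trans Dr; rewrite expr2 ler_piMr// ltW.
have s2 := shifted_ge2 n; have l1 := ln_shifted_ge1 n.
have nR : 1 <= n%:R :> R by rewrite ler1n.
(* [D ^ 2 < N ^- n] means [n * ln N < 2 * ln (1 / D)], and [ln N >= 2] because [N >= exp 2]. *)
have lnT : ln n%:R <= T.
  rewrite /T ler_ln ?posrE ?ltr0n//.
  have : ln (D ^+ 2) < ln rn by rewrite ltr_ln ?posrE // exprn_gt0.
  have -> : ln rn = - (n%:R * ln N%:R).
    by rewrite /rn lnXn ?invr_gt0// lnV ?posrE// mulr_natl mulNrn.
  rewrite lnXn// lnV ?posrE//.
  have : 2 <= ln N%:R :> R by rewrite -[leLHS]expRK ler_ln ?posrE ?expR_gt0.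
  move=> lN2; have : n%:R * 2 <= n%:R * ln N%:R :> R by rewrite ler_wpM2l.
  by rewrite mulr2n; lra.
have lM : ln (shifted n) <= M * T.
  apply: (@le_trans _ _ (ln n%:R + ln (1 + j0%:R))).
    rewrite -lnM ?posrE; [|lra|by have := j0_ge2; lra].
    rewrite ler_ln ?posrE; [|lra|].
      by rewrite /shifted natrD; have := j0_ge2; nra.
    by apply: mulr_gt0; have := j0_ge2; lra.
  have : 0 <= ln (1 + j0%:R : R) by rewrite ln_ge0// lerDl.
  by rewrite /M; nra.
have imm : mm^-1 ^+ 2 <= M `^ beta * T `^ beta.
  rewrite -powRM; [|lra|lra].
  apply: (@le_trans _ _ (ln (shifted n) `^ beta)); last first.
    by rewrite ge0_ler_powR ?nnegrE ?(ltW beta0)//; [lra|rewrite mulr_ge0//; lra].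
  have -> : ln (shifted n) `^ beta = (expR (gam * ln (ln (shifted n)))) ^+ 2.
    rewrite /powR gt_eqF; last by lra.
    by rewrite -expRM_natl; congr expR; rewrite gE; field.
  have le1 : mm^-1 <= expR (gam * ln (ln (shifted n))).
    by rewrite -[leRHS]invrK lef_pV2 ?posrE ?invr_gt0 ?expR_gt0// -expRN.
  by rewrite !expr2 ler_pM// invr_ge0 ltW.
apply: (@le_trans _ _ (4 * M `^ beta * (D ^+ 2 * T `^ beta))); last first.
  by rewrite ler_wpM2r ?mulr_ge0 ?sqr_ge0 ?powR_ge0// lerDr mulr_ge0// sqr_ge0.
apply: (@le_trans _ _ ((2 * (D / mm)) ^+ 2)).
  have h : y <= 2 * (D / mm) by lra.
  by rewrite !expr2 ler_pM// ltW.
rewrite (_ : _ ^+ 2 = 4 * D ^+ 2 * mm^-1 ^+ 2); last by ring.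
rewrite [leRHS](_ : _ = 4 * D ^+ 2 * (M `^ beta * T `^ beta)); last by ring.
by rewrite ler_wpM2l// mulr_ge0// sqr_ge0.
Qed.

End parameters.

Theorem mainTheorem3 (R : realType) (beta eps : R)
    (beta_gt0 : 0 < beta) (eps_gt0 : 0 < eps) (eps_lt_beta : eps < beta) :
  exists (C C' : set (R * R)) (f : R * R -> R * R) (Df : R * R -> 'M[R]_2),
    [/\ C `<=` closed_square R /\ C' `<=` closed_square R,
        (hausdorff_dim C < 2%:E)%E /\
          (0 < hausdorff_measure (h2 beta) C')%E,
        finite_distortion (closed_square R) f Df /\
          sobolev11 (open_square R) f Df,
        Lp_loc (beta - eps) (open_square R)
          (fun x => expR (distortion Df x / (1 + ln (distortion Df x)))) &
        f @` C = C'].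
Proof.
pose p := beta - eps; pose gam := beta / 2.
have p0 : 0 < p by rewrite subr_gt0.
have gam0 : 0 < gam by rewrite divr_gt0.
pose d := eps / p.
have d0 : 0 < d by rewrite divr_gt0.
have pd : p * d = eps by rewrite /d mulrCA divff ?mulr1// gt_eqF.
(* As [p * (1 + d) = beta], this leaves [d / 4] to spare, and the three summands of
   [distortion_bound] may each exceed their limits 1, 0 and 0 by [d / 4]. *)
pose L0 := 1 + 3 * d / 4.
have L1 : 1 <= L0 by rewrite /L0; lra.
have pL : p * L0 < 2 * gam.
  have -> : p * L0 = p + 3 / 4 * (p * d) by rewrite /L0; field.
  by rewrite pd /p /gam; lra.
(* For [w <= 1 / 4] one has [(1 - w) ^- 2 <= 1 + 4 * w], and [4 * w <= d / 4]. *)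
pose w := Num.min (4^-1) (d / 16).
have w0 : 0 < w by rewrite lt_min invr_gt0 ltr0n/= divr_gt0.
have w4 : w <= 1 / 4 by rewrite ge_min div1r lexx.
have wd : w <= d / 16 by rewrite ge_min lexx orbT.
have w1 : w < 1 by lra.
have sg0 : 0 < 1 - w by lra.
have sg1 : 1 - w < 1 by lra.
have nat_above (x : R) : 0 <= x -> exists n : nat, x < n%:R.
  by move=> x0; exists (Num.bound x); exact: archi_boundP.
(* [exp 2] is required by the gauge estimate; 8 and [32 / d] make the shear term at most [d / 4]. *)
have [N hN] : exists N : nat, expR 2 + 8 + 32 / d < N%:R :> R.
  by apply: nat_above; rewrite !addr_ge0 ?expR_ge0// divr_ge0// ltW.
have d32 : 0 < 32 / d by rewrite divr_gt0.
have e2 := expR_gt0 (2 : R).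
have N8 : 8 < N%:R :> R by lra.
have N1 : (1 < N)%N by rewrite -(ltr_nat R); lra.
have N0 : (0 < N)%N by apply: ltn_trans N1.
(* In this order, the summands give [ln j0 >= 1], the hypothesis of the series estimate,
   [m b <= 1 / 2] and [m b <= d / 16]. *)
have [j0 hj] : exists j0 : nat,
    expR 1 + expR (gam / (L0 * w)) + 2 * (gam / w) + 16 / d * (gam / w) < j0%:R :> R.
  apply: nat_above; rewrite !addr_ge0 ?expR_ge0// mulr_ge0// ?divr_ge0//; exact: ltW.
have gw : 0 < gam / w by rewrite divr_gt0.
have e1 := expR_gt0 (1 : R); have eL := expR_gt0 (gam / (L0 * w)).
have d16 : 0 < 16 / d * (gam / w) by rewrite mulr_gt0// divr_gt0.
have j00 : 0 < j0%:R :> R by lra.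
have lnj : 1 <= ln (j0%:R : R).
  by rewrite -[leLHS]expRK ler_ln ?posrE ?expR_gt0//; lra.
pose m := compression gam w j0.
have mj b : m b <= gam / (w * j0%:R) by exact: compression_le.
have m0 b : 0 < m b by exact: compression_gt0.
have qE : gam / (w * j0%:R) = gam / w / j0%:R by rewrite invfM mulrA.
have m12 b : m b <= 1 / 2.
  by apply: (le_trans (mj b)); rewrite qE ler_pdivrMr//; lra.
have m16 b : m b <= d / 16.
  apply: (le_trans (mj b)); rewrite qE ler_pdivrMr//.
  have : d / 16 * (16 / d * (gam / w)) = gam / w by field; rewrite !gt_eqF.
  have dj : d / 16 * (16 / d * (gam / w)) <= d / 16 * j0%:R.
    by rewrite ler_pM2l ?divr_gt0//; lra.
  by move=> <-.
have m1 b : m b < 1 by have := m12 b; lra.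
have m_slow j : m j <= 4 * m j.+1 by exact: compression_slow.
have sgi : 1 <= (1 - w) ^- 2 by rewrite invf_ge1 ?exprn_gt0// expr2; nra.
have sgL : (1 - w) ^- 2 <= 1 + d / 4.
  apply: (@le_trans _ _ (1 + 4 * w)); last by lra.
  by rewrite -[leLHS]mul1r ler_pdivrMr ?exprn_gt0// expr2; nra.
have NL0 : 0 < 4 / (N%:R ^+ 2 * (1 - w)).
  by rewrite divr_gt0// mulr_gt0// exprn_gt0// ltr0n.
have NL : 4 / (N%:R ^+ 2 * (1 - w)) <= d / 4.
  rewrite ler_pdivrMr; last by rewrite mulr_gt0// exprn_gt0// ltr0n.
  have dN : 32 <= d * N%:R.
    by rewrite mulrC -ler_pdivrMr//; lra.
  have sN : 6 <= N%:R * (1 - w) by nra.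
  have -> : d / 4 * (N%:R ^+ 2 * (1 - w)) = (d * N%:R) * (N%:R * (1 - w)) / 4 by field.
  by nra.
have bound_le b : (1 - w) ^- 2 + 4 / (N%:R ^+ 2 * (1 - w)) + 4 * m b <= L0.
  by have := m16 b; rewrite /L0; lra.
have bound_ge1 b : 1 <= distortion_bound N (1 - w) m b.
  rewrite /distortion_bound ler_pdivlMr// mul1r.
  by have := m0 b; have := m1 b; lra.
have [c [t0 [c0 t00 hc]]] : exists c t0 : R, [/\ 0 < c, 0 < t0 &
    forall y D : R, 0 <= y <= 1 -> 0 <= D <= t0 ->
      (forall n, y <= D / mass (1 - w) m n + 2 * (N%:R^-1) ^+ n) -> y ^+ 2 <= c * h2 beta D].
  by apply: gauge_parameters => //; lra.
have h2_ge0 (t : R) : 0 <= h2 beta t.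
  by rewrite /h2; case: ifP => // _; rewrite mulr_ge0 ?sqr_ge0// powR_ge0.
exists (surviving N (1 - w) `*` surviving N (1 - w)).
exists (planar_map N (1 - w) m @` (surviving N (1 - w) `*` surviving N (1 - w))).
exists (planar_map N (1 - w) m), (Dmap N (1 - w) m); split => //.
- by split; [exact: surviving_closed_square|exact: image_closed_square].
- by split; [exact: hausdorff_dim_surviving|exact: hausdorff_measure_image c0 t00 hc].
- by split; [exact: finite_distortion_planar_map|exact: sobolev11_planar_map].
- apply: Lp_loc_distortion => //; first exact: ltW.
  by apply: (@series_parameters _ gam w j0 gam0 w0 w1 lnj L0 p N) => //; lra.
Qed.
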